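(* Let $k\geq2$ and for $1\leq i\leq k$ let $B_i=\begin{pmatrix}a_i&b_i\\c_i&d_i\end{pmatrix}$ with $a_i,b_i,c_i,d_i$ positive integers and $|a_id_i-c_ib_i|=1$. Let $\theta$ be the left shift on $\{1,\dots,k\}^{\mathbb{Z}}$, let $\Omega_s\subset\{1,\dots,k\}^{\mathbb{Z}}$ be an Arnoux-Rauzy subshift, and let $\mathbb{P}$ be the unique $\theta$-invariant Borel probability measure on $\Omega_s$. For $\omega=(\dots,\omega_{-1},\omega_0,\omega_1,\dots)\in\Omega_s$ let $F_\omega:\mathbb{T}^2\to\mathbb{T}^2$ be the toral automorphism induced by $B_{\omega_0}$, and let $\Theta:\Omega_s\times\mathbb{T}^2\to\Omega_s\times\mathbb{T}^2$, $\Theta(\omega,x)=(\theta\omega,F_\omega x)$. Let $\varphi\in C(\Omega_s\times\mathbb{T}^2,\mathbb{R})$ and assume that $I_\varphi\neq\varnothing$. Then for $\mathbb{P}$-a.e. $\omega\in\Omega_s$: (1) $h_{top}(F,I_\varphi(\omega),\omega)=h_{top}(F)$; (2) $I_\varphi(\omega)$ is residual in $\mathbb{T}^2$. Moreover, $I_\varphi$ is dense in $\Omega_s\times\mathbb{T}^2$.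
   Context: An Arnoux-Rauzy subshift on $k$ symbols is a minimal two-sided subshift of $\{1,\dots,k\}^{\mathbb{Z}}$ whose language has, for every length $n$, exactly one right special word and exactly one left special word of length $n$, each of which can be extended (to the right, respectively to the left) by all $k$ letters (for $k=2$: Sturmian subshifts). Such subshifts are minimal and uniquely ergodic (known fact). Irregular set: $I_\varphi=\{(\omega,x):\lim_{n\to\infty}\frac1n\sum_{i=0}^{n-1}\varphi(\Theta^i(\omega,x))\text{ does not exist}\}$ and $I_\varphi(\omega)=\{x\in\mathbb{T}^2:(\omega,x)\in I_\varphi\}$. A residual set is the complement of a set of first category. Write $M=\mathbb{T}^2$, $F_\omega^n=F_{\theta^{n-1}\omega}\circ\cdots\circ F_\omega$ ($F^0_\omega=\mathrm{id}$). Fiber Bowen's metric and balls: $d_\omega^n(x,y)=\max_{0\leq i\leq n-1}d_M(F_\omega^ix,F_\omega^iy)$ and $\mathcal{B}_n(\omega,x,\epsilon)=\{y\in M:d_\omega^n(x,y)<\epsilon\}$. Fiber Bowen's topological entropy: for $Z\subset M$, $s\in\mathbb{R}$, $\epsilon>0$, $N\in\mathbb{N}$, let $m(Z,s,\omega,N,\epsilon)=\inf\sum_i e^{-sn_i}$, the infimum over all finite or countable collections $\{\mathcal{B}_{n_i}(\omega,x_i,\epsilon)\}_i$ covering $Z$ with $\min n_i\geq N$; let $m(Z,s,\omega,\epsilon)=\lim_{N\to\infty}m(Z,s,\omega,N,\epsilon)$. $h_{top}(F,Z,\omega,\epsilon)$ is the critical value of $s$ such that $m(Z,s,\omega,\epsilon)=+\infty$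 for $s$ below it and $=0$ for $s$ above it. Finally $h_{top}(F,Z,\omega)=\lim_{\epsilon\to0}h_{top}(F,Z,\omega,\epsilon)=\sup_{\epsilon>0}h_{top}(F,Z,\omega,\epsilon)$. Fiber topological entropy: $h_{top}(F)=\lim_{\epsilon\to0}\limsup_{n\to\infty}\frac1n\int\log Z(\omega,\epsilon,n)\,d\mathbb{P}(\omega)$, where $Z(\omega,\epsilon,n)$ is the largest cardinality of a set $Q\subset M$ such that $d_\omega^n(x,y)>\epsilon$ for all distinct $x,y\in Q$. *)

(* Defs.v *)
From HB Require Import structures.
From mathcomp Require Import all_boot all_order all_algebra.
From mathcomp Require Import generic_quotient finmap.
From mathcomp Require Import all_classical all_reals all_analysis.
From mathcomp Require Import ring lra.

Set Implicit Arguments.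
Unset Strict Implicit.
Unset Printing Implicit Defensive.

Import Order.TTheory GRing.Theory Num.Theory.
Import numFieldNormedType.Exports.

Local Open Scope quotient_scope.
Local Open Scope classical_set_scope.
Local Open Scope ring_scope.

Section Torus.
Context {R : realType}.
Implicit Types u v w : 'cV[R]_2.

Definition lattice_equiv u v : bool :=
  [forall i, (u - v) i 0 \is a Num.int].

Lemma lattice_equivP u v :
  reflect (exists m : 'cV[int]_2, u = v + map_mx intr m) (lattice_equiv u v).
Proof.
apply: (iffP forallP) => [uv|[m ->] i].
  exists (\col_i Num.floor ((u - v) i 0)); apply/colP => i.
  by have := uv i; rewrite !mxE intrEfloor => /eqP ->; rewrite addrC subrK.
by rewrite !mxE (addrC (v i 0)) addrK intr_int.
Qed.

Lemma lattice_equiv_refl : reflexive lattice_equiv.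
Proof. by move=> u; apply/forallP => i; rewrite subrr mxE rpred0. Qed.

Lemma lattice_equiv_sym : symmetric lattice_equiv.
Proof.
by move=> u v; apply/forallP/forallP => uv i; have := uv i;
  rewrite -opprB mxE rpredN.
Qed.

Lemma lattice_equiv_trans : transitive lattice_equiv.
Proof.
move=> v u w /forallP uv /forallP vw; apply/forallP => i.
have -> : u - w = (u - v) + (v - w) by rewrite addrA subrK.
by rewrite mxE rpredD.
Qed.

Canonical lattice_equivRel :=
  EquivRel lattice_equiv lattice_equiv_refl lattice_equiv_sym
    lattice_equiv_trans.

Definition euclid_norm v : R := Num.sqrt (\sum_i v i 0 ^+ 2).

End Torus.

Definition torus (R : realType) : Type := {eq_quot (@lattice_equiv R)}.

Section TorusMetric.
Context {R : realType}.
Implicit Types (u v : 'cV[R]_2) (x y z : torus R) (m : 'cV[int]_2).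

HB.instance Definition _ := Choice.copy (torus R) {eq_quot (@lattice_equiv R)}.

Definition torus_pi (v : 'cV[R]_2) : torus R :=
  \pi_({eq_quot (@lattice_equiv R)}) v.

Definition torus_repr (x : torus R) : 'cV[R]_2 :=
  repr (x : {eq_quot (@lattice_equiv R)}).

Lemma torus_reprK : cancel torus_repr torus_pi.
Proof. exact: reprK. Qed.

Lemma torus_pi_eqP u v :
  reflect (exists m, u = v + map_mx intr m) (torus_pi u == torus_pi v).
Proof.
rewrite /torus_pi (eqmodE (@lattice_equivRel R)).
exact: lattice_equivP.
Qed.

Lemma torus_repr_piE v :
  exists m : 'cV[int]_2, torus_repr (torus_pi v) = v + map_mx intr m.
Proof. by apply/torus_pi_eqP/eqP; exact: torus_reprK. Qed.

Definition lift_norms u v : set R :=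
  [set euclid_norm (u - v + map_mx intr m) | m in [set: 'cV[int]_2]].

Definition torus_dist x y : R := inf (lift_norms (torus_repr x) (torus_repr y)).

Let norm_ge0 u : 0 <= euclid_norm u. Proof. exact: sqrtr_ge0. Qed.

Let normE u : euclid_norm u = Num.sqrt (u 0 0 ^+ 2 + u 1 0 ^+ 2).
Proof.
rewrite /euclid_norm big_ord_recl big_ord1; congr (Num.sqrt (_ + u _ _ ^+ 2)).
exact/val_inj.
Qed.

Let norm_le_coord u i : `|u i 0| <= euclid_norm u.
Proof.
rewrite -sqrtr_sqr ler_sqrt; last by apply: sumr_ge0 => j _; exact: sqr_ge0.
by rewrite (bigD1 i) //= lerDl; apply: sumr_ge0 => j _; exact: sqr_ge0.
Qed.

Let normD u v : euclid_norm (u + v) <= euclid_norm u + euclid_norm v.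
Proof.
rewrite !normE !mxE.
move: (u 0 0) (u 1 0) (v 0 0) (v 1 0) => a b c d.
set p := Num.sqrt (a ^+ 2 + _); set q := Num.sqrt (c ^+ 2 + _).
have p0 : 0 <= p by exact: sqrtr_ge0.
have q0 : 0 <= q by exact: sqrtr_ge0.
have pE : p ^+ 2 = a ^+ 2 + b ^+ 2 by rewrite sqr_sqrtr // addr_ge0 ?sqr_ge0.
have qE : q ^+ 2 = c ^+ 2 + d ^+ 2 by rewrite sqr_sqrtr // addr_ge0 ?sqr_ge0.
have pq : a * c + b * d <= p * q.
  apply: (le_trans (ler_norm _)).
  rewrite -(ger0_norm (mulr_ge0 p0 q0)) -ler_sqr ?nnegrE // !real_normK ?num_real //.
  rewrite exprMn pE qE -subr_ge0.
  suff -> : (a ^+ 2 + b ^+ 2) * (c ^+ 2 + d ^+ 2) - (a * c + b * d) ^+ 2 =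
    (a * d - b * c) ^+ 2 by exact: sqr_ge0.
  ring.
rewrite -(ger0_norm (addr_ge0 p0 q0)) -sqrtr_sqr ler_sqrt ?sqr_ge0 //.
rewrite [X in _ <= X]sqrrD pE qE.
nra.
Qed.

Let normN u : euclid_norm (- u) = euclid_norm u.
Proof. by congr Num.sqrt; apply: eq_bigr => i _; rewrite mxE sqrrN. Qed.

Let norm0 : euclid_norm (0 : 'cV[R]_2) = 0.
Proof.
by rewrite /euclid_norm big1 ?sqrtr0 // => i _; rewrite mxE expr0n.
Qed.

Let has_inf_lift u v : has_inf (lift_norms u v).
Proof.
split; first by exists (euclid_norm (u - v + map_mx intr (0 : 'cV[int]_2))), 0.
by exists 0 => _ [m _ <-]; exact: norm_ge0.
Qed.

Let torus_dist_ge0 x y : 0 <= torus_dist x y.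
Proof.
apply: lb_le_inf; first by case: (has_inf_lift (torus_repr x) (torus_repr y)).
by move=> _ [m _ <-]; exact: norm_ge0.
Qed.

Let torus_dist_le x y m :
  torus_dist x y <= euclid_norm (torus_repr x - torus_repr y + map_mx intr m).
Proof.
by apply: ge_inf; [case: (has_inf_lift (torus_repr x) (torus_repr y))|exists m].
Qed.

Let torus_dist_lt x y e : torus_dist x y < e -> exists m,
  euclid_norm (torus_repr x - torus_repr y + map_mx intr m) < e.
Proof.
move=> /(inf_lt (proj1 (has_inf_lift _ _))) [_ [m _ <-] mE].
by exists m.
Qed.

Let torus_distxx x : torus_dist x x = 0.
Proof.
apply/eqP; rewrite eq_le torus_dist_ge0 andbT.
by apply: (le_trans (torus_dist_le x x 0)); rewrite map_mx0 addr0 subrr norm0.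
Qed.

Let torus_dist_sym_le x y : torus_dist y x <= torus_dist x y.
Proof.
apply: lb_le_inf; first by case: (has_inf_lift (torus_repr x) (torus_repr y)).
move=> _ [m _ <-]; rewrite -normN opprD opprB -map_mxN.
exact: torus_dist_le.
Qed.

Let torus_dist_sym x y : torus_dist x y = torus_dist y x.
Proof. by apply/eqP; rewrite eq_le !torus_dist_sym_le. Qed.

Let torus_dist_triangle y x z :
  torus_dist x z <= torus_dist x y + torus_dist y z.
Proof.
apply/ler_addgt0Pl => e e0.
have e2 : 0 < e / 2 by rewrite divr_gt0.
have [|m1 h1] := @torus_dist_lt x y (torus_dist x y + e / 2).
  by rewrite ltrDl.
have [|m2 h2] := @torus_dist_lt y z (torus_dist y z + e / 2).
  by rewrite ltrDl.
have := torus_dist_le x z (m1 + m2).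
have -> : torus_repr x - torus_repr z + map_mx intr (m1 + m2) =
    (torus_repr x - torus_repr y + map_mx intr m1) +
    (torus_repr y - torus_repr z + map_mx intr m2).
  rewrite map_mxD; apply/colP => i; rewrite !mxE; ring.
move=> /le_trans /(_ (normD _ _)) /le_trans; apply.
by move: h1 h2; lra.
Qed.

Let torus_dist_positivity x y : torus_dist x y = 0 -> x = y.
Proof.
move=> xy0.
have [|m mh] := @torus_dist_lt x y (1 / 2); first by rewrite xy0 divr_gt0.
rewrite -(torus_reprK x) -(torus_reprK y); apply/eqP/torus_pi_eqP.
exists (- m); apply/colP => i.
suff : (torus_repr x - torus_repr y + map_mx intr m) i 0 = 0.
  by rewrite !mxE rmorphN /=; lra.
apply/eqP; rewrite -normr_le0; apply/ler_addgt0Pl => e e0; rewrite addr0.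
have me0 : 0 < Num.min e (1 / 2) by rewrite lt_min e0 divr_gt0.
have [|m' mh'] := @torus_dist_lt x y (Num.min e (1 / 2)); first by rewrite xy0.
have /le_lt_trans /(_ mh) := norm_le_coord
  (torus_repr x - torus_repr y + map_mx intr m) i.
have /le_lt_trans /(_ mh') := norm_le_coord
  (torus_repr x - torus_repr y + map_mx intr m') i.
rewrite lt_min => /andP[he h2] h1.
suff mm' : m i 0 = m' i 0 by move: he; rewrite !mxE mm' => /ltW.
apply/eqP; rewrite -subr_eq0 -normr_le0 -ltzD1 add0r.
rewrite -(ltr_int R) intr_norm rmorphB /=.
move: h1 h2; rewrite !mxE !ltr_norml => /andP[? ?] /andP[? ?].
by apply/andP; split; lra.
Qed.

HB.instance Definition _ := @isMetric.Build R (torus R) torus_dist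
  torus_distxx torus_dist_positivity torus_dist_sym torus_dist_triangle.

HB.instance Definition _ := isPointed.Build (torus R) (torus_pi 0).

Definition toral_map (B : 'M[int]_2) (x : torus R) : torus R :=
  torus_pi (map_mx intr B *m torus_repr x).

Lemma toral_map_pi B v : toral_map B (torus_pi v) = torus_pi (map_mx intr B *m v).
Proof.
have [m mE] := torus_repr_piE v.
apply/eqP/torus_pi_eqP; exists (B *m m).
by rewrite mE mulmxDr map_mxM.
Qed.

End TorusMetric.

Section Subshift.

HB.instance Definition _ n := isPointed.Build 'I_n.+1 ord0.

(* The alphabet has k + 2 symbols, i.e. any number of symbols >= 2. *)
Definition full_shift (k : nat) : Type :=
  prod_topology (fun _ : int => discrete_topology 'I_k.+2).

HB.instance Definition _ k := Topological.copy (full_shift k)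
  (prod_topology (fun _ : int => discrete_topology 'I_k.+2)).
HB.instance Definition _ k :=
  isPointed.Build (full_shift k) (fun _ => ord0).

Context {k : nat}.
Implicit Types (X : set (full_shift k)) (u : seq 'I_k.+2).

Definition left_shift (w : full_shift k) : full_shift k := fun i => w (i + 1).

Definition subshift X := closed X /\ left_shift @` X = X.

Definition minimal_subshift X :=
  [/\ subshift X, X !=set0 &
      forall Y, subshift Y -> Y !=set0 -> Y `<=` X -> Y = X].

Definition language X : set (seq 'I_k.+2) :=
  [set u | exists (w : full_shift k) (i : int),
     X w /\ u = mkseq (fun j => w (i + j%:Z)) (size u)].

Definition right_special X u := exists a b,
  [/\ a != b, language X (rcons u a) & language X (rcons u b)].

Definition left_special X u := exists a b,
  [/\ a != b, language X (a :: u) & language X (b :: u)].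

Definition arnoux_rauzy X :=
  minimal_subshift X /\
  forall n : nat,
    (exists u, [/\ size u = n, right_special X u,
       (forall v, size v = n -> right_special X v -> v = u) &
       forall a, language X (rcons u a)]) /\
    (exists u, [/\ size u = n, left_special X u,
       (forall v, size v = n -> left_special X v -> v = u) &
       forall a, language X (a :: u)]).

End Subshift.

Definition borel (T : topologicalType) : Type := g_sigma_algebraType (@open T).

HB.instance Definition _ (T : ptopologicalType) :=
  Measurable.copy (borel T) (g_sigma_algebraType (@open T)).

(* Borel probability measures on the closed set X are encoded as the Borel
   probability measures on the full shift giving mass 1 to X. *)
Definition invariant_probability_on (R : realType) (k : nat)
    (X : set (full_shift k)) (P : probability (borel (full_shift k)) R) :=
  P X = 1%E /\
  forall A : set (borel (full_shift k)),
    measurable A -> P (left_shift @^-1` A) = P A.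

Definition unique_invariant_probability_on (R : realType) (k : nat)
    (X : set (full_shift k)) (P : probability (borel (full_shift k)) R) :=
  invariant_probability_on X P /\
  forall Q : probability (borel (full_shift k)) R,
    invariant_probability_on X Q ->
    forall A : set (borel (full_shift k)), measurable A -> Q A = P A.

Section FiberEntropy.
Local Open Scope ereal_scope.
Context {R : realType} {Omega : Type} {M : metricType R}.
Variables (theta : Omega -> Omega) (F : Omega -> M -> M).
Implicit Types (w : Omega) (x y : M) (Z : set M) (s eps : R).

Fixpoint fiber_iter (n : nat) w x : M :=
  if n is n'.+1 then F (iter n' theta w) (fiber_iter n' w x) else x.

Definition skew_product (z : Omega * M) : Omega * M := (theta z.1, F z.1 z.2).

(* Equal to 0 when n = 0. *)
Definition bowen_dist w (n : nat) x y : R :=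
  \big[Order.max/0%R]_(i < n) mdist (fiber_iter i w x) (fiber_iter i w y).

Definition bowen_ball (n : nat) w x eps : set M :=
  [set y | (bowen_dist w n x y < eps)%R].

(* The countable families of balls are indexed by a subset D of nat, so that
   finite and empty families are allowed. *)
Definition bowen_premeasure Z s w (N : nat) eps : \bar R :=
  ereal_inf [set r | exists (D : set nat) (x : nat -> M) (n : nat -> nat),
    [/\ Z `<=` \bigcup_(i in D) bowen_ball (n i) w (x i) eps,
        (forall i, D i -> (N <= n i)%N) &
        r = \esum_(i in D) (expR (- (s * (n i)%:R)))%:E]].

Definition bowen_measure Z s w eps : \bar R :=
  limn (fun N => bowen_premeasure Z s w N eps).

(* Infimum form of the critical value, see bowen_entropy_at_critical. *)
Definition bowen_entropy_at Z w eps : \bar R :=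
  ereal_inf [set s%:E | s in [set s | bowen_measure Z s w eps = 0]].

Lemma bowen_premeasure_ge0 Z s w N eps : 0 <= bowen_premeasure Z s w N eps.
Proof.
apply: le_ereal_inf_tmp => _ [D [x [n [_ _ ->]]]].
by apply: esum_ge0 => i _; rewrite lee_fin expR_ge0.
Qed.

Lemma bowen_premeasure_nd Z s w eps :
  {homo (fun N => bowen_premeasure Z s w N eps) : N N' / (N <= N')%N >-> N <= N'}.
Proof.
move=> N N' NN'; apply: ereal_inf_le_tmp => _ [D [x [n [ZD Dn ->]]]].
by exists D, x, n; split => // i /Dn; exact: leq_trans.
Qed.

Lemma bowen_premeasure_le_measure Z s w N eps :
  bowen_premeasure Z s w N eps <= bowen_measure Z s w eps.
Proof.
rewrite /bowen_measure.
rewrite (cvg_lim _ (ereal_nondecreasing_cvgn (@bowen_premeasure_nd Z s w eps)))//.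
by apply: ereal_sup_ubound; exists N.
Qed.

Lemma bowen_premeasure_shift Z s t w N eps : (s <= t)%R ->
  bowen_premeasure Z t w N eps <=
  (expR (- ((t - s) * N%:R)))%:E * bowen_premeasure Z s w N eps.
Proof.
move=> st; rewrite -ereal_inf_pZl ?expR_gt0//.
apply: le_ereal_inf_tmp => _ [_ [D [x [n [ZD Dn ->]]]] <-].
apply: (@le_trans _ _ (\esum_(i in D) (expR (- (t * (n i)%:R)))%:E)).
  by apply: ereal_inf_lbound; exists D, x, n.
apply: ge_ereal_sup => _ [X [finX XD] <-].
apply: (@le_trans _ _ (\sum_(i \in X)
    ((expR (- ((t - s) * N%:R)))%:E * (expR (- (s * (n i)%:R)))%:E))).
  apply: lee_fsum => // i /XD Di; rewrite -EFinM lee_fin -expRD ler_expR.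
  have : ((t - s) * N%:R <= (t - s) * (n i)%:R)%R.
    by rewrite ler_wpM2l ?subr_ge0 // ler_nat Dn.
  lra.
rewrite -ge0_mule_fsumr; last by move=> i; rewrite lee_fin expR_ge0.
apply: lee_wpmul2l; first by rewrite lee_fin expR_ge0.
by apply: ereal_sup_ubound; exists X.
Qed.

Lemma bowen_measure_jump Z s t w eps : (s < t)%R ->
  bowen_measure Z s w eps < +oo -> bowen_measure Z t w eps = 0.
Proof.
move=> st sfin; have ts : (0 < t - s)%R by rewrite subr_gt0.
have s0 : 0 <= bowen_measure Z s w eps.
  exact: le_trans (bowen_premeasure_ge0 Z s w 0 eps)
    (bowen_premeasure_le_measure _ _ _ _ _).
have [c cE] : exists c, bowen_measure Z s w eps = c%:E.
  by exists (fine (bowen_measure Z s w eps)); rewrite fineK // ge0_fin_numE.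
apply/eqP; rewrite eq_le; apply/andP; split; last first.
  exact: le_trans (bowen_premeasure_ge0 Z t w 0 eps)
    (bowen_premeasure_le_measure _ _ _ _ _).
rewrite {1}/bowen_measure.
rewrite (cvg_lim _ (ereal_nondecreasing_cvgn (@bowen_premeasure_nd Z t w eps)))//.
apply: ge_ereal_sup => _ [N _ <-]; apply/lee_addgt0Pr => e e0; rewrite add0e.
pose N' := maxn N (Num.truncn (c / e / (t - s))).+1.
apply: (le_trans (bowen_premeasure_nd _ _ _ _ (leq_maxl N _ : (N <= N')%N))).
apply: (le_trans (bowen_premeasure_shift _ _ _ _ (ltW st))).
have cN : (c / e <= (t - s) * N'%:R)%R.
  rewrite [X in (_ <= X)%R]mulrC -ler_pdivrMr //.
  apply: (le_trans (ltW (truncnS_gt _))).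
  by rewrite ler_nat leq_maxr.
have := bowen_premeasure_le_measure Z s w N' eps; rewrite cE => pc.
apply: (le_trans (lee_wpmul2l _ pc)); first by rewrite lee_fin expR_ge0.
rewrite -EFinM lee_fin expRN ler_pdivrMl ?expR_gt0 // -ler_pdivrMr //.
apply: (le_trans cN); apply: le_trans (expR_ge1Dx _).
by rewrite lerDr.
Qed.

Lemma bowen_entropy_at_critical Z s w eps :
  (s%:E < bowen_entropy_at Z w eps -> bowen_measure Z s w eps = +oo) /\
  (bowen_entropy_at Z w eps < s%:E -> bowen_measure Z s w eps = 0).
Proof.
split=> [|/ereal_inf_lt[_ [t t0 <-]]]; last first.
  by rewrite lte_fin => /bowen_measure_jump; apply; rewrite t0 ltry.
apply: contraPP => /eqP; rewrite -ltey => fin; apply/negP; rewrite -leNgt.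
apply/lee_addgt0Pr => e e0; apply: ereal_inf_lbound; exists (s + e)%R => //=.
by apply: bowen_measure_jump fin; rewrite ltrDl.
Qed.

Definition bowen_entropy Z w : \bar R :=
  ereal_sup [set bowen_entropy_at Z w eps | eps in [set eps : R | (0 < eps)%R]].

Definition separated w eps (n : nat) (Q : {fset M}) : Prop :=
  forall x y, x \in Q -> y \in Q -> x != y -> (eps < bowen_dist w n x y)%R.

(* Supremum over finite separated sets, hence +oo if there are arbitrarily
   large ones. *)
Definition max_separated w eps (n : nat) : \bar R :=
  ereal_sup [set (#|` Q|%fset%:R)%:E | Q in separated w eps n].

End FiberEntropy.

Section FiberEntropyIntegral.
Local Open Scope ereal_scope.
Context {R : realType} {d : measure_display} {Omega : measurableType d}
  {M : metricType R}.

Definition fiber_entropy (P : probability Omega R) (X : set Omega)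
    (theta : Omega -> Omega) (F : Omega -> M -> M) : \bar R :=
  lim (limn_esup (fun n : nat =>
         (n%:R^-1)%:E * \int[P]_(w in X) lne (max_separated theta F w eps n))
       @[eps --> (0 : R)^'+]).

End FiberEntropyIntegral.

Definition irregular_set (R : realType) (S : Type) (T : S -> S) (X : set S)
    (phi : S -> R) : set S :=
  [set z | X z /\
     ~ cvgn (fun n : nat => n%:R^-1 * \sum_(i < n) phi (iter i T z))].

Definition nowhere_dense (T : topologicalType) (A : set T) :=
  interior (closure A) = set0.

Definition first_category (T : topologicalType) (A : set T) :=
  exists G : nat -> set T,
    (forall n, nowhere_dense (G n)) /\ A = \bigcup_n G n.

Definition residual (T : topologicalType) (A : set T) := first_category (~` A).

(* Main.v *)
(* The cocycle B^n_w = B_(w_(n-1)) ... B_(w_0) expands the positive cone and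
   contracts in forward time the preimages of the mixed-sign cone; a
   parallelogram with one long side in each cone contains a fundamental domain
   of the torus.  Hence every long segment in a positive direction contains
   points that trace prescribed orbit pieces of the fibers, separated by gaps of
   a fixed length, with no restriction on w (specification).  Unique ergodicity
   (through the Krylov-Bogolyubov construction) makes the growth rate lambda of
   the cocycle uniform over the subshift, and counting Bowen balls shows that
   lambda is the fiber entropy.  It also shows that as soon as one point is
   irregular there are b < a such that over every w and for all large n some
   orbit pieces of length n have average close to a, and others close to b.

   Tracing such pieces gives residuality and density of the irregular points.
   For the entropy, one block out of q is controlled and the others follow
   freely chosen separated pieces.  For each free choice c, consider three
   points: the controlled blocks have high averages, or low ones, or alternate
   over long phases.  If the first two are regular then their averages differ,
   and the third is irregular; so for every c one of the three is irregular.  A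
   Bowen ball of order m determines about m symbols of c, and a countable family
   of cylinders of total measure less than 1 does not cover the set of all c. *)
Require Import Defs.
From HB Require Import structures.
From mathcomp Require Import all_boot all_order all_algebra.
From mathcomp Require Import finmap.
From mathcomp Require Import all_classical all_reals all_analysis.
From mathcomp Require Import ring lra zify.

Set Implicit Arguments.
Unset Strict Implicit.
Unset Printing Implicit Defensive.

Import Order.TTheory GRing.Theory Num.Theory.
Import numFieldNormedType.Exports.

Local Open Scope classical_set_scope.
Local Open Scope ring_scope.

(** * Toral cocycles in the universal cover *)

Section TorusLift.
Context {R : realType}.
Implicit Types (u v w : 'cV[R]_2) (x y : torus R) (m : 'cV[int]_2).

(** The fiber maps vary with $\omega$, so no invariant splitting is at hand: the unstable direction
    is replaced by a cone and the stable one by a vector chosen anew for each finite horizon.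
    Tracing cuts a segment into nested subsegments, each of which regrows to a fixed length before
    the next block. Hence the gap [G] depends on the accuracy alone and becomes negligible against a
    long block. A code does not reveal which of its three points is irregular. A cover of the
    irregular set is therefore only known to contain, for each code, one point of unknown kind, so
    cylinders of all three kinds are avoided at once, at the cost of a factor 3. The code is found
    by conditional expectations; a measure carried by the irregular set would require a measurable
    choice of points. Controlling one block out of [q] costs a proportion $1/q$ of the entropy, and
    the oscillation that it creates also shrinks like $1/q$; so [q] is fixed first, then the
    accuracy, and the block length last. *)

Definition l1norm v : R := `|v 0 0| + `|v 1 0|.

Lemma euclid_normE v : euclid_norm v = Num.sqrt (v 0 0 ^+ 2 + v 1 0 ^+ 2).
Proof.
rewrite /euclid_norm big_ord_recl big_ord1; congr (Num.sqrt (_ + v _ _ ^+ 2)).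
exact/val_inj.
Qed.

Lemma euclid_norm_ge0 v : 0 <= euclid_norm v.
Proof. exact: sqrtr_ge0. Qed.

Lemma euclid_norm_le_l1 v : euclid_norm v <= l1norm v.
Proof.
rewrite euclid_normE /l1norm -[leRHS]ger0_norm ?addr_ge0 // -sqrtr_sqr.
rewrite ler_sqrt ?sqr_ge0 // sqrrD !real_normK ?num_real //.
have : 0 <= `|v 0 0| * `|v 1 0| by rewrite mulr_ge0.
by rewrite mulr2n; lra.
Qed.

Lemma coord_le_euclid_norm v i : `|v i 0| <= euclid_norm v.
Proof.
rewrite -sqrtr_sqr ler_sqrt; last by apply: sumr_ge0 => j _; exact: sqr_ge0.
by rewrite (bigD1 i) //= lerDl; apply: sumr_ge0 => j _; exact: sqr_ge0.
Qed.

Lemma l1norm_ge0 v : 0 <= l1norm v.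
Proof. by rewrite addr_ge0. Qed.

Lemma l1normD u v : l1norm (u + v) <= l1norm u + l1norm v.
Proof.
rewrite /l1norm !mxE.
by have := ler_normD (u 0 0) (v 0 0); have := ler_normD (u 1 0) (v 1 0); lra.
Qed.

Lemma l1normZ a v : l1norm (a *: v) = `|a| * l1norm v.
Proof. by rewrite /l1norm !mxE !normrM mulrDr. Qed.

Lemma torus_mdist_le u v m :
  mdist (torus_pi u) (torus_pi v) <= euclid_norm (u - v + map_mx intr m).
Proof.
have [m1 m1E] := torus_repr_piE u; have [m2 m2E] := torus_repr_piE v.
apply: ge_inf; first by exists 0 => _ [n _ <-]; exact: euclid_norm_ge0.
exists (m - m1 + m2) => //; congr euclid_norm.
rewrite m1E m2E !map_mxD map_mxN; apply/colP => i; rewrite !mxE; ring.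
Qed.

Lemma torus_mdist_ge u v r :
  (forall m, r <= euclid_norm (u - v + map_mx intr m)) ->
  r <= mdist (torus_pi u) (torus_pi v).
Proof.
move=> ur.
have [m1 m1E] := torus_repr_piE u; have [m2 m2E] := torus_repr_piE v.
apply: lb_le_inf.
  by exists (euclid_norm (torus_repr (torus_pi u) - torus_repr (torus_pi v)
    + map_mx intr 0)); exists 0.
move=> _ [m _ <-]; apply: le_trans (ur (m + m1 - m2)) _.
rewrite le_eqVlt; apply/orP; left; apply/eqP; congr euclid_norm.
rewrite m1E m2E map_mxD map_mxN map_mxD; apply/colP => i; rewrite !mxE; ring.
Qed.

Lemma torus_mdist_le_l1 u v m :
  mdist (torus_pi u) (torus_pi v) <= l1norm (u - v - map_mx intr m).
Proof.
rewrite -map_mxN; exact: le_trans (torus_mdist_le _ _ _) (euclid_norm_le_l1 _).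
Qed.

(** A nonzero integer translate moves some coordinate from $[0,1/4]$ to absolute value at least
    $3/4$; for the zero translate the larger coordinate is at least half of the $\ell^1$ norm. *)
Lemma torus_mdist_far u v r : 0 <= r <= 3 / 4 ->
  (forall i, 0 <= (u - v) i 0 <= 1 / 4) -> r <= l1norm (u - v) / 2 ->
  r <= mdist (torus_pi u) (torus_pi v).
Proof.
move=> /andP[r0 r1] uv ruv; apply: torus_mdist_ge => m.
have [m0|] := pselect (m = 0).
  rewrite m0 map_mx0 addr0; apply: le_trans ruv _.
  have := coord_le_euclid_norm (u - v) 0.
  by have := coord_le_euclid_norm (u - v) 1; rewrite /l1norm; lra.
move/eqP/cV0Pn => [i mi].
apply: le_trans (coord_le_euclid_norm _ i).
have -> : (u - v + map_mx intr m) i 0 = (u - v) i 0 + (m i 0)%:~R by rewrite !mxE.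
have /andP[] := uv i; move: ((u - v) i 0) => a a0 a1.
have [m1|m1] : (1 <= m i 0) \/ (m i 0 <= -1) by move: (m i 0) mi => z; lia.
  have : (1 : R) <= (m i 0)%:~R by rewrite -(ler_int R) in m1.
  by move=> h; rewrite ger0_norm; lra.
have : ((m i 0)%:~R : R) <= -1 by rewrite -(ler_int R) in m1; apply: le_trans m1 _; rewrite intrN.
by move=> h; rewrite ltr0_norm; lra.
Qed.

Lemma floor_shift (q : 'cV[R]_2) : exists m, forall i, 0 <= (q + map_mx intr m) i 0 <= 1.
Proof.
exists (\col_i (- Num.floor (q i 0))) => i; rewrite !mxE rmorphN /=.
have := floor_itv (q i 0) => /andP[h1 h2].
by move: h2; rewrite intrD; lra.
Qed.

End TorusLift.

(** * Cone expansion and contraction of the cocycle *)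

Section Cocycle.
Context {R : realType} {k : nat} (B : 'I_k.+2 -> 'M[int]_2).
Hypothesis B_gt0 : forall i p q, 0 < B i p q.
Hypothesis B_det : forall i, `|B i 0 0 * B i 1 1 - B i 1 0 * B i 0 1| = 1.
Implicit Types (w : full_shift k) (u v p : 'cV[R]_2) (n : nat) (x : torus R).

Definition shift_iter n w : full_shift k := iter n (@left_shift k) w.

Definition torus_skew w : torus R -> torus R := toral_map (B (w 0)).

Definition torus_iter n w x : torus R := fiber_iter (@left_shift k) torus_skew n w x.

Definition real_mx i : 'M[R]_2 := map_mx intr (B i).

Fixpoint cocycle n w : 'M[R]_2 :=
  if n is n'.+1 then real_mx (shift_iter n' w 0) *m cocycle n' w else 1%:M.

Lemma shift_iterE n w i : shift_iter n w i = w (i + n%:Z).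
Proof.
elim: n i => [|n IH] i; first by rewrite addr0.
have -> : shift_iter n.+1 w i = shift_iter n w (i + 1) by [].
by rewrite IH -addrA intS.
Qed.

Lemma shift_iterD m n w : shift_iter m (shift_iter n w) = shift_iter (m + n) w.
Proof. by rewrite /shift_iter iterD. Qed.

Lemma cocycleD m n w : cocycle (m + n) w = cocycle m (shift_iter n w) *m cocycle n w.
Proof.
elim: m => [|m IH]; first by rewrite mul1mx.
by rewrite addSn /= IH mulmxA shift_iterD.
Qed.

Lemma cocycleS n w : cocycle n.+1 w = cocycle n (left_shift w) *m real_mx (w 0).
Proof. by have := cocycleD n 1 w; rewrite addn1 /= mulmx1. Qed.

Lemma torus_iter_pi n w v : torus_iter n w (torus_pi v) = torus_pi (cocycle n w *m v).
Proof.
elim: n => [|n IH] /=; first by rewrite mul1mx.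
by rewrite /torus_iter /= -/(torus_iter n w _) IH /torus_skew toral_map_pi mulmxA.
Qed.

Lemma torus_iterD m n w x :
  torus_iter (m + n) w x = torus_iter m (shift_iter n w) (torus_iter n w x).
Proof. by rewrite -(torus_reprK x) !torus_iter_pi cocycleD mulmxA. Qed.

Lemma real_mx_mulE i v j : (real_mx i *m v) j 0 =
  (B i j 0)%:~R * v 0 0 + (B i j 1)%:~R * v 1 0.
Proof.
rewrite mxE big_ord_recl big_ord1 !mxE.
by congr (_ + (B i j _)%:~R * v _ _); exact/val_inj.
Qed.

Lemma entry_ge1 i (p q : 'I_2) : (1 : R) <= (B i p q)%:~R.
Proof. by rewrite -[1]/(1%:~R) ler_int -gtz0_ge1. Qed.

Lemma entries_ge1 i : [/\ (1 : R) <= (B i 0 0)%:~R, (1 : R) <= (B i 0 1)%:~R,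
  (1 : R) <= (B i 1 0)%:~R & (1 : R) <= (B i 1 1)%:~R].
Proof. by split; exact: entry_ge1. Qed.

(** One constant for the expansion of a single step and for the ratio of [coord_sum] to either
    coordinate after it. Summing over all symbols avoids a maximum over the alphabet. *)
Definition entry_bound : R :=
  \sum_i ((B i 0 0)%:~R + (B i 0 1)%:~R + (B i 1 0)%:~R + (B i 1 1)%:~R).

Lemma entry_sum_le i :
  ((B i 0 0)%:~R + (B i 0 1)%:~R + (B i 1 0)%:~R + (B i 1 1)%:~R : R) <= entry_bound.
Proof.
rewrite /entry_bound (bigD1 i) //= lerDl; apply: sumr_ge0 => j _.
by have [] := entries_ge1 j; lra.
Qed.

Lemma entry_bound_ge4 : 4 <= entry_bound.
Proof.
apply: le_trans (entry_sum_le ord0).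
by have [] := entries_ge1 ord0; lra.
Qed.

Definition coord_sum v : R := v 0 0 + v 1 0.

Definition pos_cone v := 0 <= v 0 0 /\ 0 <= v 1 0.

(** One step sends the nonnegative cone here. Membership keeps a vector uniformly transverse to
    mixed-sign vectors, which makes the determinant in [glue] large. *)
Definition core_cone v := coord_sum v <= entry_bound * v 0 0 /\
  coord_sum v <= entry_bound * v 1 0.

Lemma l1norm_pos v : pos_cone v -> l1norm v = coord_sum v.
Proof. by case=> v0 v1; rewrite /l1norm !ger0_norm. Qed.

Lemma coord_sumZ a v : coord_sum (a *: v) = a * coord_sum v.
Proof. by rewrite /coord_sum !mxE mulrDr. Qed.

Lemma pos_coneZ a v : 0 <= a -> pos_cone v -> pos_cone (a *: v).
Proof. by move=> a0 [v0 v1]; split; rewrite mxE mulr_ge0. Qed.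

Lemma core_coneZ a v : 0 <= a -> core_cone v -> core_cone (a *: v).
Proof.
by move=> a0 [v0 v1]; split; rewrite coord_sumZ mxE mulrCA ler_wpM2l.
Qed.

(** Entries being at least 1, each coordinate of the image is at least [coord_sum v]: the sum gives
    the factor 2, and comparison with the upper bound gives [core_cone]. *)
Lemma real_mx_cone i v : pos_cone v ->
  [/\ pos_cone (real_mx i *m v), core_cone (real_mx i *m v),
      2 * coord_sum v <= coord_sum (real_mx i *m v) &
      coord_sum (real_mx i *m v) <= entry_bound * coord_sum v].
Proof.
rewrite /pos_cone /core_cone /coord_sum !real_mx_mulE; move=> [].
have := entry_sum_le i; have := entry_bound_ge4.
have := entries_ge1 i.
move: (v 0 0) (v 1 0) entry_bound ((B i 0 0)%:~R) ((B i 0 1)%:~R)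
  ((B i 1 0)%:~R) ((B i 1 1)%:~R) => x y S a b c d [a1 b1 c1 d1] S4 abcd x0 y0.
have ax : x <= a * x by rewrite ler_peMl.
have bY : y <= b * y by rewrite ler_peMl.
have cx : x <= c * x by rewrite ler_peMl.
have dy : y <= d * y by rewrite ler_peMl.
have Sx : (a + c) * x <= S * x by rewrite ler_wpM2r //; lra.
have Sy : (b + d) * y <= S * y by rewrite ler_wpM2r //; lra.
have up z : x + y <= z -> a * x + b * y + (c * x + d * y) <= S * z.
  move=> xyz; apply: (@le_trans _ _ (S * (x + y))); first by lra.
  by rewrite ler_wpM2l //; lra.
split; [lra| |lra|exact: up].
by split; apply: up; lra.
Qed.

Lemma cocycle_cone n w v : pos_cone v ->
  [/\ pos_cone (cocycle n w *m v), core_cone v -> core_cone (cocycle n w *m v) &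
      2 ^+ n * coord_sum v <= coord_sum (cocycle n w *m v)].
Proof.
move=> v0; elim: n => [|n [p c s]] /=; first by rewrite mul1mx mul1r.
rewrite -mulmxA; have [p' c' s' _] := real_mx_cone (shift_iter n w 0) p.
split=> //; apply: le_trans s'; rewrite exprS -mulrA ler_wpM2l //.
Qed.

Lemma cocycle_step_le n w v : pos_cone v ->
  coord_sum (cocycle n.+1 w *m v) <= entry_bound * coord_sum (cocycle n w *m v).
Proof.
move=> /(cocycle_cone n w) [/(real_mx_cone (shift_iter n w 0))[_ _ _]].
by rewrite /= mulmxA.
Qed.

Lemma cocycle_growth m n w v : (m <= n)%N -> pos_cone v ->
  2 ^+ (n - m) * coord_sum (cocycle m w *m v) <= coord_sum (cocycle n w *m v).
Proof.
move=> mn v0; have [p _ _] := cocycle_cone m w v0.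
have [_ _] := cocycle_cone (n - m) (shift_iter m w) p.
by rewrite mulmxA -cocycleD subnK.
Qed.

(* Preimages of the mixed-sign cone are computed with the adjugate, whose
   entries have the right signs, so that the cone is contracted in forward
   time. *)
Lemma contracted_vector n w : exists s : 'cV[R]_2,
  [/\ 0 <= s 0 0, s 1 0 <= 0, s 0 0 - s 1 0 = 1 &
     forall i, (i <= n)%N -> l1norm (cocycle i w *m s) <= (2 ^+ i)^-1].
Proof.
elim: n w => [|n IH] w.
  exists (\col_i (i == 0)%:R); rewrite !mxE; split=> //; first by rewrite subr0.
  move=> i; rewrite leqn0 => /eqP ->; rewrite mul1mx /l1norm !mxE /= normr1 normr0.
  by rewrite expr0 invr1 addr0.
have [s [s0 s1 s01 sn]] := IH (left_shift w).
set b := B (w 0).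
pose t : 'cV[R]_2 := \col_i (if i == 0
  then (b 1 1)%:~R * s 0 0 - (b 0 1)%:~R * s 1 0
  else (b 0 0)%:~R * s 1 0 - (b 1 0)%:~R * s 0 0).
have t0E : t 0 0 = (b 1 1)%:~R * s 0 0 - (b 0 1)%:~R * s 1 0 by rewrite mxE.
have t1E : t 1 0 = (b 0 0)%:~R * s 1 0 - (b 1 0)%:~R * s 0 0 by rewrite mxE.
have := entries_ge1 (w 0); rewrite -/b => -[a1 b1 c1 d1].
have as1 : (b 0 0)%:~R * s 1 0 <= s 1 0
  by rewrite -subr_le0 -{2}[s 1 0]mul1r -mulrBl mulr_ge0_le0 // subr_ge0.
have bs1 : (b 0 1)%:~R * s 1 0 <= s 1 0
  by rewrite -subr_le0 -{2}[s 1 0]mul1r -mulrBl mulr_ge0_le0 // subr_ge0.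
have cs0 : s 0 0 <= (b 1 0)%:~R * s 0 0 by rewrite ler_peMl.
have ds0 : s 0 0 <= (b 1 1)%:~R * s 0 0 by rewrite ler_peMl.
(* The signs in [s] make the two terms of each coordinate of [t] add up, so both coordinates have
   absolute value at least $s_0-s_1=1$. Dividing by $r\ge2$ is what contracts by one half per
   step. *)
pose r := t 0 0 - t 1 0; have r2 : 2 <= r by rewrite /r t0E t1E; lra.
have r0 : 0 < r by lra.
pose dt : R := (b 0 0 * b 1 1 - b 1 0 * b 0 1)%:~R.
have dt1 : `|dt| = 1 by rewrite -intr_norm B_det.
have bt : real_mx (w 0) *m t = dt *: s.
  apply/colP => i; rewrite real_mx_mulE t0E t1E !mxE /dt.
  rewrite rmorphB !rmorphM /= -/b.
  have [->|->] : i = 0 \/ i = 1 by case: i => -[|[|//]] ?; [left|right]; exact/val_inj.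
    by ring.
  by ring.
have rt j : (r^-1 *: t) j 0 = r^-1 * t j 0 by rewrite mxE.
exists (r^-1 *: t); rewrite !rt; split.
- by rewrite mulr_ge0 ?invr_ge0 ?(ltW r0) // t0E; lra.
- by rewrite mulr_ge0_le0 ?invr_ge0 ?(ltW r0) // t1E; lra.
- by rewrite -mulrBr -/r mulVf ?gt_eqF.
case=> [_|i].
  rewrite mul1mx l1normZ ger0_norm ?invr_ge0 ?(ltW r0) //.
  rewrite /l1norm ger0_norm ?ler0_norm -/r ?mulVf ?gt_eqF ?expr0 ?invr1 //.
    by rewrite t1E; lra.
  by rewrite t0E; lra.
rewrite ltnS => /sn isn.
rewrite cocycleS -scalemxAr -mulmxA bt -scalemxAr !l1normZ dt1 mul1r.
rewrite ger0_norm ?invr_ge0 ?(ltW r0) // exprS invfM.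
by rewrite ler_pM ?invr_ge0 ?(ltW r0) ?l1norm_ge0 // lef_pV2 ?posrE.
Qed.

End Cocycle.

(** * Specification in the fibers *)

Section Specification.
Context {R : realType} {k : nat} (B : 'I_k.+2 -> 'M[int]_2).
Hypothesis B_gt0 : forall i p q, 0 < B i p q.
Hypothesis B_det : forall i, `|B i 0 0 * B i 1 1 - B i 1 0 * B i 0 1| = 1.
Implicit Types (w : full_shift k) (u v p q : 'cV[R]_2) (n : nat) (x y : torus R).

Local Notation S := (@entry_bound R k B).
Local Notation cocycle := (@cocycle R k B).
Local Notation torus_iter := (@torus_iter R k B).
Local Notation core_cone := (@core_cone R k B).

Let S4 : 4 <= S. Proof. exact: entry_bound_ge4. Qed.

Lemma cocycle_unit n w : cocycle n w \in unitmx.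
Proof.
elim: n => [|n IH] /=; first exact: unitmx1.
rewrite unitmx_mul IH andbT unitmxE unitfE.
set i := shift_iter n w 0.
suff -> : \det (real_mx B i) = (B i 0 0 * B i 1 1 - B i 1 0 * B i 0 1)%:~R :> R.
  by rewrite intr_eq0 -normr_eq0 B_det.
rewrite (expand_det_row _ 0) !big_ord_recl big_ord0 /cofactor !det_mx11 !mxE.
have -> : lift 0 0 = 1 :> 'I_2 by exact/val_inj.
have -> : lift 1 0 = 0 :> 'I_2 by exact/val_inj.
by rewrite rmorphB !rmorphM /= addr0 expr0 expr1; ring.
Qed.

Lemma cocycle_int n w (m : 'cV[int]_2) :
  exists m' : 'cV[int]_2, cocycle n w *m map_mx intr m = map_mx intr m'.
Proof.
elim: n => [|n [m' IH]] /=; first by exists m; rewrite mul1mx.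
by exists (B (shift_iter n w 0) *m m'); rewrite -mulmxA IH -map_mxM.
Qed.

(* The parallelogram spanned by a long vector of the positive cone and a long
   vector contracted by the cocycle contains a fundamental domain. *)
Lemma glue w N p u q : pos_cone u -> core_cone u -> 2 * S <= coord_sum u ->
  exists tau (m : 'cV[int]_2), 0 <= tau <= 1 / 2 /\
    forall i, (i <= N)%N ->
      l1norm (cocycle i w *m (p + tau *: u - q - map_mx intr m)) <= S / 2 ^+ i.
Proof.
move=> [u0 u1] [c0 c1] uS.
have [s [s0 s1 s01 sN]] := @contracted_vector R k B B_gt0 B_det N w.
have [m mE] := floor_shift (q - p).
set d := q - p + map_mx intr m in mE.
have /andP[d00 d01] := mE 0; have /andP[d10 d11] := mE 1.
have S0 : 0 < S by have := S4; lra.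
(* Cramer's rule for $d=\tau u+rs$. As [s] has $\ell^1$ norm 1, [core_cone u] bounds [D] below by
   [coord_sum u / S], which is at least 2. Hence $\tau\le1/2$, leaving half of the segment for what
   follows, and $|r|\le S$. *)
pose D := u 1 0 * s 0 0 - u 0 0 * s 1 0.
have DS : coord_sum u <= S * D.
  have h1 : coord_sum u * s 0 0 <= S * u 1 0 * s 0 0 by rewrite ler_wpM2r.
  have h2 : coord_sum u * (- s 1 0) <= S * u 0 0 * (- s 1 0) by rewrite ler_wpM2r ?oppr_ge0.
  have -> : coord_sum u = coord_sum u * s 0 0 + coord_sum u * (- s 1 0).
    by rewrite -mulrDr s01 mulr1.
  have -> : S * D = S * u 1 0 * s 0 0 + S * u 0 0 * (- s 1 0) by rewrite /D; ring.
  exact: lerD.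
have D2 : 2 <= D by rewrite -(ler_pM2l S0); lra.
have D0 : 0 < D by lra.
pose tau := (d 1 0 * s 0 0 - d 0 0 * s 1 0) / D.
pose r := (u 1 0 * d 0 0 - u 0 0 * d 1 0) / D.
have dE : p + tau *: u - q - map_mx intr m = - r *: s.
  have -> : p + tau *: u - q - map_mx intr m = tau *: u - d.
    by apply/colP => i; rewrite !mxE; ring.
  apply/colP => i; rewrite !mxE -!/(d _ _).
  have [->|->] : i = 0 \/ i = 1 by case: i => -[|[|//]] ?; [left|right]; exact/val_inj.
    have -> : q 0 0 - p 0 0 + (m 0 0)%:~R = d 0 0 by rewrite !mxE.
    by rewrite /tau /r /D; field; exact: lt0r_neq0.
  have -> : q 1 0 - p 1 0 + (m 1 0)%:~R = d 1 0 by rewrite !mxE.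
  by rewrite /tau /r /D; field; exact: lt0r_neq0.
have le1 (a b : R) : 0 <= a <= 1 -> 0 <= b -> 0 <= a * b <= b.
  by move=> /andP[? ?] ?; rewrite mulr_ge0 ?ler_piMl.
exists tau, m; split.
  have s1' : 0 <= - s 1 0 by rewrite oppr_ge0.
  have /andP[e1 e2] := le1 _ _ (mE 0) s1'.
  have /andP[e3 e4] := le1 _ _ (mE 1) s0.
  by rewrite /tau divr_ge0 ?ler_pdivrMr ?(ltW D0) //=; lra.
move=> i iN; rewrite dE -scalemxAr l1normZ normrN.
apply: ler_pM => //; [exact: l1norm_ge0| |exact: sN].
rewrite /r normrM normfV (gtr0_norm D0) // ler_pdivrMr //.
apply: le_trans DS; rewrite ler_norml /coord_sum.
have /andP[e1 e2] := le1 _ _ (mE 0) u1.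
have /andP[e3 e4] := le1 _ _ (mE 1) u0.
by lra.
Qed.

(** The [G] steps before the window shrink the contracted component to $S/2^G$. The [G] steps after
    it expand by at least $2^G$, so a subsegment of final length $2S$ has length at most $2S/2^G$
    during the window. The sum is the accuracy $3S/2^G$, uniform in [n]. *)
Lemma trace_step w n G p u z : (0 < G)%N ->
  pos_cone u -> core_cone u -> 2 * S <= coord_sum u ->
  exists tau sigma, [/\ 0 <= tau, 0 < sigma, tau + sigma <= 1,
    2 * S <= coord_sum (cocycle (n + G.*2) w *m (sigma *: u)) &
    forall t i, 0 <= t <= 1 -> (i < n)%N ->
      mdist (torus_iter (G + i) w (torus_pi (p + (tau + sigma * t) *: u)))
        (torus_iter i (shift_iter G w) z) <= 3 * S / 2 ^+ G].
Proof.
move=> G0 u0 uc uS.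
set M := (n + G.*2)%N.
pose q := invmx (cocycle G w) *m torus_repr z.
have qE : cocycle G w *m q = torus_repr z by rewrite mulKVmx // cocycle_unit.
have [tau [m [/andP[tau0 tau1] glueE]]] := glue w M p q u0 uc uS.
set T := coord_sum (cocycle M w *m u).
have S0 : 0 < S by have := S4; lra.
have [uM _ _] := cocycle_cone B_gt0 M w u0.
have TM : 2 * (2 * S) <= T.
  have := cocycle_growth B_gt0 w (leq0n M) u0; rewrite mul1mx subn0 -/T.
  apply: le_trans; apply: ler_pM => //; [by lra|].
  rewrite -[leLHS]expr1 ler_eXn2l ?ltr1n // /M; lia.
have T0 : 0 < T by lra.
(* This length makes the image at time [M] have [coord_sum] exactly [2 * S], so the next block can
   start; since $T\ge4S$ it is at most one half. *)
exists tau, (2 * S / T); split=> //; first by rewrite divr_gt0 //; lra.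
- by have : 2 * S / T <= 1 / 2; [rewrite ler_pdivrMr //; lra|lra].
- by rewrite -scalemxAr coord_sumZ -/T divfK ?lt0r_neq0.
move=> t i /andP[t0 t1] in_.
rewrite torus_iter_pi -[z]torus_reprK torus_iter_pi -qE mulmxA addnC -cocycleD.
have [m' m'E] := cocycle_int (i + G) w m.
apply: le_trans (torus_mdist_le_l1 _ _ m') _.
rewrite -m'E -!mulmxBr.
have -> : p + (tau + 2 * S / T * t) *: u - q - map_mx intr m =
    (p + tau *: u - q - map_mx intr m) + (2 * S / T * t) *: u.
  by apply/colP => j; rewrite !mxE; ring.
rewrite mulmxDr -scalemxAr.
apply: le_trans (l1normD _ _) _; rewrite l1normZ.
have iM : (i + G <= M)%N by rewrite /M leq_add ?(ltnW in_) // -addnn leq_addr.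
have [uG _ _] := cocycle_cone B_gt0 (i + G) w u0.
rewrite (l1norm_pos uG) ger0_norm; last first.
  by rewrite mulr_ge0 // divr_ge0 ?(ltW T0) //; lra.
have h1 : l1norm (cocycle (i + G) w *m (p + tau *: u - q - map_mx intr m)) <= S / 2 ^+ G.
  apply: le_trans (glueE _ iM) _; rewrite ler_wpM2l ?(ltW S0) //.
  by rewrite lef_pV2 ?posrE ?exprn_gt0 // ler_eXn2l ?ltr1n // leq_addl.
have h2 : coord_sum (cocycle (i + G) w *m u) <= T / 2 ^+ G.
  rewrite ler_pdivlMr ?exprn_gt0 // mulrC.
  have := cocycle_growth B_gt0 w iM u0; rewrite -/T; apply: le_trans.
  rewrite ler_wpM2r //; first by case: uG => ? ?; rewrite /coord_sum addr_ge0.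
  rewrite ler_eXn2l ?ltr1n // leq_subRL // /M -addnn addnA.
  by rewrite leq_add2r leq_add2r ltnW.
have h3 : 2 * S / T * t * coord_sum (cocycle (i + G) w *m u) <= 2 * S / 2 ^+ G.
  apply: (@le_trans _ _ (2 * S / T * t * (T / 2 ^+ G))).
    by rewrite ler_wpM2l // mulr_ge0 // divr_ge0 ?(ltW T0) //; lra.
  have -> : 2 * S / T * t * (T / 2 ^+ G) = t * (2 * S / 2 ^+ G) by field; rewrite ?lt0r_neq0 ?exprn_gt0.
  by rewrite ger_pMl // divr_gt0 ?exprn_gt0 //; lra.
by move: h1 h3; lra.
Qed.

Definition traces n G w (z : nat -> torus R) x := forall j i, (i < n)%N ->
  mdist (torus_iter (j * (n + G.*2) + (G + i)) w x)
    (torus_iter i (shift_iter (j * (n + G.*2) + G) w) (z j)) <= 3 * S / 2 ^+ G.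

(** [(s j).1] and [(s j).2] are the left end and the length of a parameter interval. The intervals
    are nested, so the supremum of the left ends lies in all of them and one point traces every
    block. *)
Lemma specification w n G p u (z : nat -> torus R) : (0 < G)%N ->
  pos_cone u -> core_cone u -> 2 * S <= coord_sum u ->
  exists2 t, 0 <= t <= 1 & traces n G w z (torus_pi (p + t *: u)).
Proof.
move=> G0 u0 uc uS; set M := (n + G.*2)%N.
pose good j (s : R * R) := 0 < s.2 /\ 2 * S <= coord_sum (cocycle (j * M) w *m (s.2 *: u)).
pose step j (s s' : R * R) := [/\ good j.+1 s', s.1 <= s'.1, s'.1 + s'.2 <= s.1 + s.2 &
  forall t i, 0 <= t <= 1 -> (i < n)%N ->
  mdist (torus_iter (j * M + (G + i)) w (torus_pi (p + (s'.1 + s'.2 * t) *: u)))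
    (torus_iter i (shift_iter (j * M + G) w) (z j)) <= 3 * S / 2 ^+ G].
have next (js : nat * (R * R)) : exists s', good js.1 js.2 -> step js.1 js.2 s'.
  case: js => j [a b] /=; have [|ng] := pselect (good j (a, b)); last by exists (0, 0).
  move=> [/= b0 bS].
  have [pu cu _] := cocycle_cone B_gt0 (j * M) w (pos_coneZ (ltW b0) u0).
  have {}cu := cu (core_coneZ (ltW b0) uc).
  have [tau [sigma [t0 s0 ts next_S tr]]] := trace_step (shift_iter (j * M) w) n
    (cocycle (j * M) w *m (p + a *: u)) (z j) G0 pu cu bS.
  exists (a + b * tau, b * sigma) => _; split => /=.
  - split => /=; first exact: mulr_gt0.
    move: next_S; rewrite -scalemxAr mulmxA -cocycleD -/M -mulSn.
    by rewrite -!scalemxAr scalerA [sigma * b]mulrC.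
  - by rewrite lerDl mulr_ge0 // ltW.
  - by rewrite -addrA -mulrDr lerD2l ler_piMr // ltW.
  - move=> t i t01 in_; have := tr t i t01 in_.
    rewrite shift_iterD [(G + j * M)%N]addnC.
    suff -> : torus_iter (G + i) (shift_iter (j * M) w)
        (torus_pi (cocycle (j * M) w *m (p + a *: u) +
          (tau + sigma * t) *: (cocycle (j * M) w *m (b *: u)))) =
      torus_iter (j * M + (G + i)) w
        (torus_pi (p + (a + b * tau + b * sigma * t) *: u)) by [].
    rewrite [in RHS]addnC [in RHS]torus_iterD [in RHS]torus_iter_pi; congr (torus_iter _ _ (torus_pi _)).
    rewrite scalemxAr -mulmxDr; congr (_ *m _).
    by rewrite scalerA -addrA -scalerDl; congr (_ + _ *: _); ring.
have [f fE] := choice next.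
pose s := fix s j := if j is j'.+1 then f (j', s j') else (0, 1).
have sg j : good j (s j).
  elim: j => [|j IH]; first by split => //=; rewrite mul1mx scale1r.
  by have [] := fE (j, s j) IH.
have ss j : step j (s j) (s j.+1) by exact: (fE (j, s j) (sg j)).
have mon i j : (s i).1 <= (s (i + j)%N).1 /\ (s (i + j)%N).1 + (s (i + j)%N).2 <= (s i).1 + (s i).2.
  elim: j => [|j [IH1 IH2]]; first by rewrite addn0.
  rewrite addnS; have [_ h1 h2 _] := ss (i + j)%N.
  by split; [exact: le_trans h1|exact: le_trans IH2].
have le_up i j : (s i).1 <= (s j).1 + (s j).2.
  have [ij|/ltnW ji] := leqP i j.
    have [+ _] := mon i (j - i)%N; rewrite subnKC // => /le_trans; apply.
    by rewrite lerDl ltW //; case: (sg j).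
  have [_] := mon j (i - j)%N; rewrite subnKC //; apply: le_trans.
  by rewrite lerDl ltW //; case: (sg i).
pose A := [set (s j).1 | j in [set: nat]].
have A0 : A !=set0 by exists 0; exists 0%N.
have Aub j : ubound A ((s j).1 + (s j).2) by move=> _ [i _ <-].
have lo j : (s j).1 <= sup A by apply: ub_le_sup; [exists ((s 0).1 + (s 0).2)%R|exists j].
have hi j : sup A <= (s j).1 + (s j).2 by apply: ge_sup.
exists (sup A); first by have := lo 0%N; have := hi 0%N; rewrite /= add0r => -> ->.
move=> j i in_.
have [[/= b0 _] _ _ tr] := ss j.
have := tr ((sup A - (s j.+1).1) / (s j.+1).2) i.
have -> : (s j.+1).1 + (s j.+1).2 * ((sup A - (s j.+1).1) / (s j.+1).2) = sup A.
  by rewrite mulrC divfK ?lt0r_neq0 // addrC subrK.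
apply => //.
have := lo j.+1; have := hi j.+1 => h1 h2.
by rewrite divr_ge0 ?(ltW b0) ?subr_ge0 //= ler_pdivrMr // mul1r lerBlDl.
Qed.

End Specification.

(** * Separated points on a segment and economical covers of the torus *)

Section SeparationAndCover.
Context {R : realType} {k : nat} (B : 'I_k.+2 -> 'M[int]_2).
Hypothesis B_gt0 : forall i p q, 0 < B i p q.
Hypothesis B_det : forall i, `|B i 0 0 * B i 1 1 - B i 1 0 * B i 0 1| = 1.
Implicit Types (w : full_shift k) (u v p q : 'cV[R]_2) (n : nat) (x y : torus R).

Local Notation S := (@entry_bound R k B).
Local Notation cocycle := (@cocycle R k B).
Local Notation torus_iter := (@torus_iter R k B).

Definition ones : 'cV[R]_2 := const_mx 1.

(** The sum of all entries of the product matrix, which serves as its norm. *)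
Definition cocycle_sum n w : R := coord_sum (cocycle n w *m ones).

Lemma coord_sum_ones : coord_sum ones = 2.
Proof. by rewrite /coord_sum !mxE. Qed.

Lemma ones_pos : pos_cone ones.
Proof. by split; rewrite mxE. Qed.

Lemma ones_core : core_cone B ones.
Proof.
by have := @entry_bound_ge4 R k B B_gt0; rewrite /core_cone coord_sum_ones !mxE mulr1; lra.
Qed.

Lemma cocycle_sum_ge n w : 2 <= cocycle_sum n w.
Proof.
have [_ _] := cocycle_cone B_gt0 n w ones_pos; apply: le_trans.
by rewrite coord_sum_ones ler_peMl // exprn_ege1 // ler1n.
Qed.

Lemma cocycle_sum_mono m n w : (m <= n)%N -> cocycle_sum m w <= cocycle_sum n w.
Proof.
move=> mn; have := cocycle_growth B_gt0 w mn ones_pos; apply: le_trans.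
rewrite ler_peMl ?exprn_ege1 ?ler1n //.
by have := cocycle_sum_ge m w; rewrite /cocycle_sum; lra.
Qed.

Definition segment_point n w (c : nat) : torus R :=
  torus_pi ((c%:R / (4 * cocycle_sum n w)) *: ones).

(** The gap [f i] between the lifts is at most 1/4 at time 0, at least 1/4 at time [n], and grows at
    most by the factor [S] per step. At the last time when it is at most 1/4 it is therefore at
    least $1/(4S)$ and has not yet wrapped around the torus; [torus_mdist_far] loses a further
    factor 2. *)
Lemma segment_point_separated n w (c c' : nat) : c != c' ->
  c%:R <= cocycle_sum n w / 2 -> c'%:R <= cocycle_sum n w / 2 ->
  exists2 i, (i <= n)%N & (8 * S)^-1 <=
    mdist (torus_iter i w (segment_point n w c)) (torus_iter i w (segment_point n w c')).
Proof.
wlog cc : c c' / (c' < c)%N.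
  move=> H; rewrite neq_lt => /orP[lt|lt] c1 c2.
    have [|//|//|i iN iE] := H c' c lt; first by rewrite gtn_eqF.
    by exists i; rewrite // metric_sym.
  by apply: H => //; rewrite gtn_eqF.
move=> _ c1 _.
have S4 := @entry_bound_ge4 R k B B_gt0.
set Lam := cocycle_sum n w in c1 *.
have L2 : 2 <= Lam := cocycle_sum_ge n w.
pose r : R := (c%:R - c'%:R) / (4 * Lam).
have c'0 : (0 : R) <= c'%:R by [].
have cc1 : 1 <= (c%:R - c'%:R : R) by rewrite lerBrDl natr1 ler_nat.
have r0 : 0 <= r by rewrite divr_ge0 //; lra.
pose f i := r * cocycle_sum i w.
have f0 i : 0 <= f i by rewrite mulr_ge0 //; have := cocycle_sum_ge i w; lra.
have fn : 1 / 4 <= f n.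
  rewrite /f /r -/Lam.
  have -> : (c%:R - c'%:R) / (4 * Lam) * Lam = (c%:R - c'%:R) / 4 by field; lra.
  by lra.
have f0le : f 0%N <= 1 / 4.
  rewrite /f /r /cocycle_sum mul1mx coord_sum_ones mulrAC ler_pdivrMr; lra.
have [||i /andP[iN fi] imax] := @ex_maxnP (fun i => (i <= n)%N && (f i <= 1 / 4)) n.
- by exists 0%N; rewrite leq0n.
- by move=> i /andP[].
have fiS : 1 / (4 * S) <= f i.
  have [ieq|ilt] := eqVneq i n.
    rewrite ieq; apply: le_trans fn; rewrite ler_pdivrMr; lra.
  have : 1 / 4 < f i.+1.
    rewrite ltNge; apply/negP => h; have := imax i.+1; rewrite h andbT.
    by rewrite ltn_neqAle ilt iN ltnn => /(_ isT).
  have : f i.+1 <= S * f i.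
    by rewrite /f mulrCA ler_wpM2l // (cocycle_step_le B_gt0 _ _ ones_pos).
  move=> h1 h2; rewrite ler_pdivrMr; last lra.
  have -> : f i * (4 * S) = 4 * (S * f i) by ring.
  by lra.
have [/= [a0 b0] _ _] := cocycle_cone B_gt0 i w ones_pos.
exists i => //; rewrite !torus_iter_pi; apply: torus_mdist_far.
- apply/andP; split; first by rewrite invr_ge0 mulr_ge0 //; lra.
  by rewrite -[leLHS]div1r ler_pdivrMr; lra.
- move=> j; rewrite -!scalemxAr -scalerBl -mulrBl -/r mxE.
  have : f i = r * (cocycle i w *m ones) 0 0 + r * (cocycle i w *m ones) 1 0.
    by rewrite -mulrDr.
  have := mulr_ge0 r0 a0; have := mulr_ge0 r0 b0.
  have [->|->] : j = 0 \/ j = 1 by case: j => -[|[|//]] ?; [left|right]; exact/val_inj.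
    by lra.
  by lra.
rewrite -!scalemxAr -scalerBl -mulrBl -/r l1normZ ger0_norm // l1norm_pos //.
rewrite -/(cocycle_sum i w) -/(f i).
have -> : (8 * S)^-1 = 1 / (4 * S) / 2 by field; lra.
by rewrite ler_pM2r.
Qed.

(** A parallelogram with sides along [ones] and along the contracted vector covers the unit square.
    Along [ones] the mesh must be about [eps / Lam], along the contracted vector one independent of
    [n] suffices; the count is thus linear in [cocycle_sum]. *)
Lemma bowen_cover (eps : R) : 0 < eps -> exists2 K : R, 0 < K &
  forall n w, exists2 s : seq (torus R), (size s)%:R <= K * cocycle_sum n w &
    forall y, exists2 x, x \in s & forall i, (i <= n)%N ->
      mdist (torus_iter i w x) (torus_iter i w y) < eps.
Proof.
move=> e0.
pose K2 := (Num.truncn (2 / eps)).+1.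
have K2e : 2 / eps < K2%:R by exact: truncnS_gt.
exists ((2 / eps + 1) * (K2.*2.+1)%:R); first by rewrite mulr_gt0 // addr_gt0 // divr_gt0.
move=> n w; set Lam := cocycle_sum n w.
have L2 : 2 <= Lam := cocycle_sum_ge n w.
pose K1 := (Num.truncn (2 * Lam / eps)).+1.
have K1e : 2 * Lam / eps < K1%:R by exact: truncnS_gt.
have [s [s0 s1 s01 sn]] := @contracted_vector R k B B_gt0 B_det n w.
pose pt (a b : nat) := torus_pi ((a%:R / K1%:R) *: ones + (b%:R / K2%:R - 1) *: s).
exists [seq pt a b | a <- iota 0 K1.+1, b <- iota 0 K2.*2.+1].
  rewrite size_allpairs !size_iota natrM mulrAC ler_wpM2r //.
  have : (Num.truncn (2 * Lam / eps))%:R <= 2 * Lam / eps.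
    by rewrite truncn_le // divr_ge0 ?(ltW e0) //; lra.
  have -> : (2 / eps + 1) * Lam = 2 * Lam / eps + Lam by ring.
  have -> : K1.+1%:R = (Num.truncn (2 * Lam / eps))%:R + 2 :> R by rewrite /K1 -addn2 natrD.
  by move: ((Num.truncn _)%:R) => z; lra.
move=> y; have [m mE] := floor_shift (torus_repr y).
set v := torus_repr y + _ in mE.
have yv : y = torus_pi v.
  by rewrite -(torus_reprK y); apply/eqP; rewrite eq_sym; apply/torus_pi_eqP; exists m.
have /andP[v00 v01] := mE 0; have /andP[v10 v11] := mE 1.
(* The determinant of [ones] and [s] is [s 1 0 - s 0 0], that is $-1$, so these are the coordinates
   of [v] in that basis, without division. *)
pose r := v 0 0 - v 1 0; pose t := v 0 0 * (- s 1 0) + v 1 0 * s 0 0.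
have le1 (a b : R) : 0 <= a <= 1 -> 0 <= b -> 0 <= a * b <= b.
  by move=> /andP[? ?] ?; rewrite mulr_ge0 ?ler_piMl.
have s1' : 0 <= - s 1 0 by rewrite oppr_ge0.
have /andP[e1 e2] := le1 _ _ (mE 0) s1'.
have /andP[e3 e4] := le1 _ _ (mE 1) s0.
have t0 : 0 <= t by rewrite addr_ge0.
have t1 : t <= 1 by rewrite /t; lra.
have vE : v = t *: ones + r *: s.
  apply/colP => j; rewrite !mxE mulr1 -!/(v _ _).
  have sE : s 1 0 = s 0 0 - 1 by lra.
  have [->|->] : j = 0 \/ j = 1 by case: j => -[|[|//]] ?; [left|right]; exact/val_inj.
    have -> : torus_repr y 0 0 + (m 0 0)%:~R = v 0 0 by rewrite !mxE.
    by rewrite /t /r sE; ring.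
  have -> : torus_repr y 1 0 + (m 1 0)%:~R = v 1 0 by rewrite !mxE.
  by rewrite /t /r sE; ring.
have r0 : 0 <= r + 1 by rewrite /r; lra.
have r1 : r + 1 <= 2 by rewrite /r; lra.
have K10 : (0 : R) < K1%:R by rewrite ltr0n.
have K20 : (0 : R) < K2%:R by rewrite ltr0n.
have grid (K : nat) (z : R) : (0 : R) < K%:R -> 0 <= z ->
    `|(Num.truncn (z * K%:R))%:R / K%:R - z| <= 1 / K%:R.
  move=> K0 z0; have zK : 0 <= z * K%:R by rewrite mulr_ge0 // ltW.
  have := truncn_itv zK => /andP[h1 h2].
  rewrite -{2}[z](mulfK (lt0r_neq0 K0)) -mulrBl normrM (gtr0_norm (_ : 0 < K%:R^-1)) ?invr_gt0 //.
  rewrite ler_wpM2r ?invr_ge0 ?(ltW K0) // ler_norml.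
  by move: h2; rewrite -natr1; lra.
have ga := grid K1 t K10 t0; have gb := grid K2 _ K20 r0.
have tr (K c : nat) (z : R) : 0 <= z * K%:R -> z <= c%:R -> (Num.truncn (z * K%:R) < (c * K).+1)%N.
  move=> zK zc; rewrite ltnS -(ler_nat R) natrM.
  by apply: (@le_trans _ _ (z * K%:R)); rewrite ?truncn_le // ler_wpM2r.
exists (pt (Num.truncn (t * K1%:R)) (Num.truncn ((r + 1) * K2%:R))).
  apply: allpairs_f; rewrite mem_iota add0n leq0n andTb.
    by have := @tr K1 1%N t; rewrite mul1n; apply => //; rewrite mulr_ge0 // ltW.
  by have := @tr K2 2%N (r + 1); rewrite mul2n; apply => //; rewrite mulr_ge0 // ltW.
move=> i iN; rewrite yv !torus_iter_pi.
apply: le_lt_trans (torus_mdist_le_l1 _ _ 0) _.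
rewrite map_mx0 subr0 -mulmxBr vE.
set a := _%:R / _ in ga *; set b := _%:R / _ in gb *.
have -> : a *: ones + (b - 1) *: s - (t *: ones + r *: s) = (a - t) *: ones + (b - (r + 1)) *: s.
  by apply/colP => j; rewrite !mxE; ring.
rewrite mulmxDr -!scalemxAr; apply: le_lt_trans (l1normD _ _) _.
rewrite !l1normZ.
have [pi _ _] := cocycle_cone B_gt0 i w ones_pos.
rewrite (l1norm_pos pi) -/(cocycle_sum i w).
have h1 : `|a - t| * cocycle_sum i w <= 1 / K1%:R * Lam.
  by apply: ler_pM => //; [have := cocycle_sum_ge i w; lra|exact: cocycle_sum_mono].
have h2 : `|b - (r + 1)| * l1norm (cocycle i w *m s) <= 1 / K2%:R * 1.
  apply: ler_pM => //; first exact: l1norm_ge0.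
  by apply: le_trans (sn _ iN) _; rewrite invf_le1 ?exprn_gt0 // exprn_ege1 // ler1n.
have h3 : 1 / K1%:R * Lam < eps / 2.
  rewrite mulrAC ltr_pdivrMr //; move: K1e; rewrite ltr_pdivrMr //; lra.
have h4 : 1 / K2%:R * 1 < eps / 2.
  rewrite mulr1 ltr_pdivrMr //; move: K2e; rewrite ltr_pdivrMr //; lra.
lra.
Qed.

End SeparationAndCover.

(** * The full shift and its compactness *)

Section ShiftTopology.
Context {k : nat}.
Implicit Types (w : full_shift k) (U X : set (full_shift k)) (n : nat).

Definition agree n w w' := forall i : int, (`|i| <= n)%N -> w i = w' i.

Lemma agree_sym n w w' : agree n w w' -> agree n w' w.
Proof. by move=> h i /h. Qed.

Lemma agree_trans n w1 w2 w3 : agree n w1 w2 -> agree n w2 w3 -> agree n w1 w3.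
Proof. by move=> h1 h2 i ni; rewrite h1 // h2. Qed.

Lemma agree_le m n w w' : (m <= n)%N -> agree n w w' -> agree m w w'.
Proof. by move=> mn h i im; apply: h; exact: leq_trans mn. Qed.

Lemma agree_shift n m w w' : agree (n + m) w w' ->
  agree n (shift_iter m w) (shift_iter m w').
Proof.
move=> h i ni; rewrite !shift_iterE; apply: h; lia.
Qed.

Lemma nbhs_agree w U : nbhs w U -> exists n, forall w', agree n w w' -> U w'.
Proof.
pose F := filter_from [set: nat] (fun n => [set w' | agree n w w']).
have FF : Filter F.
  apply: filter_from_filter; first by exists 0%N.
  move=> i j _ _; exists (maxn i j) => // w' h; split; apply: agree_le h.
    exact: leq_maxl.
  exact: leq_maxr.
suff Fw : F --> w by move=> /Fw [n _ nU]; exists n => w' /nU.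
apply/cvg_sup => i V [_ [[W oW <-] WfN WV]].
by exists `|i|%N => // w' h; apply: WV => /=; rewrite -(h i).
Qed.

Lemma nbhs_agree_near w n : \forall w' \near w, agree n w w'.
Proof.
have coord (i : int) : \forall w' \near w, w' i = w i.
  have := @proj_continuous _ (fun _ : int => discrete_topology 'I_k.+2) i w.
  by move=> /(_ [set w i] (discrete_set1 _)).
have : \forall w' \near w, forall i : 'I_n.*2.+1,
    w' (i%:Z - n%:Z) = w (i%:Z - n%:Z).
  apply: (@filter_forall _ _ (fun i : 'I_n.*2.+1 =>
    [set w' : full_shift k | w' (i%:Z - n%:Z) = w (i%:Z - n%:Z)]) (nbhs w)).
  by move=> i; exact: coord.
apply: filterS => w' h i ni.
have ilt : (`|(i + n%:Z)%R| < n.*2.+1)%N by lia.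
have -> : i = (Ordinal ilt : nat)%:Z - n%:Z by rewrite /=; lia.
by rewrite h.
Qed.

Lemma compact_full_shift : compact [set: full_shift k].
Proof.
have -> : [set: full_shift k] =
    [set w | forall i : int, [set: discrete_topology 'I_k.+2] (w i)].
  by apply/seteqP; split.
apply: (@tychonoff int (fun=> discrete_topology 'I_k.+2) (fun=> setT)) => i.
by apply: finite_compact; exact: (@finite_finset 'I_k.+2).
Qed.

Lemma closed_agree X w : closed X ->
  (forall n, exists2 w', X w' & agree n w w') -> X w.
Proof.
move=> cX h; apply: cX => U /nbhs_agree[n nU].
by have [w' Xw' ww'] := h n; exists w'; split => //; exact: nU.
Qed.

End ShiftTopology.

(** * Compactness of the torus and uniform continuity *)

Section UniformContinuity.
Context {R : realType} {k : nat}.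
Implicit Types (w : full_shift k) (x y : torus R).

Lemma nbhs_mdist x (U : set (torus R)) : nbhs x U ->
  exists2 e : R, 0 < e & forall y, mdist x y < e -> U y.
Proof.
by move=> /nbhs_ballP[e /= e0 eU]; exists e => // y xy; apply: eU; rewrite ballEmdist.
Qed.

Lemma mdist_nbhs x (e : R) : 0 < e -> \forall y \near x, mdist x y < e.
Proof. by move=> e0; have := nbhsx_ballx x e e0; rewrite ballEmdist. Qed.

Lemma compact_torus : compact [set: torus R].
Proof.
pose f (z : R * R) : torus R := torus_pi (\col_i (if i == 0 then z.1 else z.2)).
have -> : [set: torus R] = f @` (`[0, 1]%classic `*` `[0, 1]%classic).
  apply/seteqP; split => // x _.
  have [m mE] := floor_shift (torus_repr x); set v := _ + _ in mE.
  exists (v 0 0, v 1 0); first by split => /=; rewrite in_itv /= mE.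
  rewrite /f -[RHS]torus_reprK; apply/eqP/torus_pi_eqP; exists m.
  apply/colP => i; rewrite mxE.
  by have [->|->] : i = 0 \/ i = 1 by case: i => -[|[|//]] ?; [left|right]; exact/val_inj.
apply: continuous_compact; last by apply: compact_setX; exact: segment_compact.
apply: continuous_subspaceT => z U /nbhs_mdist[e e0 eU].
have e2 : 0 < e / 2 by rewrite divr_gt0.
suff : \forall z' \near z, mdist (f z) (f z') < e by apply: filterS => z' /eU.
near=> z'; apply: le_lt_trans (torus_mdist_le_l1 _ _ 0) _.
rewrite map_mx0 subr0 /l1norm !mxE /=.
rewrite [e]splitr ltrD //; near: z'.
  apply: (@cvgr_dist_lt _ _ _ (nbhs z) _ (fun z : R * R => z.1) z.1) => //.
  exact: cvg_fst.
apply: (@cvgr_dist_lt _ _ _ (nbhs z) _ (fun z : R * R => z.2) z.2) => //.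
exact: cvg_snd.
Unshelve. all: by end_near. Qed.

Definition uniform_modulus (X : set (full_shift k)) (phi : full_shift k * torus R -> R) :=
  forall eta : R, 0 < eta -> exists n (e : R), 0 < e /\
    forall w w' x x', X w -> X w' -> agree n w w' -> mdist x x' <= e ->
      `|phi (w, x) - phi (w', x')| <= eta.

Lemma continuous_uniform_modulus (X : set (full_shift k)) (phi : full_shift k * torus R -> R) :
  closed X -> {within X `*` [set: torus R], continuous phi} -> uniform_modulus X phi.
Proof.
move=> cX cphi eta eta0.
have cK : compact (X `*` [set: torus R]).
  apply: compact_setX compact_torus.
  exact: (subclosed_compact cX compact_full_shift).
(* One integer governs both the window and the distance, so that the compactness criterion has a
   single parameter tending to infinity. *)
pose P n (z : full_shift k * torus R) := forall w' x', X z.1 -> X w' ->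
  agree n z.1 w' -> mdist z.2 x' <= n.+1%:R^-1 -> `|phi z - phi (w', x')| <= eta.
suff [n _ nP] : \forall n \near \oo, (X `*` [set: torus R]) `<=` P n.
  exists n, n.+1%:R^-1; split=> // w w' x x' Xw Xw' ww' xx'.
  by apply: (nP n _ (w, x)) => //=.
apply: (iffLR (compact_near_coveringP _) cK).
move=> [w0 x0] [Xw0 _].
have eta2 : 0 < eta / 2 by rewrite divr_gt0.
have /subspace_continuousP /(_ (w0, x0)) := cphi.
move=> /(_ (conj Xw0 I)) /cvgr_dist_lt /(_ _ eta2).
move=> [[U V] /= [/nbhs_agree[n0 n0U] /nbhs_mdist[e e0 eV]] UV].
have cl w' x' : X w' -> agree n0 w0 w' -> mdist x0 x' < e ->
    `|phi (w0, x0) - phi (w', x')| < eta / 2.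
  by move=> Xw' ww' xx'; apply: (UV (w', x')) => //=; split; [exact: n0U|exact: eV].
have e2 : 0 < e / 2 by rewrite divr_gt0.
pose N := maxn n0 (Num.truncn (2 / e)).+1.
exists ([set z | agree n0 w0 z.1 /\ mdist x0 z.2 < e / 2], [set n | (N <= n)%N]).
  split; last by exists N.
  exists ([set w | agree n0 w0 w], [set x | mdist x0 x < e / 2]) => //=.
  by split; [exact: nbhs_agree_near|exact: mdist_nbhs].
move=> [[w x] n] /= [[ww xx] Nn] w' x' /= Xw Xw' ww' xx'.
have h1 : `|phi (w0, x0) - phi (w, x)| < eta / 2 by apply: cl => //; lra.
have h2 : `|phi (w0, x0) - phi (w', x')| < eta / 2.
  apply: cl => //.
    by apply: (agree_trans ww); apply: agree_le ww'; apply: leq_trans Nn; exact: leq_maxl.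
  apply: le_lt_trans (metric_triangle x0 x x') _.
  suff : n.+1%:R^-1 < e / 2 by move=> h; rewrite [e]splitr ltrD // (le_lt_trans xx').
  rewrite -[e / 2]invrK ltf_pV2 ?posrE ?invr_gt0 // invf_div.
  apply: lt_le_trans (truncnS_gt _) _; rewrite ler_nat.
  by apply: leq_trans (leqW Nn); exact: leq_maxr.
have -> : phi (w, x) - phi (w', x') =
  (phi (w0, x0) - phi (w', x')) - (phi (w0, x0) - phi (w, x)) by ring.
by apply: le_trans (ler_normB _ _) _; move: h1 h2; lra.
Qed.

Lemma uniform_modulus_bounded (X : set (full_shift k)) (phi : full_shift k * torus R -> R) :
  closed X -> {within X `*` [set: torus R], continuous phi} ->
  exists K, forall w x, X w -> `|phi (w, x)| <= K.
Proof.
move=> cX cphi.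
have cK : compact (X `*` [set: torus R]).
  apply: compact_setX compact_torus.
  exact: (subclosed_compact cX compact_full_shift).
have /compact_bounded [K [_ KP]] := continuous_compact cphi cK.
exists (K + 1) => w x Xw; apply: (KP (K + 1)); first by rewrite ltrDl.
by exists (w, x).
Qed.

End UniformContinuity.

(** * Unique ergodicity *)

Section FinitarySets.
Context {k : nat}.
Implicit Types (w : full_shift k) (A : set (full_shift k)) (n : nat).

(* These are exactly the clopen sets of the full shift. *)
Definition finitary A := exists n, forall w w', agree n w w' -> A w -> A w'.

Lemma finitary0 : finitary set0.
Proof. by exists 0%N. Qed.

Lemma finitaryU A A' : finitary A -> finitary A' -> finitary (A `|` A').
Proof.
move=> [n An] [n' An']; exists (maxn n n') => w w' h [Aw|Aw]; [left|right].
  by apply: An Aw; apply: agree_le h; exact: leq_maxl.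
by apply: An' Aw; apply: agree_le h; exact: leq_maxr.
Qed.

Lemma finitaryC A : finitary A -> finitary (~` A).
Proof.
move=> [n An]; exists n => w w' h nAw Aw'; apply: nAw.
exact: An (agree_sym h) Aw'.
Qed.

Lemma finitaryI A A' : finitary A -> finitary A' -> finitary (A `&` A').
Proof.
move=> fA fA'; rewrite -[_ `&` _]setCK setCI; apply: finitaryC.
by apply: finitaryU; exact: finitaryC.
Qed.

Lemma finitary_shift_preimage A : finitary A -> finitary (@left_shift k @^-1` A).
Proof.
move=> [n An]; exists n.+1 => w w' h; apply: An.
by apply: (@agree_shift _ n 1); rewrite addn1.
Qed.

Lemma finitary_open A : finitary A -> open A.
Proof.
move=> [n An]; rewrite openE => w Aw.
by apply: filterS (nbhs_agree_near w n) => w' /An; apply.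
Qed.

Lemma finitary_closed A : finitary A -> closed A.
Proof. by move=> /finitaryC/finitary_open; rewrite openC. Qed.

Lemma finitary_hull n (X : set (full_shift k)) :
  finitary [set w | exists2 w', X w' & agree n w w'].
Proof.
by exists n => w1 w2 h [w' Xw' h']; exists w' => //; exact: agree_trans (agree_sym h) h'.
Qed.

Lemma open_bigcup_finitary A : open A ->
  exists2 F : nat -> set (full_shift k), (forall n, finitary (F n)) & A = \bigcup_n F n.
Proof.
move=> oA; exists (fun n => [set w | forall w', agree n w w' -> A w']).
  by move=> n; exists n => w1 w2 h1 h2 w' h3; apply: h2; exact: agree_trans h3.
apply/seteqP; split => [w Aw|w [n _]]; last by apply.
by have /nbhs_agree [n nA] := open_nbhs_nbhs (conj oA Aw); exists n.
Qed.

Lemma finitary_bigcup_finite (F : nat -> set (full_shift k)) :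
  (forall n, finitary (F n)) -> finitary (\bigcup_n F n) ->
  exists N, \bigcup_n F n `<=` \bigcup_(n < N) F n.
Proof.
move=> fF fU.
have cU : compact (\bigcup_n F n).
  exact: subclosed_compact (finitary_closed fU) compact_full_shift _.
suff [N _ NP] : \forall N \near \oo, \bigcup_n F n `<=` \bigcup_(n < N) F n.
  by exists N; apply: NP => /=.
apply: (iffLR (compact_near_coveringP _) cU) => w [n _ Fw].
exists (F n, [set N | (n < N)%N]) => /=.
  split; last by exists n.+1.
  exact: open_nbhs_nbhs (conj (finitary_open (fF n)) Fw).
by move=> [w' N] /= [Fw' nN]; exists n.
Qed.

(** A copy of the shift space that carries the algebra of finitary sets, the domain of the content
    before its Caratheodory extension. *)
Definition finitary_algebra : Type := full_shift k.

HB.instance Definition _ := Pointed.on finitary_algebra.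

HB.instance Definition _ := @isAlgebraOfSets.Build default_measure_display
  finitary_algebra finitary finitary0 finitaryU finitaryC.

End FinitarySets.
Arguments finitary_algebra : clear implicits.

Section BorelFinitary.
Context {k : nat}.

Lemma borel_finitaryE : (@measurable _ (borel (full_shift k))) = <<s @finitary k >>.
Proof.
apply/seteqP; split.
  apply: smallest_sub; first exact: smallest_sigma_algebra.
  move=> A /open_bigcup_finitary[F fF ->].
  by apply: sigma_algebra_bigcup => n; exact: sub_sigma_algebra.
apply: smallest_sub; first exact: smallest_sigma_algebra.
by move=> A /finitary_open oA; exact: sub_sigma_algebra.
Qed.

Lemma measurable_finitary (A : set (borel (full_shift k))) : finitary A -> measurable A.
Proof. by move=> fA; rewrite borel_finitaryE; exact: sub_sigma_algebra. Qed.

Lemma measurable_closed (A : set (borel (full_shift k))) :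
  closed (A : set (full_shift k)) -> measurable A.
Proof.
move=> cA; rewrite -[A]setCK; apply: measurableC; apply: sub_sigma_algebra.
by rewrite /= openC.
Qed.

Lemma measurable_left_shift :
  measurable_fun setT (@left_shift k : borel (full_shift k) -> borel (full_shift k)).
Proof.
apply: (@measurability _ _ _ (borel (full_shift k)) _ _ _ borel_finitaryE) => _ [A fA <-].
rewrite setTI.
by apply: measurable_finitary; exact: finitary_shift_preimage.
Qed.

End BorelFinitary.

(** * Empirical frequencies and their limit measures *)

Section EmpiricalLimit.
Context {R : realType} {k : nat}.
Implicit Types (w : full_shift k) (A : set (full_shift k)).

Definition freq N w A : R := N%:R^-1 * \sum_(i < N) \1_A (shift_iter i w).

Lemma freq_ge0 N w A : 0 <= freq N w A.
Proof. by rewrite mulr_ge0 ?invr_ge0 // sumr_ge0. Qed.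

Lemma freqT N w : (0 < N)%N -> freq N w setT = 1.
Proof.
move=> N0; rewrite /freq; under eq_bigr do rewrite indicT.
by rewrite sumr_const card_ord mulVf // pnatr_eq0 -lt0n.
Qed.

Lemma freqU N w A A' : A `&` A' = set0 -> freq N w (A `|` A') = freq N w A + freq N w A'.
Proof.
move=> AA'; rewrite /freq -mulrDr -big_split /=; congr (_ * _).
apply: eq_bigr => i _; rewrite !indicE.
have [a|a] := boolP (shift_iter i w \in A); have [b|b] := boolP (shift_iter i w \in A').
- move: a b; rewrite !inE => a b.
  by have : (A `&` A') (shift_iter i w) by []; rewrite AA'.
- by rewrite in_setU a addr0.
- by rewrite in_setU (negbTE a) b add0r.
- by rewrite in_setU (negbTE a) (negbTE b) addr0.
Qed.

Lemma freq_le1 N w A : freq N w A <= 1.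
Proof.
case: N => [|N]; first by rewrite /freq big_ord0 mulr0.
rewrite -(@freqT N.+1 w) // -(setUv A) freqU ?setICr //.
by rewrite lerDl freq_ge0.
Qed.

Lemma freq_shift N w A :
  `|freq N w (@left_shift k @^-1` A) - freq N w A| <= N%:R^-1.
Proof.
rewrite /freq -mulrBr normrM normfV normr_nat ler_piMr ?invr_ge0 //.
have -> : \sum_(i < N) \1_(@left_shift k @^-1` A) (shift_iter i w) =
    \sum_(i < N) (\1_A (shift_iter i.+1 w) : R).
  by apply: eq_bigr => i _; rewrite !indicE.
rewrite -sumrB -(big_mkord xpredT (fun i => \1_A (shift_iter i.+1 w) - \1_A (shift_iter i w))).
rewrite telescope_sumr // !indicE.
by case: (_ \in _); case: (_ \in _); rewrite ?subrr ?subr0 ?sub0r ?normrN ?normr1 ?normr0.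
Qed.

Variables (w_ : nat -> full_shift k) (N_ : nat -> nat) (U : set_system nat).
Hypothesis N_gt : forall j, (j < N_ j)%N.
Context {U_ultra : UltraFilter U}.
Hypothesis U_oo : \oo `<=` U.

Let f A j : R := freq (N_ j) (w_ j) A.

(** A limit along an ultrafilter exists for every set at once, which replaces a diagonal extraction
    over the finitary sets and makes additivity immediate. *)
Definition limit_freq A : R := lim (f A @ U).

Lemma limit_freq_cvg A : f A @ U --> limit_freq A.
Proof.
have /(_ (f A @ U)) := @segment_compact R 0 1.
case.
  by apply: (@filterE _ U) => j; rewrite /= in_itv /= /f freq_ge0 freq_le1.
move=> p [_ clp]; suff fp : f A @ U --> p by apply: cvgP fp.
move=> V Vp; have [//|UnV] := in_ultra_setVsetC (f A @^-1` V) U_ultra.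
have /clp/(_ Vp) [y [nVy Vy]] : (f A @ U) (~` V) by [].
by [].
Qed.

Lemma limit_freq_ge0 A : 0 <= limit_freq A.
Proof.
by apply: (cvgr_to_ge (@limit_freq_cvg A)); apply: nearW => j; exact: freq_ge0.
Qed.

Lemma limit_freqT : limit_freq setT = 1.
Proof.
apply/cvg_lim => //.
have -> : f setT = cst 1.
  by apply/funext => j; rewrite /f freqT // (leq_ltn_trans _ (N_gt j)).
exact: cvg_cst.
Qed.

Lemma limit_freqU A A' : A `&` A' = set0 ->
  limit_freq (A `|` A') = limit_freq A + limit_freq A'.
Proof.
move=> AA'; apply/cvg_lim => //.
have -> : f (A `|` A') = (fun j => f A j + f A' j).
  by apply/funext => j; rewrite /f freqU.
by apply: cvgD; exact: limit_freq_cvg.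
Qed.

Lemma limit_freq0 : limit_freq set0 = 0.
Proof.
have := @limit_freqU set0 set0 (setI0 _); rewrite setU0.
by move: (limit_freq _) => r; lra.
Qed.

Lemma limit_freq_shift A : limit_freq (@left_shift k @^-1` A) = limit_freq A.
Proof.
apply/eqP; rewrite -subr_eq0 -normr_le0; apply/ler_addgt0Pr => e e0; rewrite add0r.
have : (fun j => `|f (@left_shift k @^-1` A) j - f A j|) @ U -->
    `|limit_freq (@left_shift k @^-1` A) - limit_freq A|.
  by apply: cvg_norm; apply: cvgB; exact: limit_freq_cvg.
move=> /cvgr_to_le; apply.
have : \forall j \near \oo, (j.+1%:R^-1 : R) < e by exact: near_infty_natSinv_lt (PosNum e0).
move=> /U_oo; apply: filterS => j je; apply: le_trans (freq_shift _ _ _) _.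
by apply: le_trans (ltW je); rewrite lef_pV2 ?posrE ?ltr0n // ?ler_nat // (leq_ltn_trans _ (N_gt j)).
Qed.

Lemma limit_freq_big (F : nat -> set (full_shift k)) n : trivIset setT F ->
  limit_freq (\big[setU/set0]_(i < n) F i) = \sum_(i < n) limit_freq (F i).
Proof.
move=> tF; elim: n => [|n IH]; first by rewrite !big_ord0 limit_freq0.
rewrite !big_ord_recr /= limit_freqU ?IH //.
rewrite -bigcup_mkord setI_bigcupl -subset0 => w [i /= ilt [Fi Fn]].
have /trivIsetP /(_ i n I I) := tF; rewrite neq_ltn ilt => /(_ isT) h.
by have : (F i `&` F n) w by []; rewrite h.
Qed.

Definition limit_content (A : set (finitary_algebra k)) : \bar R := (limit_freq A)%:E.

Let limit_content0 : limit_content set0 = 0%E.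
Proof. by rewrite /limit_content limit_freq0. Qed.

Let limit_content_ge0 A : (0 <= limit_content A)%E.
Proof. by rewrite lee_fin limit_freq_ge0. Qed.

(* By compactness a countable disjoint union of finitary sets which is
   finitary is a finite union. *)
Let limit_content_semi_sigma_additive : semi_sigma_additive limit_content.
Proof.
move=> F mF tF mU.
have [N FN] := finitary_bigcup_finite mF mU.
apply: cvg_near_cst; exists N => // n /= Nn.
rewrite big_mkord /limit_content sumEFin -limit_freq_big //; congr (limit_freq _)%:E.
rewrite -bigcup_mkord; apply/seteqP; split => [w [i _ Fi]|w /FN [i iN Fi]].
  by exists i.
by exists i => //=; exact: leq_trans Nn.
Qed.

HB.instance Definition _ := isMeasure.Build _ (finitary_algebra k) R limit_content
  limit_content0 limit_content_ge0 limit_content_semi_sigma_additive.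

Definition limit_measure (A : set (borel (full_shift k))) : \bar R :=
  measure_extension limit_content A.

Let measurableE (A : set (borel (full_shift k))) : measurable A ->
  (@measurable _ (g_sigma_algebraType (@measurable _ (finitary_algebra k)))) A.
Proof. by rewrite borel_finitaryE. Qed.

Lemma limit_measure_finitary A : finitary A -> limit_measure A = (limit_freq A)%:E.
Proof. by move=> fA; rewrite /limit_measure /measure_extension measurable_mu_extE. Qed.

Let limit_measure0 : limit_measure set0 = 0%E.
Proof. exact: measure0. Qed.

Let limit_measure_ge0 A : (0 <= limit_measure A)%E.
Proof. exact: measure_ge0. Qed.

Let limit_measure_semi_sigma_additive : semi_sigma_additive limit_measure.
Proof.
move=> F mF tF mU; apply: measure_semi_sigma_additive => //.
  by move=> i; exact: measurableE.
exact: measurableE.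
Qed.

HB.instance Definition _ := isMeasure.Build _ (borel (full_shift k)) R limit_measure
  limit_measure0 limit_measure_ge0 limit_measure_semi_sigma_additive.

Let limit_measureT : limit_measure setT = 1%E.
Proof.
rewrite limit_measure_finitary ?limit_freqT //.
by rewrite -setC0; apply: finitaryC; exact: finitary0.
Qed.

HB.instance Definition _ := Measure_isProbability.Build _ (borel (full_shift k)) R
  limit_measure limit_measureT.

(** The image measure under the shift, packaged as a measure so that it can be compared with
    [limit_measure] on the pi-system of finitary sets. *)
Definition shifted_limit_measure (A : set (borel (full_shift k))) : \bar R :=
  limit_measure (@left_shift k @^-1` A).

Let mshift (A : set (borel (full_shift k))) : measurable A ->
  measurable (@left_shift k @^-1` A : set (borel (full_shift k))).
Proof. by move=> mA; rewrite -[X in measurable X]setTI; exact: measurable_left_shift. Qed.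

Let shifted_limit_measure0 : shifted_limit_measure set0 = 0%E.
Proof. by rewrite /shifted_limit_measure preimage_set0 measure0. Qed.

Let shifted_limit_measure_ge0 A : (0 <= shifted_limit_measure A)%E.
Proof. exact: measure_ge0. Qed.

Let shifted_limit_measure_semi_sigma_additive : semi_sigma_additive shifted_limit_measure.
Proof.
move=> F mF tF mU; rewrite /shifted_limit_measure preimage_bigcup.
apply: (@measure_semi_sigma_additive _ _ _ limit_measure) => //.
- by move=> i; exact: mshift.
- apply/trivIsetP => i j _ _ ij; rewrite -preimage_setI.
  by move/trivIsetP : tF => /(_ _ _ I I ij) ->; rewrite preimage_set0.
- by rewrite -preimage_bigcup; exact: mshift.
Qed.

HB.instance Definition _ := isMeasure.Build _ (borel (full_shift k)) R
  shifted_limit_measure shifted_limit_measure0 shifted_limit_measure_ge0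
  shifted_limit_measure_semi_sigma_additive.

Let finitaryT : finitary [set: full_shift k].
Proof. by rewrite -setC0; apply: finitaryC; exact: finitary0. Qed.

Lemma limit_measure_shift (A : set (borel (full_shift k))) : measurable A ->
  limit_measure (@left_shift k @^-1` A) = limit_measure A.
Proof.
move=> mA; rewrite -/(shifted_limit_measure A).
have uniq := measure_unique (@finitary k : set (set (borel (full_shift k)))) (fun=> setT)
  borel_finitaryE.
apply: (uniq R _ _ _ shifted_limit_measure limit_measure) => //.
- by move=> C D; exact: finitaryI.
- by rewrite -subTset => w _; exists 0%N.
- move=> C fC; rewrite /= /shifted_limit_measure !limit_measure_finitary //.
    by rewrite limit_freq_shift.
  exact: finitary_shift_preimage.
- move=> _; rewrite /= /shifted_limit_measure preimage_setT limit_measure_finitary //.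
  exact: ltry.
Qed.

(** A closed set is the intersection of its finitary hulls. The sampled orbits stay in [X], so each
    hull has frequency 1 and its complement is negligible. *)
Lemma limit_measure_subshift (X : set (full_shift k)) : subshift X ->
  (forall j, X (w_ j)) -> limit_measure X = 1%E.
Proof.
move=> [cX shX] Xw.
have Xiter j i : X (shift_iter i (w_ j)).
  elim: i => [|i IH]; first exact: Xw.
  by rewrite -shX; exists (shift_iter i (w_ j)).
pose E n := [set w | exists2 w', X w' & agree n w w'].
have XE : X = \bigcap_n E n.
  apply/seteqP; split => [w Xw' n _|w h]; first by exists w.
  by apply: closed_agree cX _ => n; have [w' ? ?] := h n I; exists w'.
have mX : measurable (X : set (borel (full_shift k))) by exact: measurable_closed.
have E1 n : limit_measure (E n) = 1%E.
  rewrite limit_measure_finitary; last exact: finitary_hull.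
  suff -> : limit_freq (E n) = 1 by [].
  apply/cvg_lim => //.
  have -> : f (E n) = cst 1; last exact: cvg_cst.
  apply/funext => j; rewrite /f -(@freqT (N_ j) (w_ j)) ?(leq_ltn_trans _ (N_gt j)) //.
  rewrite /freq; congr (_ * _); apply: eq_bigr => i _; rewrite !indicE in_setT.
  by rewrite mem_set //; exists (shift_iter i (w_ j)).
have mE n : measurable (~` E n : set (borel (full_shift k))).
  by apply: measurableC; apply: measurable_finitary; exact: finitary_hull.
have EC n : limit_measure.-negligible (~` E n : set (borel (full_shift k))).
  apply/negligibleP => //.
  transitivity (1 - limit_measure (E n))%E; last by rewrite E1 subee.
  by apply: (probability_setC limit_measure); apply: measurable_finitary; exact: finitary_hull.
have XC : limit_measure (~` X) = 0%E.
  apply/(negligibleP limit_measure); first exact: measurableC.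
  rewrite XE setC_bigcap; exact: negligible_bigcup.
have : limit_measure (~` ~` X) = (1 - limit_measure (~` X))%E.
  by apply: (probability_setC limit_measure); exact: measurableC.
by rewrite setCK XC sube0.
Qed.

Lemma krylov_bogolyubov (X : set (full_shift k)) : subshift X -> (forall j, X (w_ j)) ->
  exists2 Q : probability (borel (full_shift k)) R, invariant_probability_on X Q &
    forall A, finitary A -> Q A = (limit_freq A)%:E.
Proof.
move=> subX Xw; exists limit_measure; last exact: limit_measure_finitary.
by split; [exact: limit_measure_subshift|exact: limit_measure_shift].
Qed.

End EmpiricalLimit.
Arguments freq {R k}.

Section UniqueErgodicity.
Context {R : realType} {k : nat} (X : set (full_shift k)).
Variable P : probability (borel (full_shift k)) R.
Hypothesis P_unique : unique_invariant_probability_on X P.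
Hypothesis subX : subshift X.

(** If uniformity failed, there would be bad orbit segments of unbounded length; the invariant
    measure extracted from them gives [A] a mass at distance at least [e] from [P A], against
    uniqueness. *)
Lemma uniform_frequency (A : set (full_shift k)) (e : R) : finitary A -> 0 < e ->
  exists N0, forall N w, (N0 < N)%N -> X w -> `|freq N w A - fine (P A)| <= e.
Proof.
move=> fA e0; apply: contrapT => /forallNP H.
have {}H j : exists Nw : nat * full_shift k,
    [/\ (j < Nw.1)%N, X Nw.2 & e < `|freq Nw.1 Nw.2 A - fine (P A)|].
  have /existsNP [N /existsNP [w /not_implyP [jN /not_implyP [Xw /negP h]]]] := H j.
  by exists (N, w); split => //; rewrite ltNge.
have [g gE] := choice H.
have [U [UU ooU]] := ultraFilterLemma (_ : ProperFilter \oo).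
pose N_ j := (g j).1; pose w_ j := (g j).2.
have N_gt j : (j < N_ j)%N by case: (gE j).
have Xw j : X (w_ j) by case: (gE j).
have [Q Qinv QE] := krylov_bogolyubov (R := R) N_gt ooU subX Xw.
have QA : Q A = P A by exact: (P_unique.2 Q Qinv A (measurable_finitary fA)).
have lim : (fun j => `|freq (N_ j) (w_ j) A - fine (P A)|) @ U --> `|fine (P A) - fine (P A)|.
  apply: cvg_norm; apply: cvgB; last exact: cvg_cst.
  by rewrite -QA QE //=; exact: limit_freq_cvg.
have : e <= `|fine (P A) - fine (P A)|.
  by apply: (cvgr_to_ge lim); apply: nearW => j; case: (gE j) => _ _ /ltW.
by rewrite subrr normr0 leNgt e0.
Qed.

End UniqueErgodicity.

(** * Uniform convergence of additive and almost additive averages *)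

Section UniformAverages.
Context {R : realType} {k : nat} (X : set (full_shift k)).
Variable P : probability (borel (full_shift k)) R.
Hypothesis P_unique : unique_invariant_probability_on X P.
Hypothesis subX : subshift X.
Implicit Types (w : full_shift k) (n N : nat).

Lemma subshift_iter n w : X w -> X (shift_iter n w).
Proof.
move=> Xw; elim: n => [//|n IH]; have [_ sX] := subX.
by rewrite -sX; exists (shift_iter n w).
Qed.

Lemma subshift_nonempty : X !=set0.
Proof.
apply/set0P/eqP => X0; have [[PX _] _] := P_unique.
by move: PX; rewrite X0 measure0 => -[] /eqP; rewrite eq_sym oner_eq0.
Qed.

Definition average N (f : full_shift k -> R) w : R :=
  N%:R^-1 * \sum_(i < N) f (shift_iter i w).

Definition window n w : {ffun 'I_n.*2.+1 -> 'I_k.+2} := [ffun i : 'I_n.*2.+1 => w ((i : nat)%:Z - n%:Z)].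

Lemma window_agree n w w' : window n w = window n w' -> agree n w w'.
Proof.
move=> /ffunP h i ni.
have ilt : (`|(i + n%:Z)%R| < n.*2.+1)%N by lia.
have iE : i = (Ordinal ilt : nat)%:Z - n%:Z by rewrite /=; lia.
by have := h (Ordinal ilt); rewrite !ffunE -iE.
Qed.

Lemma agree_window n w w' : agree n w w' -> window n w = window n w'.
Proof. by move=> h; apply/ffunP => i; rewrite !ffunE h //; case: i => i /=; lia. Qed.

(** Only the oscillation on windows matters: [f] is replaced by a function of the window of radius
    [n], a finite combination of indicators of finitary sets. This form applies to suprema over
    fibers. *)
Lemma uniform_average (f : full_shift k -> R) n (K eta : R) : 0 < eta ->
  (forall w, X w -> `|f w| <= K) ->
  (forall w w', X w -> X w' -> agree n w w' -> `|f w - f w'| <= eta) ->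
  exists l N0, forall N w, (N0 < N)%N -> X w -> `|average N f w - l| <= 2 * eta.
Proof.
move=> eta0 fK fagree.
pose T : finType := {ffun 'I_n.*2.+1 -> 'I_k.+2}.
pose C (u : T) := [set w | window n w = u].
have fC u : finitary (C u).
  by exists n => w w' h <-; apply/esym/agree_window.
have K0 : 0 <= K.
  by have [w Xw] := subshift_nonempty; exact: le_trans (fK w Xw).
have value u : exists v, `|v| <= K /\ forall w, X w -> C u w -> `|f w - v| <= eta.
  have [[w0 [Xw0 Cw0]]|no] := pselect (exists w, X w /\ C u w); last first.
    by exists 0; rewrite normr0; split => // w Xw Cw; exfalso; apply: no; exists w.
  exists (f w0); split; first exact: fK.
  by move=> w Xw Cw; apply: fagree => //; apply: window_agree; rewrite Cw Cw0.
have [v vE] := choice value.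
pose e := eta / (K * #|T|%:R + 1).
have D0 : 0 < K * #|T|%:R + 1 by rewrite ltr_wpDl // mulr_ge0.
have e0 : 0 < e by rewrite divr_gt0.
have fr u : exists N0, forall N w, (N0 < N)%N -> X w -> `|freq N w (C u) - fine (P (C u))| <= e.
  exact (uniform_frequency P_unique subX (fC u) e0).
have [N0 N0E] := choice fr.
exists (\sum_u v u * fine (P (C u))), (\max_u N0 u)%N => N w NN Xw.
have N0' : (0 < N)%N by exact: leq_ltn_trans NN.
have NR : (0 : R) < N%:R by rewrite ltr0n.
have step1 : `|average N f w - \sum_u v u * freq N w (C u)| <= eta.
  have -> : \sum_u v u * freq N w (C u) = average N (fun w => v (window n w)) w.
    rewrite /average /freq; under eq_bigr do rewrite mulrCA mulr_sumr.
    rewrite -mulr_sumr exchange_big /=; congr (_ * _); apply: eq_bigr => i _.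
    rewrite (bigD1 (window n (shift_iter i w))) //= big1 => [|u uN].
      by rewrite indicE mem_set // mulr1 addr0.
    rewrite indicE memNset ?mulr0 // => Cu; move: uN; rewrite Cu eqxx //.
  rewrite /average -mulrBr -sumrB normrM gtr0_norm ?invr_gt0 // mulrC ler_pdivrMr //.
  apply: le_trans (ler_norm_sum _ _ _) _.
  apply: (@le_trans _ _ (\sum_(i < N) eta)); last first.
    by rewrite sumr_const card_ord mulr_natr.
  apply: ler_sum => i _; have [_] := vE (window n (shift_iter i w)); apply => //.
  exact: subshift_iter.
have step2 : `|\sum_u v u * freq N w (C u) - \sum_u v u * fine (P (C u))| <= eta.
  rewrite -sumrB; apply: le_trans (ler_norm_sum _ _ _) _.
  apply: (@le_trans _ _ (\sum_(u : T) K * e)); last first.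
    rewrite sumr_const -mulr_natr mulrAC /e mulrA ler_pdivrMr // mulrC.
    by rewrite ler_wpM2l ?(ltW eta0) // lerDl.
  apply: ler_sum => u _; rewrite -mulrBr normrM ler_pM //.
    by case: (vE u).
  by apply: N0E => //; apply: leq_ltn_trans NN; exact: leq_bigmax.
move: step1 step2; set a := average _ _ _; set b := \sum_u _; set c := \sum_u _ => h1 h2.
have -> : a - c = (a - b) + (b - c) by ring.
by apply: le_trans (ler_normD _ _) _; lra.
Qed.

(** Adding [N] consecutive increments of step [n] is the same as adding [n] consecutive increments
    of step [N], and each of the latter is close to [s N]. *)
Lemma telescoping (s : nat -> R) (K C : R) n N : 0 <= K ->
  (forall i j, `|s (i + j)%N - s i| <= K * j%:R + C) -> (forall j, `|s j| <= K * j%:R + C) ->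
  `|\sum_(i < N) (s (n + i)%N - s i) - n%:R * s N| <= n%:R * (2 * (K * n%:R + C)).
Proof.
move=> K0 sK s0.
have -> : \sum_(i < N) (s (n + i)%N - s i) = \sum_(i < n) (s (N + i)%N - s i).
  rewrite !sumrB; apply/eqP; rewrite subr_eq addrAC eq_sym subr_eq addrC.
  rewrite [X in _ == X]addrC -!(big_mkord xpredT s).
  have h a b : \sum_(0 <= i < a + b) s i = \sum_(0 <= i < a) s i + \sum_(i < b) s (a + i)%N.
    elim: b => [|b IH]; first by rewrite addn0 big_ord0 addr0.
    by rewrite addnS big_nat_recr //= IH big_ord_recr addrA.
  by rewrite -!h addnC.
have -> : n%:R * s N = \sum_(i < n) s N by rewrite sumr_const card_ord mulr_natl.
rewrite -sumrB; apply: le_trans (ler_norm_sum _ _ _) _.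
have -> : n%:R * (2 * (K * n%:R + C)) = \sum_(i < n) (2 * (K * n%:R + C)).
  by rewrite sumr_const card_ord mulr_natl.
apply: ler_sum => i _.
have -> : s (N + i)%N - s i - s N = (s (N + i)%N - s N) - s i by ring.
apply: le_trans (ler_normB _ _) _.
have in_ : K * i%:R <= K * n%:R by rewrite ler_wpM2l // ler_nat ltnW.
by have := sK N i; have := s0 i; lra.
Qed.

(** A Cauchy criterion uniform in the base point: the limit is the supremum of the certified lower
    bounds [a - eta], each of which is below every certified upper bound. *)
Lemma uniform_limit (g : nat -> full_shift k -> R) :
  (forall eta, 0 < eta -> exists a N0, forall N w, (N0 < N)%N -> X w -> `|g N w - a| <= eta) ->
  exists l, forall eta, 0 < eta -> exists N0, forall N w, (N0 < N)%N -> X w -> `|g N w - l| <= eta.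
Proof.
move=> gU.
pose A := [set r : R | exists a eta N0, r = a - eta /\
  forall N w, (N0 < N)%N -> X w -> `|g N w - a| <= eta].
have [w Xw] := subshift_nonempty.
have cross a eta N0 a' eta' N0' :
    (forall N w, (N0 < N)%N -> X w -> `|g N w - a| <= eta) ->
    (forall N w, (N0' < N)%N -> X w -> `|g N w - a'| <= eta') -> a - eta <= a' + eta'.
  move=> /(_ (maxn N0 N0').+1 w) h /(_ (maxn N0 N0').+1 w) h'.
  have := h _ Xw; have := h' _ Xw; rewrite !ltnS leq_maxl leq_maxr => /(_ isT) + /(_ isT).
  by rewrite !ler_norml => /andP[? ?] /andP[? ?]; lra.
have A0 : A !=set0.
  by have [a [N0 h]] := gU 1 ltr01; exists (a - 1), a, 1, N0.
have Aub a eta N0 : (forall N w, (N0 < N)%N -> X w -> `|g N w - a| <= eta) ->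
    ubound A (a + eta).
  by move=> h _ [a' [eta' [N0' [-> h']]]]; exact: cross h' h.
exists (sup A) => eta eta0; have e2 : 0 < eta / 2 by rewrite divr_gt0.
have [a [N0 h]] := gU _ e2; exists N0 => N w' NN Xw'.
have lo : a - eta / 2 <= sup A.
  by apply: ub_le_sup; [exists (a + eta / 2); exact: Aub h|exists a, (eta / 2), N0].
have hi : sup A <= a + eta / 2 by apply: ge_sup => //; exact: Aub h.
by have := h N w' NN Xw'; rewrite !ler_norml => /andP[? ?]; apply/andP; split; lra.
Qed.

(** By almost additivity the sum of [f n] along an orbit of length [N] differs from [n * f N] by at
    most [C] per term, up to end effects. Thus [f N / N] is within about [C / n] of the average of
    [f n / n], which converges uniformly up to small errors. *)
Lemma almost_additive_limit (f : nat -> full_shift k -> R) (K C : R) : 0 <= K ->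
  (forall m n w, `|f (m + n)%N w - f m (shift_iter n w) - f n w| <= C) ->
  (forall n w, `|f n w| <= K * n%:R) ->
  (forall n w w', agree n w w' -> f n w = f n w') ->
  exists l, forall eta, 0 < eta -> exists N0, forall N w, (N0 < N)%N -> X w ->
    `|f N w / N%:R - l| <= eta.
Proof.
move=> K0 fC fK fagree; apply: uniform_limit => eta eta0.
have C0 : 0 <= C by have [w _] := subshift_nonempty; exact: le_trans (fC 0%N 0%N w).
pose n := (Num.truncn (4 * C / eta)).+1.
have n0 : (0 : R) < n%:R by rewrite ltr0n.
have nC : 4 * C / eta < n%:R by exact: truncnS_gt.
have eta8 : 0 < eta / 8 by rewrite divr_gt0.
have [l [N0 avg]] := @uniform_average (f n) n (K * n%:R) (eta / 8) eta8 (fun w _ => fK n w)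
  (fun w w' _ _ h => ltac:(by rewrite (fagree _ _ _ h) subrr normr0 ltW)).
pose E := 2 * (K * n%:R + C).
pose N1 := (Num.truncn (4 * E / eta)).+1.
have N1E : 4 * E / eta < N1%:R by exact: truncnS_gt.
exists (l / n%:R), (maxn N0 N1) => N w; rewrite gtn_max => /andP[NN0 NN1] Xw.
have NR : (0 : R) < N%:R by rewrite ltr0n (leq_trans _ NN1).
have h1 := avg N w NN0 Xw.
have h2 : `|\sum_(i < N) (f (n + i)%N w - f i w) - n%:R * f N w| <= n%:R * E.
  apply: (@telescoping (f^~ w) K C) => //.
    move=> i j; rewrite addnC; have := fC j i w; have := fK j (shift_iter i w).
    by rewrite !ler_norml => /andP[? ?] /andP[? ?]; apply/andP; split; lra.
  by move=> j; apply: le_trans (fK _ _) _; rewrite lerDl.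
have h3 : `|\sum_(i < N) (f (n + i)%N w - f i w) - N%:R * average N (f n) w| <= N%:R * C.
  rewrite /average mulVKf ?lt0r_neq0 // -sumrB; apply: le_trans (ler_norm_sum _ _ _) _.
  have -> : N%:R * C = \sum_(i < N) C by rewrite sumr_const card_ord mulr_natl.
  by apply: ler_sum => i _; rewrite addrAC; exact: fC.
move: h1 h2 h3; set a := average _ _ _; set s := \sum_(i < N) _; set F := f N w => h1 h2 h3.
have nN : 0 < n%:R * N%:R :> R by rewrite mulr_gt0.
have -> : F / N%:R - l / n%:R = (n%:R * F - N%:R * l) / (n%:R * N%:R).
  by field; rewrite !lt0r_neq0.
rewrite normrM normfV (gtr0_norm nN) ler_pdivrMr //.
have -> : n%:R * F - N%:R * l = - (s - n%:R * F) + (s - N%:R * a) + N%:R * (a - l) by ring.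
apply: le_trans (ler_normD _ _) _; apply: le_trans (lerD (ler_normD _ _) (lexx _)) _.
rewrite normrN normrM (gtr0_norm NR).
have h4 : N%:R * `|a - l| <= N%:R * (eta / 4) by rewrite ler_wpM2l ?(ltW NR) //; lra.
have h5 : N%:R * C <= N%:R * (n%:R * (eta / 4)).
  rewrite ler_wpM2l ?(ltW NR) //; move: nC; rewrite ltr_pdivrMr //; lra.
have h6 : n%:R * E <= n%:R * (N%:R * (eta / 4)).
  rewrite ler_wpM2l ?(ltW n0) //; move: N1E; rewrite ltr_pdivrMr // => h.
  have : N1%:R * eta <= N%:R * eta by rewrite ler_wpM2r ?(ltW eta0) // ler_nat ltnW.
  lra.
have h7 : N%:R * (eta / 4) <= n%:R * (N%:R * (eta / 4)).
  by rewrite ler_peMl ?mulr_ge0 ?(ltW NR) ?divr_ge0 ?(ltW eta0) // ler1n.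
have -> : eta * (n%:R * N%:R) = 4 * (n%:R * (N%:R * (eta / 4))) by field.
have h8 : 0 <= n%:R * (N%:R * (eta / 4)).
  by rewrite !mulr_ge0 ?(ltW NR) ?(ltW n0) ?(ltW eta0).
have : N%:R * (n%:R * (eta / 4)) = n%:R * (N%:R * (eta / 4)) by ring.
lra.
Qed.

End UniformAverages.

(** * Growth rate and Birkhoff sums *)

Section Growth.
Context {R : realType} {k : nat} (B : 'I_k.+2 -> 'M[int]_2).
Hypothesis B_gt0 : forall i p q, 0 < B i p q.
Variable X : set (full_shift k).
Variable P : probability (borel (full_shift k)) R.
Hypothesis P_unique : unique_invariant_probability_on X P.
Hypothesis subX : subshift X.
Implicit Types (w : full_shift k) (m n N : nat).

Local Notation S := (@entry_bound R k B).
Local Notation cocycle := (@cocycle R k B).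
Local Notation cocycle_sum := (@cocycle_sum R k B).
Local Notation ones := (@ones R).

Lemma cocycle_agree n w w' : agree n w w' -> cocycle n w = cocycle n w'.
Proof.
elim: n => [//|n IH] h /=; rewrite IH; last exact: agree_le h.
congr (real_mx B _ *m _); rewrite !shift_iterE; apply: h.
by rewrite add0r absz_nat.
Qed.

(** By [core_cone], [u] lies coordinatewise between [coord_sum u / S] and [coord_sum u] times
    [ones], and a matrix preserving the positive cone is monotone. *)
Lemma cocycle_sum_mul m n w :
  cocycle_sum m (shift_iter n w) * cocycle_sum n w / S <= cocycle_sum (m + n) w <=
  cocycle_sum m (shift_iter n w) * cocycle_sum n w.
Proof.
have S4 := @entry_bound_ge4 R k B B_gt0.
have S0 : 0 < S by lra.
have [u0 uc _] := cocycle_cone B_gt0 n w (@ones_pos R).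
have {}uc := uc (ones_core B_gt0).
rewrite /cocycle_sum cocycleD -mulmxA; set u := cocycle n w *m ones in u0 uc *.
set M := cocycle m _.
have sumB (a b : 'cV[R]_2) : coord_sum (a - b) = coord_sum a - coord_sum b.
  by rewrite /coord_sum !mxE; ring.
have mono (a b : 'cV[R]_2) : pos_cone (a - b) -> coord_sum (M *m b) <= coord_sum (M *m a).
  move=> ab; rewrite -subr_ge0 -sumB -mulmxBr.
  by have [[? ?] _ _] := cocycle_cone B_gt0 m (shift_iter n w) ab; rewrite addr_ge0.
have [u1 u2] := u0; have [c1 c2] := uc.
have E (c : R) : coord_sum (M *m (c *: ones)) = coord_sum (M *m ones) * c.
  by rewrite -scalemxAr coord_sumZ mulrC.
have F1 (a : 'cV[R]_2) c j : (a - c *: ones) j 0 = a j 0 - c by rewrite !mxE mulr1.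
have F2 (a : 'cV[R]_2) c j : (c *: ones - a) j 0 = c - a j 0 by rewrite !mxE mulr1.
apply/andP; split.
  rewrite -mulrA -E; apply: mono; split; rewrite F1.
    by rewrite subr_ge0 ler_pdivrMr // mulrC.
  by rewrite subr_ge0 ler_pdivrMr // mulrC.
rewrite -E; apply: mono; split; rewrite F2 /coord_sum.
  by rewrite addrAC subrr add0r.
by rewrite addrK.
Qed.

Definition growth n w : R := ln (cocycle_sum n w / 2).

Lemma growthE n w : cocycle_sum n w = 2 * expR (growth n w).
Proof.
have L2 := @cocycle_sum_ge R k B B_gt0 n w.
by rewrite /growth lnK ?posrE; [field|lra].
Qed.

Lemma growth_ge0 n w : 0 <= growth n w.
Proof. by rewrite ln_ge0 //; have := @cocycle_sum_ge R k B B_gt0 n w; lra. Qed.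

Lemma growth_additive m n w :
  `|growth (m + n) w - growth m (shift_iter n w) - growth n w| <= ln S.
Proof.
have S4 := @entry_bound_ge4 R k B B_gt0.
have S0 : 0 < S by lra.
have /andP[lo hi] := cocycle_sum_mul m n w.
move: lo hi; rewrite !growthE.
set a := growth (m + n) w; set b := growth m _; set c := growth n w => lo hi.
have SE : expR (ln S) = S by rewrite lnK // posrE.
have bc : 2 * expR b * (2 * expR c) = 4 * expR (b + c) by rewrite expRD; ring.
rewrite bc in lo hi.
have h1 : b + c - ln S <= a.
  rewrite -ler_expR expRB SE ler_pdivrMr //.
  by move: lo; rewrite ler_pdivrMr //; have := expR_gt0 (b + c); lra.
have h2 : a <= b + c + ln S.
  rewrite -ler_expR expRD SE; have := expR_gt0 (b + c); nra.
by rewrite ler_norml; apply/andP; split; lra.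
Qed.

Lemma growth_le n w : growth n w <= ln S * n%:R.
Proof.
have S4 := @entry_bound_ge4 R k B B_gt0.
have S0 : 0 < S by lra.
rewrite -ler_expR mulrC expRM_natl lnK ?posrE //.
rewrite -(ler_pM2l (_ : 0 < 2 :> R)) // -growthE.
elim: n => [|n IH]; first by rewrite /cocycle_sum mul1mx coord_sum_ones expr0 mulr1.
apply: le_trans (cocycle_step_le B_gt0 _ _ (@ones_pos R)) _.
by rewrite exprS mulrCA ler_wpM2l // ltW.
Qed.

Lemma growth_ge n w : ln 2 * n%:R <= growth n w.
Proof.
rewrite -ler_expR mulrC expRM_natl lnK ?posrE // -(ler_pM2l (_ : 0 < 2 :> R)) // -growthE.
have [_ _] := cocycle_cone B_gt0 n w (@ones_pos R).
by rewrite coord_sum_ones mulrC.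
Qed.

Lemma growth_rate : exists2 lam : R, 0 < lam & forall eta, 0 < eta ->
  exists N0, forall N w, (N0 < N)%N -> X w ->
    expR ((lam - eta) * N%:R) <= cocycle_sum N w <= expR ((lam + eta) * N%:R).
Proof.
have S4 := @entry_bound_ge4 R k B B_gt0.
have lnS : 0 <= ln S by rewrite ln_ge0 //; lra.
have [lam lamE] := almost_additive_limit P_unique subX lnS growth_additive
  (fun n w => ltac:(by rewrite ger0_norm ?growth_ge0 // growth_le))
  (fun n w w' h => ltac:(by rewrite /growth /cocycle_sum (cocycle_agree h))).
have [w0 Xw0] := subshift_nonempty P_unique.
exists lam.
  have ln2 : 0 < ln 2 :> R by rewrite ln_gt0 // ltr1n.
  have [|N0 h] := lamE (ln 2 / 2); first by rewrite divr_gt0.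
  have := h N0.+1 w0 (ltnSn _) Xw0; rewrite ler_norml => /andP[_].
  have : ln 2 <= growth N0.+1 w0 / N0.+1%:R by rewrite ler_pdivlMr ?growth_ge.
  by move: (growth _ _ / _) => z; lra.
move=> eta eta0; have eta2 : 0 < eta / 2 by rewrite divr_gt0.
have [N0 h] := lamE _ eta2.
exists (maxn N0 (Num.truncn (2 * ln 2 / eta))) => N w; rewrite gtn_max => /andP[NN0 NN1] Xw.
have NR : (0 : R) < N%:R by rewrite ltr0n (leq_trans _ NN0).
have Neta : 2 * ln 2 < N%:R * eta.
  rewrite -ltr_pdivrMr //; apply: lt_le_trans (truncnS_gt _) _.
  by rewrite ler_nat.
have := h N w NN0 Xw; rewrite ler_norml => /andP[].
rewrite lerBrDr ler_pdivlMr // => h1; rewrite lerBlDr ler_pdivrMr // => h2.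
have ln20 : 0 <= ln 2 :> R by rewrite ln_ge0 // ler1n.
have -> : cocycle_sum N w = expR (ln 2 + growth N w).
  by rewrite expRD lnK ?posrE // growthE.
have p0 : 0 <= eta / 2 * N%:R by rewrite mulr_ge0 ?ltW.
by rewrite !ler_expR; apply/andP; split; lra.
Qed.

End Growth.

(** * Birkhoff sums along the fibers *)

Section BirkhoffSums.
Context {R : realType} {k : nat} (B : 'I_k.+2 -> 'M[int]_2).
Hypothesis B_gt0 : forall i p q, 0 < B i p q.
Hypothesis B_det : forall i, `|B i 0 0 * B i 1 1 - B i 1 0 * B i 0 1| = 1.
Variable X : set (full_shift k).
Variable P : probability (borel (full_shift k)) R.
Hypothesis P_unique : unique_invariant_probability_on X P.
Hypothesis subX : subshift X.
Implicit Types (w : full_shift k) (m n N q : nat) (x y : torus R)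
  (phi : full_shift k * torus R -> R).

Local Notation S := (@entry_bound R k B).
Local Notation torus_iter := (@torus_iter R k B).

Definition birkhoff phi n w x : R :=
  \sum_(i < n) phi (shift_iter i w, torus_iter i w x).

Lemma birkhoffD phi m n w x : birkhoff phi (m + n) w x =
  birkhoff phi m w x + birkhoff phi n (shift_iter m w) (torus_iter m w x).
Proof.
rewrite /birkhoff big_split_ord /=; congr (_ + _); apply: eq_bigr => i _.
by rewrite shift_iterD -torus_iterD [(m + i)%N]addnC.
Qed.

Lemma birkhoffN phi n w x : birkhoff (fun z => - phi z) n w x = - birkhoff phi n w x.
Proof. by rewrite /birkhoff sumrN. Qed.

Lemma birkhoff_le phi K n w x : (forall w x, X w -> `|phi (w, x)| <= K) -> X w ->
  `|birkhoff phi n w x| <= K * n%:R.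
Proof.
move=> phiK Xw; apply: le_trans (ler_norm_sum _ _ _) _.
have -> : K * n%:R = \sum_(i < n) K by rewrite sumr_const card_ord mulr_natr.
by apply: ler_sum => i _; apply: phiK; exact: subshift_iter.
Qed.

Lemma torus_iter_surj n w y : exists x, torus_iter n w x = y.
Proof.
exists (torus_pi (invmx (cocycle B n w) *m torus_repr y)).
by rewrite torus_iter_pi mulKVmx ?torus_reprK // cocycle_unit.
Qed.

Definition fiber_modulus phi (d eta : R) := forall w x x', X w -> mdist x x' <= d ->
  `|phi (w, x) - phi (w, x')| <= eta.

Lemma birkhoff_trace phi K eta n G w z y :
  (forall w x, X w -> `|phi (w, x)| <= K) -> fiber_modulus phi (3 * S / 2 ^+ G) eta ->
  X w -> traces B n G w z y -> forall j,
  `|birkhoff phi (n + G.*2) (shift_iter (j * (n + G.*2)) w) (torus_iter (j * (n + G.*2)) w y) -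
    birkhoff phi n (shift_iter (j * (n + G.*2) + G) w) (z j)| <=
    n%:R * eta + 2 * K * G%:R.
Proof.
move=> phiK phi_mod Xw tr j; set M := (n + G.*2)%N.
have ME : M = (G + (n + G))%N by rewrite /M -addnn addnCA.
rewrite [in birkhoff phi M]ME !birkhoffD.
set w' := shift_iter (j * M) w; set y' := torus_iter (j * M) w y.
have Xw' : X w' by exact: subshift_iter.
have w'G : shift_iter (j * M + G) w = shift_iter G w' by rewrite shift_iterD addnC.
have h1 := birkhoff_le G y' phiK Xw'.
have h2 := birkhoff_le G (torus_iter n (shift_iter G w') (torus_iter G w' y')) phiK
  (subshift_iter subX n (subshift_iter subX G Xw')).
have h3 : `|birkhoff phi n (shift_iter G w') (torus_iter G w' y') -
    birkhoff phi n (shift_iter G w') (z j)| <= n%:R * eta.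
  rewrite /birkhoff -sumrB; apply: le_trans (ler_norm_sum _ _ _) _.
  have -> : n%:R * eta = \sum_(i < n) eta by rewrite sumr_const card_ord mulr_natl.
  apply: ler_sum => i _; apply: phi_mod; first by do 2 apply: subshift_iter => //.
  have := tr j i (ltn_ord i); rewrite -/M w'G.
  by rewrite -torus_iterD /y' -torus_iterD [(i + G + _)%N]addnC [(i + G)%N]addnC.
rewrite w'G.
move: h1 h2 h3; set a := birkhoff phi G _ _; set b := birkhoff phi G _ _.
set c := birkhoff phi n _ _; set d := birkhoff phi n _ _.
rewrite !ler_norml => /andP[? ?] /andP[? ?] /andP[? ?]; apply/andP; split; lra.
Qed.

Lemma birkhoff_mul phi q M w x : birkhoff phi (q * M) w x =
  \sum_(j < q) birkhoff phi M (shift_iter (j * M) w) (torus_iter (j * M) w x).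
Proof.
elim: q => [|q IH]; first by rewrite /birkhoff !big_ord0.
by rewrite mulSn addnC birkhoffD IH big_ord_recr.
Qed.

(** Splitting the sum by residues modulo [M], some residue class does at least as well as the
    average. *)
Lemma best_offset (g : nat -> R) q M c : (0 < M)%N ->
  (q * M)%:R * c <= \sum_(i < q * M) g i ->
  exists2 r, (r < M)%N & q%:R * c <= \sum_(j < q) g (j * M + r)%N.
Proof.
move=> M0 gc; apply: contrapT => H.
have {}H (r : 'I_M) : \sum_(j < q) g (j * M + r)%N < q%:R * c.
  by rewrite ltNge; apply/negP => h; apply: H; exists r.
have gE : \sum_(i < q * M) g i = \sum_(r < M) \sum_(j < q) g (j * M + r)%N.
  rewrite exchange_big /=; elim: q {gc H} => [|q IH]; first by rewrite !big_ord0.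
  by rewrite big_ord_recr /= -IH mulSn addnC big_split_ord.
move: gc; rewrite gE leNgt => /negP; apply.
have -> : (q * M)%:R * c = \sum_(r < M) q%:R * c.
  by rewrite sumr_const card_ord -[RHS]mulr_natl natrM; ring.
apply: ltr_sum => [|r _]; last exact: H.
by apply/hasP; exists (Ordinal M0) => //; exact: mem_index_enum.
Qed.

(** High averages are known only over [w0]. The supremum [A] of the [n]-step sums over a fiber
    depends on the base point alone, and up to a small error on a window of it, so unique ergodicity
    carries its orbit average from [w0] to every [w]. Near-maximizers at the best offset modulo [M]
    are then traced by a single point. *)
Lemma upper_average phi (a : R) w0 x0 :
  uniform_modulus X phi -> (exists K, forall w x, X w -> `|phi (w, x)| <= K) ->
  X w0 -> (forall N, exists2 n, (N < n)%N & a * n%:R <= birkhoff phi n w0 x0) ->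
  forall eta, 0 < eta -> exists n0, forall n w, (n0 < n)%N -> X w ->
    exists x, (a - eta) * n%:R <= birkhoff phi n w x.
Proof.
move=> phi_mod [K0 phiK0] Xw0 freq_a eta eta0.
pose K := `|K0| + `|a|.
have phiK w x : X w -> `|phi (w, x)| <= K.
  move=> Xw; apply: le_trans (phiK0 w x Xw) _.
  by apply: le_trans (ler_norm _) _; rewrite lerDl.
have K_ge0 : 0 <= K by rewrite addr_ge0.
have aK : `|a| <= K by rewrite lerDr.
have S4 := @entry_bound_ge4 R k B B_gt0.
(* Ten errors of size [e] per step: three in the lower bound for [l], two from the uniform average,
   one for taking near-maximizers, two for tracing, one for the gaps and one for the two ends. *)
pose e := eta / 10; have e0 : 0 < e by rewrite divr_gt0.
have [m [d [d0 modE]]] := phi_mod e e0.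
pose G := (Num.truncn (3 * S / d)).+1.
have Gd : 3 * S / 2 ^+ G <= d.
  rewrite ler_pdivrMr ?exprn_gt0 // -ler_pdivrMl // mulrC.
  apply: le_trans (ltW (truncnS_gt _)) _; rewrite -/G.
  by rewrite -natrX ler_nat ltnW // ltn_expl.
have phiG : fiber_modulus phi (3 * S / 2 ^+ G) e.
  by move=> w x x' Xw xx'; apply: modE => //; exact: le_trans Gd.
pose n := (Num.truncn (2 * K * G%:R / e)).+1.
have nR : (0 : R) < n%:R by rewrite ltr0n.
have nE : 2 * K * G%:R <= n%:R * e.
  by rewrite -ler_pdivrMr //; exact: ltW (truncnS_gt _).
set M := (n + G.*2)%N.
have MR : M%:R = n%:R + 2 * G%:R :> R by rewrite natrD -muln2 natrM mulrC.
have M0 : (0 < M)%N by rewrite addn_gt0.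
pose V w := [set birkhoff phi n w x | x in [set: torus R]].
pose A w := sup (V w).
have V0 w : V w !=set0 by exists (birkhoff phi n w point); exists point.
have VK w : X w -> ubound (V w) (K * n%:R).
  by move=> Xw _ [x _ <-]; apply: le_trans (ler_norm _) _; exact: birkhoff_le.
have Vsup w : X w -> has_sup (V w).
  by move=> Xw; split => //; exists (K * n%:R); exact: VK.
have A_ge w x : X w -> birkhoff phi n w x <= A w.
  by move=> Xw; apply: ub_le_sup; [exists (K * n%:R); exact: VK|exists x].
have A_near w : X w -> exists x, A w - n%:R * e <= birkhoff phi n w x.
  move=> Xw; have ne0 : 0 < n%:R * e by rewrite mulr_gt0.
  have [_ [x _ <-] h] := sup_adherent ne0 (Vsup w Xw).
  by exists x; exact: ltW.
have AK w : X w -> `|A w| <= K * n%:R.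
  move=> Xw; rewrite ler_norml; apply/andP; split; last by apply: ge_sup => //; exact: VK.
  apply: le_trans (A_ge w point Xw).
  by have := birkhoff_le n point phiK Xw; rewrite ler_norml => /andP[].
have birk_agree w w' x : X w -> X w' -> agree (m + n) w w' ->
    `|birkhoff phi n w x - birkhoff phi n w' x| <= n%:R * e.
  move=> Xw Xw' ww'; rewrite /birkhoff -sumrB; apply: le_trans (ler_norm_sum _ _ _) _.
  have -> : n%:R * e = \sum_(i < n) e by rewrite sumr_const card_ord mulr_natl.
  apply: ler_sum => i _.
  have -> : torus_iter i w' x = torus_iter i w x.
    rewrite -[x]torus_reprK !torus_iter_pi (@cocycle_agree _ _ _ i w w') //.
    by apply: agree_le ww'; rewrite (leq_trans (ltnW (ltn_ord i))) // leq_addl.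
  apply: modE; [exact: subshift_iter|exact: subshift_iter| |by rewrite mdistxx ltW].
  apply: agree_shift; apply: agree_le ww'; rewrite leq_add2l; exact: ltnW.
have A_agree w w' : X w -> X w' -> agree (m + n) w w' -> `|A w - A w'| <= n%:R * e.
  have one u u' : X u -> X u' -> agree (m + n) u u' -> A u <= A u' + n%:R * e.
    move=> Xu Xu' uu'; apply: ge_sup => // _ [x _ <-].
    have := birk_agree u u' x Xu Xu' uu'; rewrite ler_norml => /andP[_].
    by rewrite lerBlDr addrC => h; apply: le_trans h _; rewrite lerD2r; exact: A_ge.
  move=> Xw Xw' ww'; rewrite ler_norml lerNl opprB !lerBlDl !one //.
  exact: agree_sym.
have ne0 : 0 < n%:R * e by rewrite mulr_gt0.
have [l [N0 avg]] := uniform_average P_unique subX ne0 AK A_agree.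
(* The [n]-step sums along the orbit of the given point are bounded by [A], and telescoping shows
   that at its good times they average to nearly [n * a] or more. *)
have l_ge : n%:R * a - 3 * (n%:R * e) <= l.
  pose C := n%:R * (2 * (K * n%:R + 0)) : R.
  have [N NN Na] := freq_a (maxn N0 (Num.truncn (C / (n%:R * e))).+1).
  move: NN; rewrite gtn_max => /andP[NN0 NN1].
  have NR : (0 : R) < N%:R by rewrite ltr0n (leq_ltn_trans _ NN0).
  have CN : C <= N%:R * (n%:R * e).
    rewrite -ler_pdivrMr //; apply: le_trans (ltW (truncnS_gt _)) _.
    by rewrite ler_nat ltnW.
  have := avg N w0 NN0 Xw0; rewrite /average ler_norml => /andP[_].
  rewrite lerBlDr mulrC ler_pdivrMr // => h1.
  have h2 : \sum_(i < N) (birkhoff phi (n + i) w0 x0 - birkhoff phi i w0 x0) <=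
      \sum_(i < N) A (shift_iter i w0).
    apply: ler_sum => i _; rewrite addnC birkhoffD addrAC subrr add0r.
    by apply: A_ge; exact: subshift_iter.
  have h3 : `|\sum_(i < N) (birkhoff phi (n + i) w0 x0 - birkhoff phi i w0 x0) -
      n%:R * birkhoff phi N w0 x0| <= C.
    apply: (telescoping (s := fun i => birkhoff phi i w0 x0)) => //.
      move=> i j; rewrite birkhoffD addrAC subrr add0r addr0.
      by apply: birkhoff_le => //; exact: subshift_iter.
    by move=> j; rewrite addr0; exact: birkhoff_le.
  move: h3; rewrite ler_norml => /andP[h3 _].
  have h4 : n%:R * (a * N%:R) <= n%:R * birkhoff phi N w0 x0 by rewrite ler_wpM2l ?(ltW nR).
  rewrite -(ler_pM2r NR).
  move: h1 h2 h3 h4 CN; set s1 := \sum_(i < N) _; set s2 := \sum_(i < N) _.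
  set b := birkhoff _ _ _ _; clear; lra.
exists (N0 + M + M + Num.truncn (4 * M%:R * K / e) + 1)%N => N w NN Xw.
have [NT N2 NN0] : [/\ (Num.truncn (4 * M%:R * K / e) < N)%N, (M + M <= N)%N &
    (N0 + M + M < N)%N].
  have aux (i j u v : nat) : (i + j + j + u + 1 < v)%N ->
      [/\ (u < v)%N, (j + j <= v)%N & (i + j + j < v)%N] by clear; split; lia.
  exact: aux NN.
have NM : 4 * M%:R * K <= e * N%:R.
  rewrite [e * _]mulrC -ler_pdivrMr //; apply: le_trans (ltW (truncnS_gt _)) _.
  by rewrite ler_nat.
(* One whole block is given up to make room for the offset [r]. *)
pose q := (N %/ M).-1.
have NME : (q * M + M + N %% M)%N = N.
  have NM1 : (M <= N)%N by apply: leq_trans N2; rewrite leq_addr.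
  by rewrite -mulSnr /q prednK ?divn_gt0 // -divn_eq.
have modM : (N %% M < M)%N by rewrite ltn_mod.
have qN0 : (N0 < q * M)%N.
  have aux (i j u v o : nat) : (i + j + j < u)%N -> (v < j)%N -> (o + j + v)%N = u ->
      (i < o)%N by clear; lia.
  exact: aux NN0 modM NME.
(* The windows to be traced start [G] steps after their blocks, so the averages are taken along the
   orbit of the [G]-th iterate. *)
have XwG : X (shift_iter G w) by exact: subshift_iter.
have qMR : (0 : R) < (q * M)%:R by rewrite ltr0n (leq_ltn_trans _ qN0).
have := avg (q * M)%N _ qN0 XwG; rewrite /average ler_norml => /andP[+ _].
rewrite lerBrDr ler_pdivlMl // => h1.
have h2 : (q * M)%:R * (n%:R * a - 5 * (n%:R * e)) <=
    \sum_(i < q * M) A (shift_iter i (shift_iter G w)).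
  apply: le_trans h1; rewrite ler_wpM2l ?(ltW qMR) //; move: l_ge; clear; lra.
have [r rM hr] := @best_offset (fun i => A (shift_iter i (shift_iter G w))) q M _ M0 h2.
have zex j : exists z, A (shift_iter (j * M + r) (shift_iter G w)) - n%:R * e <=
    birkhoff phi n (shift_iter (j * M + G) (shift_iter r w)) z.
  have -> : shift_iter (j * M + G) (shift_iter r w) =
      shift_iter (j * M + r) (shift_iter G w).
    by rewrite !shift_iterD -!addnA [(G + r)%N]addnC.
  by apply: A_near; exact: subshift_iter.
have [z zE] := choice zex.
have ones2S : 2 * S <= coord_sum (S *: @ones R) by rewrite coord_sumZ coord_sum_ones mulrC.
have S0 : 0 <= S by exact: le_trans S4.
have [t _ tr] := @specification R k B B_gt0 B_det (shift_iter r w) n G 0 (S *: @ones R) z isT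
  (pos_coneZ S0 (@ones_pos R)) (core_coneZ S0 (ones_core B_gt0)) ones2S.
have [x xE] := torus_iter_surj r w (torus_pi (0 + t *: (S *: @ones R))).
set y := torus_pi _ in tr xE.
have Xwr : X (shift_iter r w) by exact: subshift_iter.
exists x.
have [s sE] : exists s, N = (r + (q * M + s))%N.
  exists (M - r + N %% M)%N; rewrite -{1}NME.
  have aux (i j u v : nat) : (i < j)%N -> (u + j + v = i + (u + (j - i + v)))%N by clear; lia.
  exact: aux.
rewrite {2}sE !birkhoffD xE birkhoff_mul.
have b1 := birkhoff_le r x phiK Xw.
have b3 := birkhoff_le s (torus_iter (q * M) (shift_iter r w) y) phiK
  (subshift_iter subX (q * M) Xwr).
have b2 : q%:R * (n%:R * a - 5 * (n%:R * e)) - q%:R * (3 * (n%:R * e)) <=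
    \sum_(j < q) birkhoff phi M (shift_iter (j * M) (shift_iter r w))
      (torus_iter (j * M) (shift_iter r w) y).
  apply: (@le_trans _ _ (\sum_(j < q) (A (shift_iter (j * M + r) (shift_iter G w)) -
      3 * (n%:R * e)))).
    rewrite sumrB sumr_const card_ord -[_ *+ q]mulr_natl; move: hr; clear; lra.
  apply: ler_sum => j _; have := birkhoff_trace phiK phiG Xwr tr j.
  by rewrite ler_norml => /andP[+ _]; move: (zE j) nE; rewrite -/M; clear; lra.
move: b1 b2 b3; rewrite !ler_norml => /andP[b1 _] b2 /andP[b3 _].
have NRE : N%:R = r%:R + s%:R + q%:R * (n%:R + 2 * G%:R) :> R.
  by rewrite {1}sE !natrD natrM MR; ring.
have rs2 : r%:R + s%:R <= 2 * M%:R :> R.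
  rewrite -natrD -natrM ler_nat.
  have aux (i j u v o o' : nat) : (u + j + v)%N = o -> o = (i + (u + o'))%N -> (v < j)%N ->
    (i + o' <= 2 * j)%N by clear; lia.
  exact: aux NME sE modM.
have rs0 : 0 <= r%:R + s%:R :> R by rewrite addr_ge0.
have q0 : 0 <= q%:R :> R by [].
have f1 : a * (r%:R + s%:R) <= K * (r%:R + s%:R).
  by rewrite ler_wpM2r // (le_trans (ler_norm _)).
have f2 : K * (r%:R + s%:R) <= K * (2 * M%:R) by rewrite ler_wpM2l.
have f3 : a * (q%:R * (2 * G%:R)) <= K * (q%:R * (2 * G%:R)).
  by rewrite ler_wpM2r ?mulr_ge0 // (le_trans (ler_norm _)).
have f4 : q%:R * (2 * K * G%:R) <= q%:R * (n%:R * e) by rewrite ler_wpM2l.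
have f5 : e * (q%:R * n%:R) <= e * N%:R.
  rewrite ler_wpM2l ?(ltW e0) // NRE mulrDr.
  by have : 0 <= q%:R * (2 * G%:R) :> R; [rewrite !mulr_ge0|move: rs0; clear; lra].
have -> : a - eta = a - 10 * e by rewrite /e; field.
have f6 : a * N%:R = a * (r%:R + s%:R) + a * (q%:R * n%:R) + a * (q%:R * (2 * G%:R)).
  by rewrite NRE; ring.
rewrite mulrBl f6; move: b1 b2 b3.
move: (birkhoff _ r _ _) (birkhoff _ s _ _) (\sum_(j < q) _) => c1 c2 c3.
by move: NM rs2 rs0 f1 f2 f3 f4 f5; clear; lra.
Qed.

End BirkhoffSums.

(** * Irregular points *)

Section Oscillation.
Context {R : realType}.

(** [inf U] is the upper limit and [sup L] the lower one; without convergence they differ, and the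
    two levels are placed at the thirds of the gap. *)
Lemma not_cvg_oscillation (y : nat -> R) (K : R) : (forall n, `|y n| <= K) -> ~ cvgn y ->
  exists a b, [/\ b < a, forall N, exists2 n, (N < n)%N & a <= y n &
    forall N, exists2 n, (N < n)%N & y n <= b].
Proof.
move=> yK ncvg.
pose U := [set c | exists N, forall n, (N < n)%N -> y n <= c].
pose L := [set c | exists N, forall n, (N < n)%N -> c <= y n].
have LU c d : L c -> U d -> c <= d.
  move=> [N cN] [N' dN]; apply: (@le_trans _ _ (y (maxn N N').+1)).
    by apply: cN; rewrite ltnS leq_maxl.
  by apply: dN; rewrite ltnS leq_maxr.
have yK' n : - K <= y n <= K by rewrite -ler_norml.
have UK : U K by exists 0%N => n _; case/andP: (yK' n).
have LK : L (- K) by exists 0%N => n _; case/andP: (yK' n).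
have infU c : L c -> c <= inf U by move=> Lc; apply: lb_le_inf; [exists K|move=> d; exact: LU].
have supL_le : sup L <= inf U by apply: ge_sup; [exists (- K)|].
have Ulb : has_lbound U by exists (- K) => d; exact: LU.
have Lub : has_ubound L by exists K => c Lc; exact: LU.
have [lt|] := ltP (sup L) (inf U); last first.
  move=> ge; have supinf : sup L = inf U by apply/eqP; rewrite eq_le supL_le.
  exfalso; apply: ncvg; apply/cvg_ex; exists (inf U); apply/cvgrPdist_le => e e0.
  have [d [N dN] dlt] : exists2 d, U d & d < inf U + e.
    by apply: inf_lt; [exists K|rewrite ltrDl].
  have [c [N' cN] clt] : exists2 c, L c & sup L - e < c.
    by apply: sup_gt; [exists (- K)|rewrite gtrDl oppr_lt0].
  exists (maxn N N').+1 => // n /=; rewrite gtn_max => /andP[Nn N'n].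
  have := dN n Nn; have := cN n N'n; rewrite supinf in clt => h1 h2.
  by rewrite ler_norml; apply/andP; split; lra.
exists ((2 * inf U + sup L) / 3), ((inf U + 2 * sup L) / 3); split.
- lra.
- move=> N; apply: contrapT => H.
  suff : inf U <= (2 * inf U + sup L) / 3 by lra.
  apply: ge_inf => //; exists N => n Nn; rewrite leNgt; apply/negP => h.
  by apply: H; exists n => //; exact: ltW.
- move=> N; apply: contrapT => H.
  suff : (inf U + 2 * sup L) / 3 <= sup L by lra.
  apply: ub_le_sup => //; exists N => n Nn; rewrite leNgt; apply/negP => h.
  by apply: H; exists n => //; exact: ltW.
Qed.

(** The convergence of $s_J/J$ to $l$, in a form without division. *)
Definition has_rate (s : nat -> R) l := forall e, 0 < e ->
  exists J0, forall J, (J0 < J)%N -> `|s J - l * J%:R| <= e * J%:R.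

(* Alternates between the two values on blocks of indices each of which is much
   longer than all the previous ones. *)
Definition phase (j : nat) : bool := odd (trunc_log 2 (trunc_log 2 j)).

(** The phase is constant on $[2^{2^r},2^{2^{r+1}})$, whose right end is the square of the left one,
    so the indices before [I] form an arbitrarily small proportion. *)
Lemma phase_constant p (J0 : nat) (D e : R) : 0 <= D -> 0 < e -> exists I J,
  [/\ (J0 < J)%N, (I <= J)%N, D * I%:R <= e * J%:R &
      forall j, (I <= j < J)%N -> phase j = p].
Proof.
move=> D0 e0; pose T := Num.truncn (D / e).
pose r := (p + (J0 + T).*2)%N; pose I := (2 ^ (2 ^ r))%N.
have [J0r Tr] : (J0 <= r)%N /\ (T <= r)%N.
  have aux (i j u : nat) : (j <= i + (j + u).*2 /\ u <= i + (j + u).*2)%N by clear; lia.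
  exact: aux.
have oddr : odd r = p by rewrite /r oddD odd_double addbF; case: (p).
have rI : (r < I)%N by rewrite /I (ltn_trans (ltn_expl r (ltnSn 1))) // ltn_expl.
have JE : (2 ^ (2 ^ r.+1) = I * I)%N by rewrite /I expnS mul2n -addnn expnD.
have I1 : (0 < I)%N by rewrite expn_gt0.
exists I, (I * I)%N; split.
- apply: leq_trans (leq_pmulr I I1).
  exact: leq_ltn_trans rI.
- exact: leq_pmulr.
- rewrite natrM mulrA ler_wpM2r // [e * _]mulrC -ler_pdivrMr //.
  apply: le_trans (ltW (truncnS_gt _)) _; rewrite -/T ler_nat.
  exact: leq_ltn_trans rI.
move=> j /andP[Ij jJ]; rewrite /phase.
rewrite (@trunc_log_eq 2 r) // ?oddr //.
have j0 : (0 < j)%N by exact: leq_trans Ij.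
rewrite -{1}(@trunc_log_eq 2 (2 ^ r) (2 ^ (2 ^ r))) //; last first.
  by rewrite leqnn /= ltn_exp2l.
rewrite leq_trunc_log //= ltnNge; apply/negP => h.
have := leq_trans (_ : 2 ^ (2 ^ r.+1) <= 2 ^ trunc_log 2 j)%N (trunc_logP (ltnSn 1) j0).
by rewrite leq_exp2l // h => /(_ isT); rewrite JE leqNgt jJ.
Qed.

Lemma dvdn_countE q J : (0 < q)%N -> (\sum_(j < J) (q %| j) = (J + q.-1) %/ q)%N.
Proof.
move=> q0; elim: J => [|J IH]; first by rewrite big_ord0 add0n divn_small // prednK.
by rewrite big_ord_recr /= IH addSn divnS // -addnS prednK // dvdn_addl // addnC.
Qed.

Lemma dvdn_count q J : (0 < q)%N -> (J <= q * \sum_(j < J) (q %| j))%N.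
Proof.
move=> q0; rewrite dvdn_countE //.
have aux (i j u : nat) : (0 < j)%N -> (i + j.-1 < j + u)%N -> (i <= u)%N by clear; lia.
by apply: (aux _ _ _ q0); rewrite mulnC -mulSn; exact: ltn_ceil.
Qed.

(** At least a proportion $1/q$ of the indices is controlled, so the first two rates differ by at
    least [Delta / q - 2 * E]. At the ends of long phases the third sum follows each of the others
    within [2 * E] per index. Together these force [Delta / q <= 6 * E]. *)
Lemma alternating_rates (sA sB sC : nat -> R) (b : bool -> nat -> R) (c : nat -> R)
    (D E Delta : R) q lA lB lC : (0 < q)%N -> 0 <= D -> 0 <= E -> 6 * E < Delta / q%:R ->
  (forall J, sA J = \sum_(j < J) b true j) ->
  (forall J, sB J = \sum_(j < J) b false j) ->
  (forall J, sC J = \sum_(j < J) c j) ->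
  (forall p j, `|b p j| <= D) -> (forall j, `|c j| <= D) ->
  (forall j, (if (q %| j)%N then Delta else 0) - 2 * E <= b true j - b false j) ->
  (forall j, `|c j - b (phase j) j| <= 2 * E) ->
  has_rate sA lA -> has_rate sB lB -> has_rate sC lC -> False.
Proof.
move=> q0 D0 E0 gap sAE sBE sCE bD cD bAB cb rA rB rC.
pose e := (Delta / q%:R - 6 * E) / 20.
have e0 : 0 < e by rewrite divr_gt0 // subr_gt0.
have qR : (0 : R) < q%:R by rewrite ltr0n.
have Delta0 : 0 <= Delta.
  have : 0 <= Delta / q%:R by apply: le_trans (ltW gap); rewrite mulr_ge0.
  by rewrite pmulr_lge0 // invr_gt0.
have close p s l : has_rate s l -> (forall J, s J = \sum_(j < J) b p j) ->
    `|lC - l| <= 2 * E + 4 * e.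
  move=> rs sE; have [J1 h1] := rs e e0; have [J2 h2] := rC e e0.
  have [I [J [JJ IJ DI ph]]] := @phase_constant p (maxn J1 J2) (2 * D) e (mulr_ge0 (ler0n _ 2) D0) e0.
  move: JJ; rewrite gtn_max => /andP[JJ1 JJ2].
  have JR : (0 : R) < J%:R by rewrite ltr0n (leq_ltn_trans _ JJ1).
  have h3 : `|sC J - s J| <= 2 * D * I%:R + 2 * E * J%:R.
    rewrite sCE sE -sumrB; apply: le_trans (ler_norm_sum _ _ _) _.
    rewrite -(subnKC IJ) big_split_ord /= natrD mulrDr.
    have -> : 2 * D * I%:R = \sum_(i < I) 2 * D by rewrite sumr_const card_ord mulr_natr.
    have -> : 2 * E * (J - I)%:R = \sum_(i < J - I) 2 * E.
      by rewrite sumr_const card_ord mulr_natr.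
    apply: lerD.
      apply: ler_sum => i _; apply: le_trans (ler_normB _ _) _.
      by rewrite mulrDl mul1r lerD.
    apply: ler_wpDl; first by rewrite !mulr_ge0.
    apply: ler_sum => i _.
    have <- : phase (I + i) = p by apply: ph; rewrite leq_addr -ltn_subRL ltn_ord.
    exact: cb.
  have := h1 J JJ1; have := h2 J JJ2; move=> h4 h5.
  rewrite -(ler_pM2r JR) -[X in _ * X <= _](gtr0_norm JR) -normrM.
  have -> : (lC - l) * J%:R = - (sC J - lC * J%:R) + (sC J - s J) + (s J - l * J%:R) by ring.
  apply: le_trans (ler_normD _ _) _; apply: le_trans (lerD (ler_normD _ _) (lexx _)) _.
  have eJ : 0 <= e * J%:R by rewrite mulr_ge0 ?ltW.
  rewrite normrN; move: h3 h4 h5 DI eJ; move: `|_| `|_| `|_| => x1 x2 x3; clear; lra.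
have hA := close true sA lA rA sAE; have hB := close false sB lB rB sBE.
have hAB : Delta / q%:R - 2 * E - 2 * e <= lA - lB.
  have [J1 h1] := rA e e0; have [J2 h2] := rB e e0.
  pose J := (maxn J1 J2).+1; have JR : (0 : R) < J%:R by rewrite ltr0n.
  have := h1 J; have := h2 J; rewrite !ltnS leq_maxl leq_maxr => /(_ isT) + /(_ isT).
  have h3 : Delta / q%:R * J%:R - 2 * E * J%:R <= sA J - sB J.
    rewrite sAE sBE -sumrB.
    apply: (@le_trans _ _ (\sum_(j < J) ((if (q %| j)%N then Delta else 0) - 2 * E))); last first.
      by apply: ler_sum => i _; exact: bAB.
    rewrite sumrB sumr_const card_ord -[2 * E *+ J]mulr_natr lerD2r.
    have -> : \sum_(i < J) (if (q %| i)%N then Delta else 0) =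
        Delta * (\sum_(i < J) (q %| i))%:R.
      rewrite natr_sum mulr_sumr; apply: eq_bigr => i _.
      by case: ifP => _; rewrite ?mulr1 ?mulr0.
    rewrite -mulrA ler_wpM2l // ler_pdivrMl // -natrM ler_nat.
    exact: dvdn_count.
  rewrite !ler_norml => /andP[h4 h5] /andP[h6 h7]; rewrite -(ler_pM2r JR).
  by move: h3 h4 h5 h6 h7; clear; lra.
move: hA hB; rewrite !ler_norml => /andP[h1 h2] /andP[h3 h4].
have eE : 20 * e = Delta / q%:R - 6 * E by rewrite /e; field; rewrite lt0r_neq0.
by move: hAB h1 h2 h3 h4 eE e0; clear; lra.
Qed.

End Oscillation.

(** * Existence and density of irregular points *)

Section IrregularPoints.
Context {R : realType} {k : nat} (B : 'I_k.+2 -> 'M[int]_2).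
Hypothesis B_gt0 : forall i p q, 0 < B i p q.
Hypothesis B_det : forall i, `|B i 0 0 * B i 1 1 - B i 1 0 * B i 0 1| = 1.
Variable X : set (full_shift k).
Variable P : probability (borel (full_shift k)) R.
Hypothesis P_unique : unique_invariant_probability_on X P.
Hypothesis subX : subshift X.
Implicit Types (w : full_shift k) (m n N q G : nat) (x y : torus R)
  (phi : full_shift k * torus R -> R).

Local Notation S := (@entry_bound R k B).
Local Notation torus_iter := (@torus_iter R k B).
Local Notation cocycle := (@cocycle R k B).
Local Notation birkhoff := (@birkhoff R k B).

Definition regular phi w x := cvgn (fun n => n%:R^-1 * birkhoff phi n w x).

Lemma skew_iterE n w x :
  iter n (skew_product (@left_shift k) (torus_skew B)) (w, x) =
  (shift_iter n w, torus_iter n w x).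
Proof. by elim: n => [//|n IH]; rewrite iterS IH. Qed.

Lemma irregular_setE phi w x :
  irregular_set (skew_product (@left_shift k) (torus_skew B))
    (X `*` [set: torus R]) phi (w, x) <-> X w /\ ~ regular phi w x.
Proof.
rewrite /irregular_set /regular /=.
have -> : (fun n => n%:R^-1 * \sum_(i < n)
      phi (iter i (skew_product (@left_shift k) (torus_skew B)) (w, x))) =
    (fun n => n%:R^-1 * birkhoff phi n w x).
  apply/funext => n; congr (_ * _); apply: eq_bigr => i _.
  by rewrite skew_iterE.
by split => [[[] ]|[]].
Qed.

Lemma regularP phi w x : regular phi w x <->
  exists l, has_rate (fun n => birkhoff phi n w x) l.
Proof.
have E n l : (0 < n)%N -> `|birkhoff phi n w x - l * n%:R| =
    `|l - n%:R^-1 * birkhoff phi n w x| * n%:R.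
  move=> n0; have nR : (0 : R) < n%:R by rewrite ltr0n.
  have -> : birkhoff phi n w x - l * n%:R = - ((l - n%:R^-1 * birkhoff phi n w x) * n%:R).
    by field; rewrite lt0r_neq0.
  by rewrite normrN normrM normr_nat.
split.
  move=> /cvg_ex [l /cvgrPdist_le h]; exists l => e e0; have [J0 _ JE] := h e e0.
  exists J0 => J J0J; rewrite E ?(leq_ltn_trans _ J0J) // ler_wpM2r //.
  by apply: JE; exact: ltnW.
move=> [l h]; apply/cvg_ex; exists l; apply/cvgrPdist_le => e e0.
have [J0 JE] := h e e0; exists J0.+1 => // n /= J0n.
have n0 : (0 < n)%N by exact: leq_ltn_trans J0n.
by have := JE n J0n; rewrite E // ler_pM2r // ltr0n.
Qed.

Lemma regular_iter phi K m w x : (forall w x, X w -> `|phi (w, x)| <= K) -> X w ->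
  regular phi w x -> regular phi (shift_iter m w) (torus_iter m w x).
Proof.
move=> phiK Xw /regularP [l h]; apply/regularP; exists l => e e0.
have e2 : 0 < e / 2 by rewrite divr_gt0.
have [J0 hJ] := h _ e2.
pose C := K * m%:R + `|l| * m%:R + e / 2 * m%:R.
exists (maxn J0 (Num.truncn (C / (e / 2)))) => J; rewrite gtn_max => /andP[J0J CJ].
have CE : C <= e / 2 * J%:R.
  rewrite mulrC -ler_pdivrMr //; apply: le_trans (ltW (truncnS_gt _)) _.
  by rewrite ler_nat.
have := hJ (m + J)%N (leq_trans J0J (leq_addl _ _)); rewrite birkhoffD natrD.
have := birkhoff_le B subX m x phiK Xw.
set a := birkhoff _ m _ _; set b := birkhoff _ J _ _ => h1 h2.
have -> : b - l * J%:R = (a + b - l * (m%:R + J%:R)) - a + l * m%:R by ring.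
apply: le_trans (ler_normD _ _) _; apply: le_trans (lerD (ler_normB _ _) (lexx _)) _.
rewrite (normrM l) normr_nat.
by move: h1 h2 CE; rewrite /C; clear; lra.
Qed.

(* The free targets are common to the three points, so two of them have Birkhoff
   averages that differ by a definite amount at all times, and the third one
   follows each of them in turn. *)
Lemma some_irregular phi K eta Delta n G q w (z : bool -> nat -> torus R)
    (x : option bool -> torus R) : (0 < q)%N -> (0 < n)%N -> 0 <= eta ->
  (forall w x, X w -> `|phi (w, x)| <= K) ->
  fiber_modulus X phi (3 * S / 2 ^+ G) eta -> X w ->
  6 * (n%:R * eta + 2 * K * G%:R) < Delta / q%:R ->
  (forall j, ~~ (q %| j)%N -> z true j = z false j) ->
  (forall j, (q %| j)%N -> Delta <=
    birkhoff phi n (shift_iter (j * (n + G.*2) + G) w) (z true j) -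
    birkhoff phi n (shift_iter (j * (n + G.*2) + G) w) (z false j)) ->
  (forall f, traces B n G w (fun j => z (odflt (phase j) f) j) (x f)) ->
  exists f, ~ regular phi w (x f).
Proof.
move=> q0 n0 eta0 phiK phiG Xw gap z_free z_ctrl tr; apply: contrapT => H.
have reg f : regular phi w (x f) by apply: contrapT => h; apply: H; exists f.
set M := (n + G.*2)%N.
have M0 : (0 < M)%N by rewrite addn_gt0 n0.
have K0 : 0 <= K by exact: le_trans (phiK w point Xw).
pose E := n%:R * eta + 2 * K * G%:R.
have E0 : 0 <= E by rewrite addr_ge0 ?mulr_ge0.
pose b f j := birkhoff phi M (shift_iter (j * M) w) (torus_iter (j * M) w (x f)).
have bE f J : birkhoff phi (J * M) w (x f) = \sum_(j < J) b f j by exact: birkhoff_mul.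
have rate f : exists l, has_rate (fun J => birkhoff phi (J * M) w (x f)) l.
  have /regularP [l h] := reg f; exists (l * M%:R) => e e0.
  have eM : 0 < e / M%:R by rewrite divr_gt0 // ltr0n.
  have [J0 JE] := h _ eM; exists J0 => J J0J.
  have MR : M%:R != 0 :> R by rewrite pnatr_eq0 -lt0n.
  have -> : l * M%:R * J%:R = l * (J * M)%:R by rewrite natrM; ring.
  have -> : e * J%:R = e / M%:R * (J * M)%:R by rewrite natrM; field.
  exact: JE (leq_trans J0J (leq_pmulr _ M0)).
pose Rj f j := birkhoff phi n (shift_iter (j * M + G) w) (z (odflt (phase j) f) j).
have bR f j : `|b f j - Rj f j| <= E by exact: (birkhoff_trace subX phiK phiG Xw (tr f) j).
have bD f j : `|b f j| <= K * M%:R by apply: (birkhoff_le B subX) => //; exact: subshift_iter.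
(* [Some true] and [Some false] keep one kind of controlled block for ever, whereas [None] follows
   [phase]. *)
have [lA rA] := rate (Some true); have [lB rB] := rate (Some false).
have [lC rC] := rate None.
apply: (@alternating_rates R _ _ _ (fun p => b (Some p)) (b None) (K * M%:R) E Delta q
  lA lB lC q0 _ E0 gap (bE _) (bE _) (bE _) _ (bD _) _ _ rA rB rC) => //.
- by rewrite mulr_ge0.
- move=> j /=.
  have : (if (q %| j)%N then Delta else 0) <= Rj (Some true) j - Rj (Some false) j.
    rewrite /Rj /=; case: ifP => [|/negbT] qj; first exact: z_ctrl.
    by rewrite z_free // subrr.
  have := bR (Some true) j; have := bR (Some false) j.
  rewrite !ler_norml => /andP[+ +] /andP[+ +].
  move: (b (Some true) j) (b (Some false) j) (Rj (Some true) j) (Rj (Some false) j).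
  by case: ifP => _; clear; move=> *; lra.
- move=> j /=.
  have Rc : Rj None j = Rj (Some (phase j)) j by [].
  have := bR None j; have := bR (Some (phase j)) j; rewrite Rc.
  rewrite !ler_norml => /andP[h1 h2] /andP[h3 h4].
  move: (b None j) (b (Some (phase j)) j) (Rj (Some (phase j)) j) h1 h2 h3 h4.
  by clear; move=> *; apply/andP; split; lra.
Qed.

Definition spread_averages phi (a b : R) := forall eta, 0 < eta ->
  exists n0, forall n w, (n0 < n)%N -> X w ->
    (exists x, (a - eta) * n%:R <= birkhoff phi n w x) /\
    (exists x, birkhoff phi n w x <= (b + eta) * n%:R).

Lemma uniform_modulusN phi : uniform_modulus X phi -> uniform_modulus X (fun z => - phi z).
Proof.
move=> mod_phi eta /mod_phi[n [e [e0 h]]]; exists n, e; split => // w w' x x' Xw Xw' ww' xx'.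
by rewrite opprK addrC distrC; exact: h.
Qed.

(** The averages of an irregular point return infinitely often above some [a] and below some
    [b < a]; [upper_average] spreads both properties, the second one through [- phi]. *)
Lemma irregular_spread phi w0 x0 : uniform_modulus X phi ->
  (exists K, forall w x, X w -> `|phi (w, x)| <= K) -> X w0 -> ~ regular phi w0 x0 ->
  exists a b, b < a /\ spread_averages phi a b.
Proof.
move=> mod_phi bd Xw0 irr; have [K phiK] := bd.
have avgK n : `|n%:R^-1 * birkhoff phi n w0 x0| <= K.
  have K0 : 0 <= K by exact: le_trans (phiK w0 point Xw0).
  case: n => [|n]; first by rewrite invr0 mul0r normr0.
  rewrite normrM normfV normr_nat mulrC ler_pdivrMr ?ltr0n //.
  exact: (birkhoff_le B subX).
have [a [b [ba fa fb]]] := not_cvg_oscillation avgK irr.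
exists a, b; split => // eta eta0.
have [|n1 h1] := @upper_average R k B B_gt0 B_det X P P_unique subX phi a w0 x0 mod_phi bd Xw0 _ eta eta0.
  move=> N; have [n Nn an] := fa N; exists n => //.
  have nR : (0 : R) < n%:R by rewrite ltr0n (leq_ltn_trans _ Nn).
  by move: an; rewrite mulrC ler_pdivlMr.
have bdN : exists K, forall w x, X w -> `|- phi (w, x)| <= K.
  by exists K => w x; rewrite normrN; exact: phiK.
have [|n2 h2] := @upper_average R k B B_gt0 B_det X P P_unique subX (fun z => - phi z) (- b)
    w0 x0 (uniform_modulusN mod_phi) bdN Xw0 _ eta eta0.
  move=> N; have [n Nn an] := fb N; exists n => //.
  have nR : (0 : R) < n%:R by rewrite ltr0n (leq_ltn_trans _ Nn).
  by rewrite birkhoffN mulNr lerN2; move: an; rewrite mulrC ler_pdivrMr.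
exists (maxn n1 n2) => n w; rewrite gtn_max => /andP[nn1 nn2] Xw; split; first exact: h1.
have [x xE] := h2 n w nn2 Xw; exists x; move: xE; rewrite birkhoffN.
have -> : (- b - eta) * n%:R = - ((b + eta) * n%:R) by ring.
by rewrite lerN2.
Qed.

Lemma fine_trace (d : R) : 0 < d -> exists2 G, (0 < G)%N & 3 * S / 2 ^+ G <= d.
Proof.
move=> d0; exists (Num.truncn (3 * S / d)).+1 => //.
rewrite ler_pdivrMr ?exprn_gt0 // -ler_pdivrMl // mulrC.
apply: le_trans (ltW (truncnS_gt _)) _.
by rewrite -natrX ler_nat ltnW // ltn_expl.
Qed.

(** A short segment at [x] grows into one long enough for specification, which turns statements
    about long segments into local ones. *)
Lemma expanded_segment w x (r : R) : 0 < r -> exists T (u p : 'cV[R]_2),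
  [/\ pos_cone u, core_cone B u, 2 * S <= coord_sum u &
    forall t, 0 <= t <= 1 -> exists y, mdist x y < r /\
      torus_iter T w y = torus_pi (p + t *: u)].
Proof.
move=> r0; have S4 := @entry_bound_ge4 R k B B_gt0.
pose v : 'cV[R]_2 := (r / 4) *: @ones R.
have r4 : 0 <= r / 4 by rewrite divr_ge0 ?ltW.
have v0 : pos_cone v := pos_coneZ r4 (@ones_pos R).
have vc : core_cone B v := core_coneZ r4 (ones_core B_gt0).
have vs : coord_sum v = r / 2 by rewrite coord_sumZ coord_sum_ones; field.
pose T := (Num.truncn (4 * S / r)).+1.
have [u0 uc us] := cocycle_cone B_gt0 T w v0.
exists T, (cocycle T w *m v), (cocycle T w *m torus_repr x); split => //; first exact: uc.
  apply: le_trans us; rewrite vs.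
  have : 4 * S / r <= 2 ^+ T.
    apply: le_trans (ltW (truncnS_gt _)) _; rewrite -/T -natrX ler_nat.
    by rewrite ltnW // ltn_expl.
  by rewrite ler_pdivrMr //; lra.
move=> t /andP[t0 t1]; exists (torus_pi (torus_repr x + t *: v)); split.
  rewrite metric_sym -{2}[x]torus_reprK; apply: le_lt_trans (torus_mdist_le_l1 _ _ 0) _.
  rewrite map_mx0 subr0 addrAC subrr add0r l1normZ l1norm_pos // vs ger0_norm //.
  apply: (@le_lt_trans _ _ (r / 2)); first by rewrite ler_piMl // divr_ge0 ?ltW.
  by move: r0; lra.
by rewrite torus_iter_pi mulmxDr scalemxAr.
Qed.

Section Spread.
Variables (phi : full_shift k * torus R -> R) (a b : R).
Hypothesis phi_mod : uniform_modulus X phi.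
Hypothesis phi_bd : exists K, forall w x, X w -> `|phi (w, x)| <= K.
Hypothesis ba : b < a.
Hypothesis phi_spread : spread_averages phi a b.

(** [G] and [eta] are chosen before the block length [n], so the oscillation, linear in [n],
    eventually beats the cost [2 * K * G] of the gaps. *)
Lemma controlled_blocks q (d : R) : (0 < q)%N -> 0 < d ->
  exists G eta Delta0 K, [/\ (0 < G)%N, 3 * S / 2 ^+ G <= d, 0 <= eta,
    (forall w x, X w -> `|phi (w, x)| <= K) /\ fiber_modulus X phi (3 * S / 2 ^+ G) eta &
    exists n1, forall n, (n1 < n)%N ->
      6 * (n%:R * eta + 2 * K * G%:R) < Delta0 * n%:R / q%:R /\
      forall w, X w -> exists xa xb,
        Delta0 * n%:R <= birkhoff phi n w xa - birkhoff phi n w xb].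
Proof.
move=> q0 d0; have [K phiK] := phi_bd.
have ab0 : 0 < a - b by rewrite subr_gt0.
have qR : (0 : R) < q%:R by rewrite ltr0n.
(* Then [6 * eta * q] is one eighth of [a - b]; for large [n] the gaps take less than three eighths,
   and the total stays below [Delta0], which is half of [a - b]. *)
pose eta := (a - b) / (48 * q%:R).
have eta0 : 0 < eta by rewrite divr_gt0 // mulr_gt0.
have [m [d1 [d10 modE]]] := phi_mod eta0.
have dm0 : 0 < Num.min d d1 by rewrite lt_min d0.
have [G G0 Gd] := fine_trace dm0; move: Gd; rewrite le_min => /andP[Gd Gd1].
have ab4 : 0 < (a - b) / 4 by rewrite divr_gt0.
have [n0 n0E] := phi_spread ab4.
exists G, eta, ((a - b) / 2), K; split => //; first exact: ltW.
  split => // w x x' Xw xx'; apply: modE => //; exact: le_trans Gd1.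
exists (maxn n0 (Num.truncn (32 * K * G%:R * q%:R / (a - b)))) => n.
rewrite gtn_max => /andP[nn0 nn1]; split.
  have h1 : 32 * K * G%:R * q%:R < (a - b) * n%:R.
    rewrite [ltRHS]mulrC -ltr_pdivrMr //; apply: lt_le_trans (truncnS_gt _) _.
    by rewrite ler_nat.
  rewrite ltr_pdivlMr //.
  have -> : 6 * (n%:R * eta + 2 * K * G%:R) * q%:R =
      (a - b) * n%:R / 8 + 12 * (K * G%:R * q%:R).
    by rewrite /eta; field; rewrite lt0r_neq0.
  have nR : 0 < (a - b) * n%:R by rewrite mulr_gt0 // ltr0n (leq_ltn_trans _ nn0).
  by move: h1 nR; lra.
move=> w Xw; have [[xa xaE] [xb xbE]] := n0E n w nn0 Xw; exists xa, xb.
by move: xaE xbE; lra.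
Qed.

(** The case [q = 1]: every block is controlled, since no free choice has to be kept. *)
Lemma segment_irregular w (p u : 'cV[R]_2) : X w -> pos_cone u -> core_cone B u ->
  2 * S <= coord_sum u -> exists2 t, 0 <= t <= 1 & ~ regular phi w (torus_pi (p + t *: u)).
Proof.
move=> Xw u0 uc uS.
have [G [eta [Delta0 [K [G0 _ eta0 [phiK phiG] [n1 n1E]]]]]] := controlled_blocks (ltn0Sn 0) (@ltr01 R).
have [gap ext] := n1E n1.+1 (ltnSn _); set n := n1.+1 in gap ext.
have zex j : exists z : torus R * torus R, Delta0 * n%:R <=
    birkhoff phi n (shift_iter (j * (n + G.*2) + G) w) z.1 -
    birkhoff phi n (shift_iter (j * (n + G.*2) + G) w) z.2.
  by have [|xa [xb h]] := ext (shift_iter (j * (n + G.*2) + G) w);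
    [exact: subshift_iter|exists (xa, xb)].
have [z zE] := choice zex.
pose zz (c : bool) j := if c then (z j).1 else (z j).2.
have xex (f : option bool) : exists t, 0 <= t <= 1 /\
    traces B n G w (fun j => zz (odflt (phase j) f) j) (torus_pi (p + t *: u)).
  by have [t t01 tr] := @specification R k B B_gt0 B_det w n G p u
    (fun j => zz (odflt (phase j) f) j) G0 u0 uc uS; exists t.
have [t tE] := choice xex.
have [|||f fE] := @some_irregular phi K eta (Delta0 * n%:R) n G 1 w zz
    (fun f => torus_pi (p + t f *: u)) isT isT eta0 phiK phiG Xw gap.
- by move=> j; rewrite dvd1n.
- by move=> j _; exact: zE.
- by move=> f; case: (tE f).
by exists (t f) => //; case: (tE f).
Qed.

Lemma irregular_dense w x (r : R) : X w -> 0 < r ->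
  exists2 y, mdist x y < r & ~ regular phi w y.
Proof.
move=> Xw r0; have [T [u [p [u0 uc uS uE]]]] := expanded_segment w x r0.
have [t t01 irr] := segment_irregular p (subshift_iter subX T Xw) u0 uc uS.
have [y [xy yE]] := uE t t01; exists y => //.
have [K phiK] := phi_bd.
by move=> reg; apply: irr; rewrite -yE; exact: regular_iter phiK Xw reg.
Qed.

End Spread.

(** A bounded time [T] brings a neighbourhood of [x] onto a long segment, after which one traced
    block of large length [n] outweighs the beginning and the gaps. *)
Lemma high_average_dense phi (a eta : R) N w x (r : R) :
  uniform_modulus X phi -> (exists K, forall w x, X w -> `|phi (w, x)| <= K) ->
  (forall eta, 0 < eta -> exists n0, forall n w, (n0 < n)%N -> X w ->
    exists x, (a - eta) * n%:R <= birkhoff phi n w x) ->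
  X w -> 0 < r -> 0 < eta -> exists y n, [/\ mdist x y < r, (N < n)%N &
    (a - eta) * n%:R < birkhoff phi n w y].
Proof.
move=> phi_mod [K0 phiK0] high Xw r0 eta0.
pose K := `|K0| + `|a|.
have phiK w' x' : X w' -> `|phi (w', x')| <= K.
  move=> Xw'; apply: le_trans (phiK0 w' x' Xw') _.
  by apply: le_trans (ler_norm _) _; rewrite lerDl.
have K_ge0 : 0 <= K by rewrite addr_ge0.
have aK : a <= K by apply: le_trans (ler_norm _) _; rewrite lerDr.
have [T [u [p [u0 uc uS uE]]]] := expanded_segment w x r0.
pose e := eta / 4; have e0 : 0 < e by rewrite divr_gt0.
have [m [d [d0 modE]]] := phi_mod e e0.
have [G G0 Gd] := fine_trace d0.
have phiG : fiber_modulus X phi (3 * S / 2 ^+ G) e.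
  by move=> w' y y' Xw' yy'; apply: modE => //; exact: le_trans Gd.
have [n0 n0E] := high e e0.
pose C := 4 * K * (T%:R + 2 * G%:R).
pose n := (maxn (maxn n0 N) (Num.truncn (C / e))).+1.
have nn0 : (n0 < n)%N by rewrite ltnS !leq_max leqnn.
have nN : (N < n)%N by rewrite ltnS !leq_max leqnn orbT.
have nR : (0 : R) < n%:R by [].
have nC : C <= e * n%:R.
  rewrite mulrC -ler_pdivrMr //; apply: le_trans (ltW (truncnS_gt _)) _.
  by rewrite ler_nat ltnS leq_max leqnn orbT.
have XT : X (shift_iter T w) by exact: subshift_iter.
have [z zE] := n0E n (shift_iter G (shift_iter T w)) nn0 (subshift_iter subX G XT).
(* The targets are constant because only the block of index 0 is used. *)
have [t t01 tr] := @specification R k B B_gt0 B_det (shift_iter T w) n G p u (fun=> z) G0 u0 uc uS.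
have [y [xy yE]] := uE t t01.
exists y, (T + (n + G.*2))%N; split => //.
  by apply: leq_trans nN _; rewrite addnCA leq_addr.
rewrite birkhoffD yE.
have h1 := birkhoff_trace subX phiK phiG XT tr 0; rewrite mul0n add0n in h1.
have h2 := birkhoff_le B subX T y phiK Xw.
have NE : (T + (n + G.*2))%:R = n%:R + (T%:R + 2 * G%:R) :> R.
  by rewrite !natrD -muln2 natrM; ring.
have TG0 : 0 <= T%:R + 2 * G%:R :> R by rewrite addr_ge0 // mulr_ge0.
have f1 : a * (T%:R + 2 * G%:R) <= K * (T%:R + 2 * G%:R) by rewrite ler_wpM2r.
have f2 : 0 <= K * T%:R by rewrite mulr_ge0.
have f3 : 0 <= K * G%:R by rewrite mulr_ge0.
have f4 : 0 < e * n%:R by rewrite mulr_gt0.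
have f5 : 0 <= e * (T%:R + 2 * G%:R) by rewrite mulr_ge0 // ltW.
have -> : a - eta = a - 4 * e by rewrite /e; field.
rewrite NE; move: h1 h2; rewrite !ler_norml => /andP[h1 _] /andP[h2 _].
move: zE h1 h2 nC f1 f2 f3 f4 f5; rewrite /C.
move: (birkhoff phi n _ z) (birkhoff phi (n + G.*2) _ _) (birkhoff phi T w y).
by move=> *; lra.
Qed.

End IrregularPoints.

(** * Entropy *)

Section GreedyPath.
Context {R : realType}.
Local Open Scope ereal_scope.

Lemma esum_scale_le (D : set nat) (r : R) (a : nat -> \bar R) : (0 <= r)%R ->
  (forall i, 0 <= a i) -> \esum_(i in D) (r%:E * a i) <= r%:E * \esum_(i in D) a i.
Proof.
move=> r0 a0; apply: ge_ereal_sup => _ [Y [finY YD] <-].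
rewrite -ge0_mule_fsumr //; apply: lee_wpmul2l; first by rewrite lee_fin.
by apply: ereal_sup_ubound; exists Y.
Qed.

(** Method of conditional expectations: a weight below 1 is preserved by choosing a suitable next
    symbol each time. *)
Lemma greedy_path (N : nat -> nat) (W : seq nat -> \bar R) :
  (forall p, W p < 1 -> exists2 a, (a < N (size p))%N & W (rcons p a) < 1) ->
  W [::] < 1 -> exists2 c : nat -> nat, (forall l, (c l < N l)%N) &
    forall J, W (mkseq c J) < 1.
Proof.
move=> step W0.
have next p : exists a, W p < 1 -> (a < N (size p))%N /\ W (rcons p a) < 1.
  have [|ng] := pselect (W p < 1); last by exists 0%N.
  by move=> /step[a aN Wa]; exists a.
have [f fE] := choice next.
pose s := fix s j := if j is j'.+1 then rcons (s j') (f (s j')) else [::].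
have sE J : s J = mkseq (fun j => f (s j)) J.
  by elim: J => [//|J IH]; rewrite mkseqS -IH.
have Ws J : W (s J) < 1.
  by elim: J => [//|J IH]; case: (fE (s J) IH).
have ss J : size (s J) = J by rewrite sE size_mkseq.
exists (fun j => f (s j)) => [l|J]; last by rewrite -sE.
by have [+ _] := fE (s l) (Ws l); rewrite ss.
Qed.

Variable N : nat -> nat.
Hypothesis N_gt0 : forall l, (0 < N l)%N.

Definition consistent (c : nat -> nat) J (p : seq nat) : bool :=
  all (fun l => nth 0%N p l == c l) (iota 0 (minn (size p) J)).

(* The conditional probability, given the prefix [p], of the set of sequences
   that agree with [c] up to time [J], for the uniform product measure. *)
Definition cylinder_weight (c : nat -> nat) J (p : seq nat) : R :=
  ((consistent c J p)%:R * \prod_(size p <= l < J) (N l)%:R^-1)%R.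

Lemma cylinder_weight_ge0 c J p : (0 <= cylinder_weight c J p)%R.
Proof. by rewrite mulr_ge0 // prodr_ge0 // => i _; rewrite invr_ge0. Qed.

Lemma consistent_rcons c J p a : consistent c J (rcons p a) =
  consistent c J p && ((J <= size p)%N || (a == c (size p))).
Proof.
rewrite /consistent size_rcons.
have h m : (m <= size p)%N -> all (fun l => nth 0%N (rcons p a) l == c l) (iota 0 m) =
    all (fun l => nth 0%N p l == c l) (iota 0 m).
  move=> mp; apply: eq_in_all => l; rewrite mem_iota add0n /= => lm.
  by rewrite nth_rcons (leq_trans lm mp).
have [Jp|pJ] := leqP J (size p).
  by rewrite !(minn_idPr _) ?leqW // andbT h.
rewrite (minn_idPl pJ) -addn1 iotaD all_cat h //= add0n.
by rewrite nth_rcons ltnn eqxx andbT.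
Qed.

(** Before time [J] at most one child of [p] stays consistent with [c], and its weight is
    [N (size p)] times that of [p]. *)
Lemma cylinder_weight_step c J p : (cylinder_weight c J p < 1)%R ->
  (\sum_(a < N (size p)) cylinder_weight c J (rcons p a) <=
    (N (size p))%:R * cylinder_weight c J p)%R.
Proof.
rewrite /cylinder_weight.
have [Jp|pJ] := leqP J (size p).
  rewrite big_geq // mulr1; case cp : (consistent c J p); first by rewrite ltxx.
  move=> _; rewrite mulr0n mulr0 big1 // => a _.
  by rewrite consistent_rcons cp mulr0n mul0r.
move=> _; under [leLHS]eq_bigr => a _ do rewrite consistent_rcons leqNgt pJ /= size_rcons.
rewrite [in leRHS]big_ltn // [X in (_ <= X)%R]mulrCA mulVKf ?pnatr_eq0 -?lt0n //.
rewrite -mulr_suml ler_wpM2r ?prodr_ge0 //.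
case cp : (consistent c J p) => /=; last by rewrite big1.
rewrite -natr_sum ler_nat.
have [cN|cN] := ltnP (c (size p)) (N (size p)); last first.
  rewrite big1 // => a _; case: eqP => // ac; move: cN; rewrite -ac leqNgt ltn_ord //.
rewrite (bigD1 (Ordinal cN)) //= eqxx big1 // => a /eqP ac; case: eqP => // h.
by exfalso; apply: ac; exact/val_inj.
Qed.

Lemma cylinder_weight_root c J : cylinder_weight c J [::] = (\prod_(l < J) (N l)%:R^-1)%R.
Proof. by rewrite /cylinder_weight /consistent min0n /= mul1r big_mkord. Qed.

Lemma cylinder_weight_in c J (c' : nat -> nat) : (forall l, (l < J)%N -> c' l = c l) ->
  cylinder_weight c J (mkseq c' J) = 1%R.
Proof.
move=> h; rewrite /cylinder_weight size_mkseq big_geq // mulr1.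
suff -> : consistent c J (mkseq c' J) by [].
apply/allP => l; rewrite size_mkseq minnn mem_iota add0n /= => lJ.
by rewrite nth_mkseq // h.
Qed.

(** [W p] bounds the expected number of listed cylinders that contain a random sequence starting
    with [p]. Averaging over the next symbol yields a child below 1, whereas a prefix lying entirely
    inside a cylinder has weight at least 1. *)
Lemma avoid_cylinders (D : set nat) (F : finType) (act : nat -> F -> bool)
    (c : nat -> F -> nat -> nat) (J : nat -> F -> nat) :
  \esum_(i in D) (\sum_(f | act i f) \prod_(l < J i f) (N l)%:R^-1 : R)%R%:E < 1 ->
  exists2 c' : nat -> nat, (forall l, (c' l < N l)%N) &
    forall i f, D i -> act i f -> exists2 l, (l < J i f)%N & c' l != c i f l.
Proof.
move=> small.
pose nu p i : R := (\sum_(f | act i f) cylinder_weight (c i f) (J i f) p)%R.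
pose W p := \esum_(i in D) (nu p i)%:E.
have nu0 p i : (0 <= nu p i)%R.
  by apply: sumr_ge0 => f _; exact: cylinder_weight_ge0.
have nu_le p i : D i -> (nu p i)%:E <= W p.
  move=> Di; apply: esum_ge; exists [set i]; last by rewrite fsbig_set1.
  by split; [exact: finite_set1|move=> _ ->].
have W0 : W [::] < 1.
  rewrite /W; under eq_esum do rewrite /nu.
  apply: le_lt_trans small; apply: le_esum => i Di; rewrite lee_fin.
  by apply: ler_sum => f _; rewrite cylinder_weight_root.
have step p : W p < 1 -> exists2 a, (a < N (size p))%N & W (rcons p a) < 1.
  move=> Wp; apply: contrapT => H.
  have ge1 (a : 'I_(N (size p))) : 1 <= W (rcons p a).
    by rewrite leNgt; apply/negP => h; apply: H; exists a.
  have sumW : \sum_(a < N (size p)) W (rcons p a) <= (N (size p))%:R%:E * W p.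
    rewrite /W -esum_sum; last by move=> *; rewrite lee_fin.
    have nuW : \esum_(i in D) ((N (size p))%:R%:E * (nu p i)%:E) <= (N (size p))%:R%:E * W p.
      by apply: esum_scale_le => // i; rewrite lee_fin.
    apply: le_trans nuW.
    apply: le_esum => i Di; rewrite sumEFin -EFinM lee_fin.
    rewrite /nu exchange_big mulr_sumr; apply: ler_sum => f fact.
    apply: cylinder_weight_step.
    have : (nu p i < 1)%R by rewrite -lte_fin; exact: le_lt_trans (nu_le p i Di) Wp.
    apply: le_lt_trans; rewrite /nu (bigD1 f) //= lerDl.
    by apply: sumr_ge0 => f' _; exact: cylinder_weight_ge0.
  have : (N (size p))%:R%:E <= (N (size p))%:R%:E * W p.
    apply: le_trans sumW.
    have -> : (N (size p))%:R%:E = \sum_(a < N (size p)) (1 : \bar R).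
      by rewrite sumEFin sumr_const card_ord.
    exact: lee_sum.
  have Wge0 : 0 <= W p by apply: esum_ge0 => i _; rewrite lee_fin.
  have [v vE] : exists v, W p = v%:E.
    by exists (fine (W p)); rewrite fineK // ge0_fin_numE // (lt_trans Wp) // ltry.
  rewrite vE -EFinM lee_fin ler_pMr ?ltr0n // => v1.
  by move: Wp; rewrite vE lte_fin ltNge v1.
have [c' c'N c'W] := greedy_path step W0.
exists c' => // i f Di fact; apply: contrapT => H.
have agree l : (l < J i f)%N -> c' l = c i f l.
  by move=> lJ; apply/eqP; apply: contrapT => /negP h; apply: H; exists l.
have := le_lt_trans (nu_le (mkseq c' (J i f)) i Di) (c'W (J i f)).
rewrite lte_fin ltNge => /negP; apply.
rewrite /nu (bigD1 f) //= cylinder_weight_in // lerDl.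
by apply: sumr_ge0 => f' _; exact: cylinder_weight_ge0.
Qed.

End GreedyPath.

(** * Lower bound for the Bowen entropy of the irregular set *)

Section BowenEntropyLower.
Context {R : realType} {k : nat} (B : 'I_k.+2 -> 'M[int]_2).
Hypothesis B_gt0 : forall i p q, 0 < B i p q.
Hypothesis B_det : forall i, `|B i 0 0 * B i 1 1 - B i 1 0 * B i 0 1| = 1.
Variable X : set (full_shift k).
Hypothesis subX : subshift X.
Implicit Types (w : full_shift k) (m n N q G : nat) (x y : torus R).

Local Notation S := (@entry_bound R k B).
Local Notation torus_iter := (@torus_iter R k B).
Local Notation cocycle_sum := (@cocycle_sum R k B).
Local Notation birkhoff := (@birkhoff R k B).

Lemma mdist_le_bowen w n i x y : (i < n)%N ->
  mdist (torus_iter i w x) (torus_iter i w y) <=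
  bowen_dist (@left_shift k) (torus_skew B) w n x y.
Proof.
move=> in_; rewrite /bowen_dist.
exact: (le_bigmax_cond 0 (fun i : 'I_n => mdist (torus_iter i w x) (torus_iter i w y))
  (isT : xpredT (Ordinal in_))).
Qed.

Lemma bowen_dist_lt w n x y (e : R) : 0 < e ->
  (forall i, (i < n)%N -> mdist (torus_iter i w x) (torus_iter i w y) < e) ->
  bowen_dist (@left_shift k) (torus_skew B) w n x y < e.
Proof.
move=> e0 h; rewrite /bowen_dist; apply/bigmax_ltP; split => // i _.
exact: h.
Qed.

(** With $\varepsilon=1/(32S)$ the targets are $4\varepsilon$ apart and each tracing loses at most
    $\varepsilon$; the remaining $2\varepsilon$ forbids a common Bowen ball of radius $\varepsilon$.
    The window has length [n'.+1] because the separation may occur at time [n'] itself. *)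
Lemma trace_separates w n' G (z z' : nat -> torus R) x x' l (c c' : nat) :
  3 * S / 2 ^+ G <= (32 * S)^-1 ->
  traces B n'.+1 G w z x -> traces B n'.+1 G w z' x' ->
  let w' := shift_iter (l * (n'.+1 + G.*2) + G) w in
  z l = segment_point B n' w' c -> z' l = segment_point B n' w' c' -> c != c' ->
  c%:R <= cocycle_sum n' w' / 2 -> c'%:R <= cocycle_sum n' w' / 2 ->
  exists2 i, (i < l.+1 * (n'.+1 + G.*2))%N &
    2 * (32 * S)^-1 <= mdist (torus_iter i w x) (torus_iter i w x').
Proof.
move=> Gd tr tr' w' zl zl' cc' cL cL'.
have S4 := @entry_bound_ge4 R k B B_gt0.
have [i iN sep] := segment_point_separated B_gt0 cc' cL cL'.
exists (l * (n'.+1 + G.*2) + (G + i))%N.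
  have aux (u v s r : nat) : (s <= v)%N -> (u + (r + s) < v.+1 + r.*2 + u)%N by clear; lia.
  by rewrite mulSn; exact: aux.
have := tr l i iN; have := tr' l i iN; rewrite zl zl' -/w'.
set a := torus_iter _ w x; set a' := torus_iter _ w x'.
set b := torus_iter i w' _ in sep *; set b' := torus_iter i w' _ in sep *.
move=> h' h; have := metric_triangle b a b'; have := metric_triangle a a' b'.
rewrite [mdist b a]metric_sym.
have e0 : 0 < (32 * S)^-1 by rewrite invr_gt0 mulr_gt0 // (lt_le_trans _ S4).
have SE : (8 * S)^-1 = 4 * (32 * S)^-1 by field; rewrite lt0r_neq0 // (lt_le_trans _ S4).
move: sep h h' Gd; rewrite SE; move: ((32 * S)^-1) (3 * S / 2 ^+ G) => d d'.
by move: (mdist b b') (mdist a b) (mdist a' b') (mdist a a') (mdist a b') => *; lra.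
Qed.

Section Lower.
Variables (phi : full_shift k * torus R -> R) (a b lam : R).
Hypothesis phi_mod : uniform_modulus X phi.
Hypothesis phi_bd : exists K, forall w x, X w -> `|phi (w, x)| <= K.
Hypothesis ba : b < a.
Hypothesis phi_spread : spread_averages B X phi a b.
Hypothesis lam_gt0 : 0 < lam.
Hypothesis lam_rate : forall eta, 0 < eta ->
  exists N0, forall N w, (N0 < N)%N -> X w ->
    expR ((lam - eta) * N%:R) <= cocycle_sum N w <= expR ((lam + eta) * N%:R).

Local Notation Irr w := [set x | ~ regular B phi w x].
Local Notation eps := (32 * S)^-1.

Lemma prod_weight_le q (N1 : nat) (r : R) J : 0 < r -> r <= N1%:R -> (0 < N1)%N ->
  \prod_(l < J) (if (q %| l)%N then 1%N else N1)%:R^-1 <=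
  r^-1 ^+ (J - \sum_(l < J) (q %| l))%N.
Proof.
move=> r0 rN N10.
have cnt I : (\sum_(l < I) (q %| l) <= I)%N.
  rewrite -[leqRHS]card_ord -sum1_card; apply: leq_sum => i _; exact: leq_b1.
elim: J => [|J IH]; first by rewrite !big_ord0.
rewrite !big_ord_recr /=; case: (q %| J)%N.
  by rewrite addn1 subSS invr1 mulr1.
rewrite addn0 subSn ?cnt // exprSr; apply: ler_pM => //.
  by apply: prodr_ge0 => i _; rewrite invr_ge0.
by rewrite lef_pV2 ?posrE ?ltr0n.
Qed.

(** A mass distribution argument: a ball of order [m] determines, for each kind, the first [m %/ M]
    symbols of all codes whose point it contains, and such a cylinder has measure at most
    [C * expR (- (t * m))]. A cover of weight below $1/(3C)$ would leave some code outside all these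
    cylinders, although the irregular point of that code lies in one of the balls. *)
Lemma bowen_premeasure_irregular w (t : R) : X w -> 0 <= t < lam ->
  exists2 c : R, 0 < c &
    (c%:E <= bowen_premeasure (@left_shift k) (torus_skew B) (Irr w) t w 0 eps)%E.
Proof.
move=> Xw /andP[t0 tlam].
have S4 := @entry_bound_ge4 R k B B_gt0.
have S0 : 0 <= S by exact: le_trans S4.
have e0 : 0 < eps by rewrite invr_gt0 mulr_gt0 // (lt_le_trans _ S4).
(* Midway between [t] and [lam]: the distance to [lam] pays for the gaps, the distance to [t] for
   the blocks that carry no choice. *)
pose kap := (t + lam) / 2.
have kapE : 2 * kap = t + lam by rewrite /kap; field.
have tk : 0 < kap - t by lra.
have k0 : 0 < kap by lra.
(* Large enough that losing a proportion $1/q$ of the rate [kap] still leaves at least [t]. *)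
pose q := (Num.truncn (kap / (kap - t))).+1.
have qR : (0 : R) < q%:R by [].
have qE : kap <= (kap - t) * q%:R.
  by rewrite mulrC -ler_pdivrMr //; exact: ltW (truncnS_gt _).
have [G [eta [Delta0 [K [G0 Gd eta0 [phiK phiG] [n1 n1E]]]]]] :=
  controlled_blocks phi_mod phi_bd ba phi_spread (ltn0Sn _ : (0 < q)%N) e0.
pose eta' := (lam - kap) / 2.
have eta'0 : 0 < eta' by rewrite divr_gt0 //; lra.
have [N0 N0E] := lam_rate eta'0.
(* Accounts for the steps of a block beyond [n'] and for the factor 2 in the admissible number of
   segment points. *)
pose C1 := kap * (1 + 2 * G%:R) + ln 2.
pose n' := maxn (maxn n1 N0.+1) (Num.truncn (C1 / eta')).+1.
have n'1 : (n1 < n'.+1)%N by rewrite ltnS !leq_max leqnn.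
have n'N0 : (N0 < n')%N by rewrite /n' !leq_max ltnSn orbT.
have n'C : C1 <= eta' * n'%:R.
  rewrite mulrC -ler_pdivrMr //; apply: le_trans (ltW (truncnS_gt _)) _.
  by rewrite ler_nat leq_max leqnn orbT.
have [gap ext] := n1E n'.+1 n'1.
set M := (n'.+1 + G.*2)%N.
have MR : M%:R = n'%:R + (1 + 2 * G%:R) :> R.
  by rewrite natrD -natr1 -muln2 natrM; ring.
have M0 : (0 < M)%N by [].
pose E := expR (kap * M%:R).
have E0 : 0 < E by exact: expR_gt0.
have E_le w' : X w' -> E <= cocycle_sum n' w' / 2.
  move=> Xw'; have /andP[h _] := N0E n' w' n'N0 Xw'.
  rewrite ler_pdivlMr //; apply: le_trans h.
  have -> : E * 2 = expR (kap * M%:R + ln 2) by rewrite expRD lnK ?posrE.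
  rewrite ler_expR MR.
  have -> : lam - eta' = kap + eta' by rewrite /eta'; field.
  by move: n'C; rewrite /C1; lra.
pose N1 := (Num.truncn E).+1.
have EN1 : E <= N1%:R by exact: ltW (truncnS_gt _).
(* A controlled block admits a single symbol, a free one [N1] symbols. *)
pose Nl l := if (q %| l)%N then 1%N else N1.
have Nl0 l : (0 < Nl l)%N by rewrite /Nl; case: ifP.
have Nl_le c l w' : (c < Nl l)%N -> X w' -> c%:R <= cocycle_sum n' w' / 2.
  move=> cN Xw'; apply: le_trans (E_le w' Xw').
  have cE : (c <= Num.truncn E)%N.
    by move: cN; rewrite /Nl; case: ifP => _; rewrite ltnS // leqn0 => /eqP ->.
  by apply: (@le_trans _ _ (Num.truncn E)%:R); rewrite ?ler_nat // truncn_le ltW.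
pose wl l := shift_iter (l * M + G) w.
have Xwl l : X (wl l) by exact: subshift_iter.
have zex j : exists z : torus R * torus R, Delta0 * n'.+1%:R <=
    birkhoff phi n'.+1 (wl j) z.1 - birkhoff phi n'.+1 (wl j) z.2.
  by have [xa [xb h]] := ext (wl j) (Xwl j); exists (xa, xb).
have [zc zcE] := choice zex.
pose z (c : nat -> nat) (p : bool) j := if (q %| j)%N
  then (if p then (zc j).1 else (zc j).2) else segment_point B n' (wl j) (c j).
have ones2S : 2 * S <= coord_sum (S *: @ones R) by rewrite coord_sumZ coord_sum_ones mulrC.
have Yex (cf : (nat -> nat) * option bool) : exists x,
    traces B n'.+1 G w (fun j => z cf.1 (odflt (phase j) cf.2) j) x.
  have [s _ tr] := @specification R k B B_gt0 B_det w n'.+1 G 0 (S *: @ones R)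
    (fun j => z cf.1 (odflt (phase j) cf.2) j) G0
    (pos_coneZ S0 (@ones_pos R)) (core_coneZ S0 (ones_core B_gt0)) ones2S.
  by exists (torus_pi (0 + s *: (S *: @ones R))).
have [Y YE] := choice Yex.
have Yirr c : exists f, Irr w (Y (c, f)).
  apply: (@some_irregular R k B X subX phi K eta (Delta0 * n'.+1%:R) n'.+1 G q w (z c)
    (fun f => Y (c, f)) _ _ eta0 phiK phiG Xw gap) => //.
  - by move=> j qj; rewrite /z (negbTE qj).
  - by move=> j qj; rewrite /z qj; exact: zcE.
  - by move=> f; exact: YE (c, f).
pose ball m x := bowen_ball (@left_shift k) (torus_skew B) m w x eps.
have determined m x f c c' l : (forall l, (c l < Nl l)%N) -> (forall l, (c' l < Nl l)%N) ->
    ball m x (Y (c, f)) -> ball m x (Y (c', f)) -> (l < m %/ M)%N -> c l = c' l.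
  move=> cN c'N bc bc' lm; have [ql|ql] := boolP (q %| l)%N.
    by move: (cN l) (c'N l); rewrite /Nl ql !ltnS !leqn0 => /eqP -> /eqP ->.
  apply/eqP; apply: contrapT => /negP cc'.
  have [||i iM sep] := trace_separates (l := l) Gd (YE (c, f)) (YE (c', f)) _ _ cc'
      (Nl_le _ _ _ (cN l) (Xwl l)) (Nl_le _ _ _ (c'N l) (Xwl l)).
  - by rewrite /= /z (negbTE ql).
  - by rewrite /= /z (negbTE ql).
  have im : (i < m)%N.
    apply: leq_trans iM _; apply: leq_trans (leq_trunc_div m M).
    by rewrite leq_mul2r lm orbT.
  have := le_lt_trans (mdist_le_bowen w x (Y (c, f)) im) bc.
  have := le_lt_trans (mdist_le_bowen w x (Y (c', f)) im) bc'.
  have := metric_triangle (torus_iter i w (Y (c, f))) (torus_iter i w x)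
    (torus_iter i w (Y (c', f))).
  rewrite [mdist _ (torus_iter i w x)]metric_sym => h1 h2 h3.
  by move: sep h1 h2 h3; move: (mdist _ _) (mdist _ _) (mdist _ _) eps => *; lra.
(* Covers the incomplete last block and the one extra controlled block due to rounding. *)
pose C := expR ((t + kap) * M%:R).
have weight m : \prod_(l < m %/ M) (Nl l)%:R^-1 <= C * expR (- (t * m%:R)).
  apply: le_trans (prod_weight_le q (m %/ M) E0 EN1 (ltn0Sn _)) _.
  rewrite -expRN -expRM_natr -expRD ler_expR.
  set J := (m %/ M)%N; set u := \sum_(l < J) _.
  have uJ : (u <= J)%N.
    rewrite -[leqRHS]card_ord -sum1_card; apply: leq_sum => i _; exact: leq_b1.
  have uq : u%:R <= J%:R / q%:R + 1 :> R.
    have -> : u = ((J + q.-1) %/ q)%N by exact: dvdn_countE.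
    have -> : J%:R / q%:R + 1 = (J + q)%:R / q%:R :> R.
      by rewrite natrD mulrDl divff // lt0r_neq0.
    rewrite ler_pdivlMr // -natrM ler_nat.
    by apply: leq_trans (leq_trunc_div _ _) _; rewrite leq_add2l /q.
  have mM : m%:R <= J%:R * M%:R + M%:R :> R.
    by rewrite -natrM -natrD ler_nat -mulSnr ltnW // ltn_ceil.
  have MR0 : (0 : R) < M%:R by [].
  have h1 : t * m%:R <= t * (J%:R * M%:R + M%:R) by rewrite ler_wpM2l.
  have h2 : kap * M%:R * u%:R <= kap * M%:R * (J%:R / q%:R + 1).
    by rewrite ler_wpM2l // mulr_ge0 // ltW.
  have h3 : kap * (J%:R / q%:R) * M%:R <= (kap - t) * J%:R * M%:R.
    rewrite ler_wpM2r //.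
    have -> : kap * (J%:R / q%:R) = J%:R / q%:R * kap by rewrite mulrC.
    rewrite [leRHS]mulrC -mulrA ler_wpM2l // ler_pdivrMl // mulrC.
    exact: qE.
  rewrite natrB //; move: h1 h2 h3; lra.
have C0 : 0 < C by exact: expR_gt0.
exists (3 * C)^-1; first by rewrite invr_gt0 mulr_gt0.
apply: le_ereal_inf_tmp => _ [D [x [nn [cover _ ->]]]].
rewrite leNgt; apply/negP => small.
(* Records whether the ball contains a point of kind [f] at all; if so, any one such code fixes the
   cylinder to be avoided. *)
pose act i f := `[< exists2 c, (forall l, (c l < Nl l)%N) & ball (nn i) (x i) (Y (c, f)) >].
have cex (i : nat) (f : option bool) : exists c, act i f ->
    (forall l, (c l < Nl l)%N) /\ ball (nn i) (x i) (Y (c, f)).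
  have [/asboolP [c cN cb]|na] := pselect (act i f); first by exists c.
  by exists (fun=> 0%N).
have cexF (i : nat) : exists c : option bool -> nat -> nat, forall f, act i f ->
    (forall l, (c f l < Nl l)%N) /\ ball (nn i) (x i) (Y (c f, f)).
  by have [c cE] := choice (cex i); exists c.
have [ci ciE] := choice cexF.
have [|c' c'N c'E] := @avoid_cylinders R Nl Nl0 D (option bool) act ci (fun i _ => (nn i %/ M)%N).
  apply: (@le_lt_trans _ _ (\esum_(i in D) ((3 * C)%:E * (expR (- (t * (nn i)%:R)))%:E)))%E.
    apply: le_esum => i Di; rewrite -EFinM lee_fin.
    apply: (@le_trans _ _ (\sum_(f : option bool | act i f) C * expR (- (t * (nn i)%:R)))).
      by apply: ler_sum => f _; exact: weight.
    rewrite big_mkcond /=.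
    apply: (@le_trans _ _ (\sum_(f : option bool) C * expR (- (t * (nn i)%:R)))).
      by apply: ler_sum => f _; case: ifP => // _; rewrite mulr_ge0 ?expR_ge0.
    by rewrite sumr_const card_option card_bool -[leLHS]mulr_natl mulrA.
  apply: le_lt_trans (esum_scale_le _ _ _) _; first by rewrite mulr_ge0 ?expR_ge0.
    by move=> i; rewrite lee_fin expR_ge0.
  move: small; set s := \esum_(i in D) _ => small.
  have s0 : (0 <= s)%E by apply: esum_ge0 => i _; rewrite lee_fin expR_ge0.
  have [v vE] : exists v, s = v%:E.
    by exists (fine s); rewrite fineK // ge0_fin_numE // (lt_trans small) // ltry.
  move: small; rewrite vE -EFinM !lte_fin -[(3 * C)^-1]mulr1 ltr_pdivlMl //.
  by rewrite mulr_gt0.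
have [f irr] := Yirr c'.
have [i Di bi] := cover _ irr.
have acti : act i f by apply/asboolP; exists c'.
have [l lJ /eqP] := c'E i f Di acti; apply.
have [ciN cib] := ciE i f acti.
exact: determined c'N ciN bi cib lJ.
Qed.

Lemma bowen_entropy_irregular_ge w : X w ->
  (lam%:E <= bowen_entropy (@left_shift k) (torus_skew B) (Irr w) w)%E.
Proof.
move=> Xw; have S4 := @entry_bound_ge4 R k B B_gt0.
have e0 : 0 < eps by rewrite invr_gt0 mulr_gt0 // (lt_le_trans _ S4).
apply: (@le_trans _ _ (bowen_entropy_at (@left_shift k) (torus_skew B) (Irr w) w eps)); last first.
  by apply: ereal_sup_ubound; exists eps.
apply: le_ereal_inf_tmp => _ [s s0 <-]; rewrite lee_fin leNgt; apply/negP => slam.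
(* A negative [s] is replaced by 0; with [N = 0] the comparison factor between the two exponents is
   1. *)
pose t := Num.max s 0.
have t01 : 0 <= t < lam by rewrite le_max lexx orbT /= gt_max slam.
have [c c0 cle] := bowen_premeasure_irregular Xw t01.
have st : s <= t by rewrite le_max lexx.
have := bowen_premeasure_shift (@left_shift k) (torus_skew B) (Irr w) w 0 eps st.
rewrite mulr0 oppr0 expR0 mul1e => /(le_trans cle).
have := bowen_premeasure_le_measure (@left_shift k) (torus_skew B) (Irr w) s w 0 eps.
by rewrite s0 => /[swap] /le_trans /[apply]; rewrite lee_fin leNgt c0.
Qed.

End Lower.
End BowenEntropyLower.

(** * Upper bound for the Bowen entropy and counts of separated sets *)

Section FiberEntropyValue.
Context {R : realType} {k : nat} (B : 'I_k.+2 -> 'M[int]_2).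
Hypothesis B_gt0 : forall i p q, 0 < B i p q.
Hypothesis B_det : forall i, `|B i 0 0 * B i 1 1 - B i 1 0 * B i 0 1| = 1.
Variable X : set (full_shift k).
Implicit Types (w : full_shift k) (m n N : nat) (x y : torus R).

Local Notation S := (@entry_bound R k B).
Local Notation torus_iter := (@torus_iter R k B).
Local Notation cocycle_sum := (@cocycle_sum R k B).

Variable lam : R.
Hypothesis lam_rate : forall eta, 0 < eta ->
  exists N0, forall N w, (N0 < N)%N -> X w ->
    expR ((lam - eta) * N%:R) <= cocycle_sum N w <= expR ((lam + eta) * N%:R).

Lemma linear_dominates (C eta : R) : 0 < eta -> exists n0, forall n, (n0 < n)%N -> C <= eta * n%:R.
Proof.
move=> eta0; exists (Num.truncn (C / eta)) => n nn.
rewrite mulrC -ler_pdivrMr //; apply: le_trans (ltW (truncnS_gt _)) _.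
by rewrite ler_nat.
Qed.

(** Balls of a single large order [n] are enough: a constant times [expR ((lam + e / 2) * n)] of
    them, each of weight [expR (- ((lam + e) * n))]. *)
Lemma bowen_entropy_le w (Z : set (torus R)) : X w ->
  (bowen_entropy (@left_shift k) (torus_skew B) Z w <= lam%:E)%E.
Proof.
move=> Xw; apply: ge_ereal_sup => _ [eps /= eps0 <-].
apply/lee_addgt0Pr => e e0; rewrite -EFinD.
apply: ereal_inf_lbound; exists (lam + e) => //=.
apply/eqP; rewrite eq_le; apply/andP; split; last first.
  apply: le_trans (bowen_premeasure_ge0 (@left_shift k) (torus_skew B) Z (lam + e) w 0 eps) _.
  exact: bowen_premeasure_le_measure.
rewrite /bowen_measure.
rewrite (cvg_lim _ (ereal_nondecreasing_cvgn
  (@bowen_premeasure_nd _ _ _ (@left_shift k) (torus_skew B) Z (lam + e) w eps))) //.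
apply: ge_ereal_sup => _ [N _ <-]; apply/lee_addgt0Pr => d d0; rewrite add0e.
have [K K0 cov] := bowen_cover B_gt0 B_det eps0.
have e2 : 0 < e / 2 by rewrite divr_gt0.
have [N0 N0E] := lam_rate e2.
have [n0 n0E] := linear_dominates (ln (K / d)) e2.
pose n := (maxn N (maxn N0 n0)).+1.
have nN : (N <= n)%N by rewrite ltnW // ltnS leq_max leqnn.
have nN0 : (N0 < n)%N by rewrite ltnS !leq_max leqnn orbT.
have nn0 : (n0 < n)%N by rewrite ltnS !leq_max leqnn !orbT.
have [s ssize scov] := cov n w.
have /andP[_ Lam] := N0E n w nN0 Xw.
apply: (@le_trans _ _ (\esum_(i in `I_(size s)) (expR (- ((lam + e) * n%:R)))%:E)%E).
  apply: ereal_inf_lbound; exists `I_(size s), (nth point s), (fun=> n); split => //.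
  move=> y _; have [x xs xy] := scov y; exists (index x s) => /=.
    by rewrite index_mem.
  rewrite /bowen_ball /= nth_index //; apply: bowen_dist_lt => // i in_.
  by apply: xy; exact: ltnW.
rewrite esum_fset //.
rewrite -fsbig_ord sumEFin lee_fin sumr_const card_ord -[leLHS]mulr_natl.
apply: (@le_trans _ _ (K * expR ((lam + e / 2) * n%:R) * expR (- ((lam + e) * n%:R)))).
  rewrite ler_wpM2r ?expR_ge0 //; apply: le_trans ssize _.
  by rewrite ler_wpM2l // ltW.
rewrite -mulrA -expRD.
have -> : (lam + e / 2) * n%:R + - ((lam + e) * n%:R) = - (e / 2 * n%:R) by field.
rewrite expRN ler_pdivrMr ?expR_gt0 // -ler_pdivrMl // mulrC.
have Kd : 0 < K / d by rewrite divr_gt0.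
by rewrite -[leLHS]lnK ?posrE // ler_expR; exact: n0E.
Qed.

Lemma max_separated_le (eps : R) : 0 < eps -> exists2 K : R, 0 < K & forall n w,
  (max_separated (@left_shift k) (torus_skew B) w eps n <= (K * cocycle_sum n w)%:E)%E.
Proof.
move=> eps0; have e2 : 0 < eps / 2 by rewrite divr_gt0.
have [K K0 cov] := bowen_cover B_gt0 B_det e2; exists K => // n w.
apply: ge_ereal_sup => _ [Q sepQ <-]; rewrite lee_fin.
have [s ssize scov] := cov n w; apply: le_trans ssize; rewrite ler_nat.
have gex y : exists x, x \in s /\ forall i, (i <= n)%N ->
    mdist (torus_iter i w x) (torus_iter i w y) < eps / 2.
  by have [x xs xy] := scov y; exists x.
have [g gE] := choice gex.
have -> : size Q = size (map g Q) by rewrite size_map.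
apply: uniq_leq_size; last by move=> _ /mapP[y _ ->]; case: (gE y).
rewrite map_inj_in_uniq ?fset_uniq // => y y' yQ y'Q gyy'.
apply/eqP; apply: contrapT => /negP yy'.
have := sepQ y y' yQ y'Q yy'; apply/negP; rewrite -leNgt ltW //.
apply: bowen_dist_lt => // i in_.
have [_ h] := gE y; have [_ h'] := gE y'.
have {}h := h i (ltnW in_); have {}h' := h' i (ltnW in_); rewrite -gyy' in h'.
apply: le_lt_trans (metric_triangle _ (torus_iter i w (g y)) _) _.
by rewrite [ltRHS]splitr; apply: ltrD => //; rewrite metric_sym.
Qed.

(** Segment points separate at some time up to [n] inclusive, which the Bowen distance of order
    [n.+1] sees. *)
Lemma max_separated_ge (eps : R) n w : 0 < eps -> eps < (8 * S)^-1 ->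
  ((cocycle_sum n w / 2)%:E <=
    max_separated (@left_shift k) (torus_skew B) w eps n.+1)%E.
Proof.
move=> eps0 eps8.
have L2 := @cocycle_sum_ge R k B B_gt0 n w.
pose N := (Num.truncn (cocycle_sum n w / 2)).+1.
pose s : seq (torus R) := [seq segment_point B n w c | c <- iota 0 N].
have cN c : c \in iota 0 N -> c%:R <= cocycle_sum n w / 2.
  rewrite mem_iota add0n leq0n /= ltnS => cN.
  apply: (@le_trans _ _ (Num.truncn (cocycle_sum n w / 2))%:R); first by rewrite ler_nat.
  by rewrite truncn_le divr_ge0 //; lra.
have sep c c' : c \in iota 0 N -> c' \in iota 0 N -> c != c' ->
    eps < bowen_dist (@left_shift k) (torus_skew B) w n.+1
      (segment_point B n w c) (segment_point B n w c').
  move=> /cN cs /cN c's cc'.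
  have [i iN h] := segment_point_separated B_gt0 cc' cs c's.
  apply: lt_le_trans eps8 _; apply: le_trans h _.
  by apply: mdist_le_bowen; rewrite ltnS.
have us : uniq s.
  rewrite map_inj_in_uniq ?iota_uniq // => c c' cs c's e.
  apply/eqP; apply: contrapT => /negP cc'; have := sep c c' cs c's cc'.
  apply/negP; rewrite -leNgt e; apply: ltW; apply: bowen_dist_lt => // i _.
  by rewrite mdistxx.
apply: (@le_trans _ _ N%:R%:E); first by rewrite lee_fin; exact: ltW (truncnS_gt _).
apply: ereal_sup_ubound; exists (seq_fset tt s).
  move=> x y; rewrite !seq_fsetE => /mapP[c cs ->] /mapP[c' c's ->] ne.
  by apply: sep => //; apply: contraNneq ne => ->.
by rewrite size_seq_fset undup_id // size_map size_iota.
Qed.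

End FiberEntropyValue.

Section IntegralMonotone.
Local Open Scope ereal_scope.
Context d (T : measurableType d) (R : realType) (mu : {measure set T -> \bar R}).

(* The integral of a nonnegative function, measurable or not, is the supremum of
   the integrals of the simple functions below it. *)
Lemma ge0_integral_mono (D : set T) (f g : T -> \bar R) : (forall x, D x -> 0 <= f x) ->
  (forall x, D x -> f x <= g x) -> \int[mu]_(x in D) f x <= \int[mu]_(x in D) g x.
Proof.
move=> f0 fg; have g0 x : D x -> 0 <= g x by move=> Dx; exact: le_trans (f0 x Dx) (fg x Dx).
rewrite !ge0_integralE //; apply: ereal_sup_le => _ [h hf <-]; exists h => // x.
apply: le_trans (hf x) _; rewrite !patchE; case: ifPn => // xD.
by apply: fg; rewrite inE in xD.
Qed.

End IntegralMonotone.

(** * The fiber entropy equals the growth rate *)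

Section FiberEntropyEqual.
Context {R : realType} {k : nat} (B : 'I_k.+2 -> 'M[int]_2).
Hypothesis B_gt0 : forall i p q, 0 < B i p q.
Hypothesis B_det : forall i, `|B i 0 0 * B i 1 1 - B i 1 0 * B i 0 1| = 1.
Variables (X : set (full_shift k)) (P : probability (borel (full_shift k)) R).
Hypothesis closedX : closed X.
Hypothesis PX : P X = 1%E.

Local Notation S := (@entry_bound R k B).
Local Notation cocycle_sum := (@cocycle_sum R k B).

Variable lam : R.
Hypothesis lam_gt0 : 0 < lam.
Hypothesis lam_rate : forall eta, 0 < eta ->
  exists N0, forall N w, (N0 < N)%N -> X w ->
    expR ((lam - eta) * N%:R) <= cocycle_sum N w <= expR ((lam + eta) * N%:R).

Lemma lne_max_separated_rate (eps eta : R) : 0 < eps -> eps < (8 * S)^-1 -> 0 < eta ->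
  exists n0, forall n w, (n0 < n)%N -> X w ->
    (((lam - eta) * n%:R)%:E <=
       lne (max_separated (@left_shift k) (torus_skew B) w eps n) <=
     ((lam + eta) * n%:R)%:E)%E.
Proof.
move=> eps0 eps8 eta0; have e2 : 0 < eta / 2 by rewrite divr_gt0.
have [K K0 up] := max_separated_le B_gt0 B_det eps0.
have [N0 N0E] := lam_rate e2.
have [n1 n1E] := linear_dominates (ln K) e2.
(* The term [lam] pays for the shift by one in the order of the Bowen distance, [ln 2] for the
   halved count of segment points. *)
have [n2 n2E] := linear_dominates (ln 2 + lam) e2.
exists (maxn N0.+1 (maxn n1 n2)) => -[//|n] w; rewrite !gtn_max => /andP[nN0 /andP[nn1 nn2]] Xw.
have /andP[lo _] := N0E n w nN0 Xw.
have /andP[_ hi] := N0E n.+1 w (ltnW nN0) Xw.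
have L2 := @cocycle_sum_ge R k B B_gt0 n w.
have := max_separated_ge B_gt0 n w eps0 eps8; have := up n.+1 w.
move: (max_separated _ _ _ _ _) => Z.
have lnZ (r : R) : Z = r%:E -> 0 < r -> lne Z = (ln r)%:E.
  by move=> -> r0; rewrite lne_EFin.
case: Z lnZ => [r|//|//] lnZ; rewrite !lee_fin => rK rL.
have r0 : 0 < r by lra.
rewrite (lnZ r) // !lee_fin; apply/andP; split; rewrite -ler_expR lnK ?posrE //.
  apply: le_trans rL; rewrite ler_pdivlMr //; apply: le_trans lo.
  have -> : expR ((lam - eta) * n.+1%:R) * 2 = expR ((lam - eta) * n.+1%:R + ln 2).
    by rewrite expRD lnK ?posrE.
  rewrite ler_expR; move: (n2E n.+1 nn2); rewrite -[n.+1%:R]natr1.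
  by move: (n%:R) (ln 2) => z z2; lra.
apply: le_trans rK _.
have -> : K * cocycle_sum n.+1 w = expR (ln K) * cocycle_sum n.+1 w by rewrite lnK ?posrE.
apply: (@le_trans _ _ (expR (ln K) * expR ((lam + eta / 2) * n.+1%:R))).
  by rewrite ler_wpM2l ?expR_ge0.
rewrite -expRD ler_expR; move: (n1E n.+1 nn1).
by move: (n.+1%:R) => z; lra.
Qed.

(** Below the scale $1/(8S)$ separated sets already grow at the rate [lam], uniformly over [X]; the
    outer limit is that of an eventually constant function. *)
Lemma fiber_entropyE :
  fiber_entropy P X (@left_shift k) (torus_skew B : full_shift k -> torus R -> torus R) = lam%:E.
Proof.
have S4 := @entry_bound_ge4 R k B B_gt0.
have e8 : 0 < (8 * S)^-1 by rewrite invr_gt0 mulr_gt0 // (lt_le_trans _ S4).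
apply: lim_near_cst; first exact: ereal_hausdorff.
near=> eps.
have eps0 : 0 < eps by near: eps; exact: nbhs_right_gt.
have eps8 : eps < (8 * S)^-1 by near: eps; exact: nbhs_right_lt.
have mX : measurable (X : set (borel (full_shift k))) by exact: measurable_closed.
set u := (X in limn_esup X).
(* The bound [eta <= lam] keeps the lower constant nonnegative, so that integrals can be compared by
   monotonicity alone. *)
have uE eta : 0 < eta -> eta <= lam -> exists n0, forall n, (n0 < n)%N ->
    ((lam - eta)%:E <= u n <= (lam + eta)%:E)%E.
  move=> eta0 etal; have [n0 n0E] := lne_max_separated_rate eps0 eps8 eta0.
  exists n0 => n nn0; have nR : (0 : R) < n%:R by rewrite ltr0n (leq_ltn_trans _ nn0).
  have int_cst (r : R) : ((n%:R^-1)%:E * \int[P]_(w in X) (r * n%:R)%:E = r%:E)%E.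
    have -> : (\int[P]_(w in X) (r * n%:R)%:E = (r * n%:R)%:E * P X)%E by exact: integral_cst.
    rewrite PX mule1 -EFinM mulrCA mulVf ?mulr1 //.
    exact: lt0r_neq0.
  have pos : forall w, X w -> (0 <= lne (max_separated (@left_shift k) (torus_skew B) w eps n))%E.
    move=> w Xw; have /andP[h _] := n0E n w nn0 Xw; apply: le_trans h.
    by rewrite lee_fin mulr_ge0 // subr_ge0.
  apply/andP; split.
    rewrite -(int_cst (lam - eta)); apply: lee_wpmul2l; first by rewrite lee_fin invr_ge0.
    apply: ge0_integral_mono => w Xw; first by rewrite lee_fin mulr_ge0 // subr_ge0.
    by have /andP[] := n0E n w nn0 Xw.
  rewrite -(int_cst (lam + eta)); apply: lee_wpmul2l; first by rewrite lee_fin invr_ge0.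
  by apply: ge0_integral_mono => // w Xw; have /andP[] := n0E n w nn0 Xw.
suff /cvg_limn_einf_sup[_ ->] : u @ \oo --> lam%:E by [].
apply/fine_cvgP; split.
  have [n0 n0E] := uE lam lam_gt0 (lexx _); exists n0.+1 => // n /= nn0.
  by have /andP[h1 h2] := n0E n nn0; rewrite fin_numE; apply/andP; split; apply/eqP => h;
    move: h1 h2; rewrite h.
apply/cvgrPdist_le => e e0.
have m0 : 0 < Num.min e lam by rewrite lt_min e0.
have ml : Num.min e lam <= lam by rewrite ge_min lexx orbT.
have [n0 n0E] := uE _ m0 ml; exists n0.+1 => // n /= nn0.
have /andP[] := n0E n nn0; case: (u n) => [r|//|//]; rewrite !lee_fin /= => h1 h2.
have me : Num.min e lam <= e by rewrite ge_min lexx.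
rewrite distrC ler_distlC; apply/andP; split; lra.
Unshelve. all: by end_near. Qed.

End FiberEntropyEqual.

(** * Residuality and the theorem *)

Section Residual.
Context {R : realType} {k : nat} (B : 'I_k.+2 -> 'M[int]_2).
Hypothesis B_gt0 : forall i p q, 0 < B i p q.
Hypothesis B_det : forall i, `|B i 0 0 * B i 1 1 - B i 1 0 * B i 0 1| = 1.
Variable X : set (full_shift k).
Hypothesis subX : subshift X.
Implicit Types (w : full_shift k) (n N : nat) (x y : torus R)
  (phi : full_shift k * torus R -> R).

Local Notation S := (@entry_bound R k B).
Local Notation torus_iter := (@torus_iter R k B).
Local Notation cocycle := (@cocycle R k B).
Local Notation birkhoff := (@birkhoff R k B).

Lemma l1norm_cocycle n w (d : 'cV[R]_2) : l1norm (cocycle n w *m d) <= S ^+ n * l1norm d.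
Proof.
have S0 : 0 <= S by exact: le_trans (entry_bound_ge4 B_gt0).
elim: n => [|n IH] /=; first by rewrite mul1mx mul1r.
rewrite -mulmxA exprS -mulrA; apply: le_trans (_ : S * l1norm (cocycle n w *m d) <= _).
  set v := cocycle n w *m d; set i := shift_iter n w 0.
  have := @entry_sum_le R k B B_gt0 i; have [] := @entries_ge1 R k B B_gt0 i.
  rewrite /l1norm !real_mx_mulE.
  move: ((B i 0 0)%:~R) ((B i 0 1)%:~R) ((B i 1 0)%:~R) ((B i 1 1)%:~R).
  move: (v 0 0) (v 1 0) S S0 => x y s s0 a b c e a1 b1 c1 e1 sum_le.
  have a0 : 0 <= a by exact: le_trans a1.
  have b0 : 0 <= b by exact: le_trans b1.
  have c0 : 0 <= c by exact: le_trans c1.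
  have e0 : 0 <= e by exact: le_trans e1.
  have h1 := ler_normD (a * x) (b * y); have h2 := ler_normD (c * x) (e * y).
  rewrite !normrM !(ger0_norm a0) !(ger0_norm b0) !(ger0_norm c0) !(ger0_norm e0) in h1 h2.
  have h3 : (a + c) * `|x| <= s * `|x| by rewrite ler_wpM2r //; lra.
  have h4 : (b + e) * `|y| <= s * `|y| by rewrite ler_wpM2r //; lra.
  by lra.
by rewrite ler_wpM2l.
Qed.

Lemma torus_iter_lipschitz n w x y : mdist (torus_iter n w x) (torus_iter n w y) <=
  2 * S ^+ n * mdist x y.
Proof.
have S0 : 0 < S ^+ n by rewrite exprn_gt0 // (lt_le_trans _ (entry_bound_ge4 B_gt0)).
have C0 : 0 < 2 * S ^+ n by rewrite mulr_gt0.
rewrite -ler_pdivrMl // -[x]torus_reprK -[y]torus_reprK; apply: torus_mdist_ge => m.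
rewrite ler_pdivrMl // !torus_iter_pi.
have [m' m'E] := @cocycle_int R k B n w (- m).
apply: le_trans (torus_mdist_le_l1 _ _ m') _; rewrite -m'E -!mulmxBr.
have -> : torus_repr x - torus_repr y - map_mx intr (- m) =
    torus_repr x - torus_repr y + map_mx intr m :> 'cV[R]_2.
  by apply/colP => i; rewrite !mxE rmorphN opprK.
apply: le_trans (l1norm_cocycle _ _ _) _; rewrite [2 * _]mulrC -mulrA.
rewrite ler_wpM2l ?(ltW S0) //; set d := _ + _.
by have := coord_le_euclid_norm d 0; have := coord_le_euclid_norm d 1; rewrite /l1norm; lra.
Qed.

Lemma birkhoff_near phi n w x (e : R) : uniform_modulus X phi -> X w -> 0 < e ->
  exists2 r : R, 0 < r & forall y, mdist x y < r ->
    `|birkhoff phi n w x - birkhoff phi n w y| <= e.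
Proof.
move=> phi_mod Xw e0.
have en : 0 < e / n.+1%:R by rewrite divr_gt0.
have [m [d [d0 modE]]] := phi_mod _ en.
have S1 : 1 <= S by apply: le_trans (entry_bound_ge4 B_gt0); rewrite ler1n.
have C0 : 0 < 2 * S ^+ n by rewrite mulr_gt0 // exprn_gt0 // (lt_le_trans ltr01).
exists (d / (2 * S ^+ n)); first by rewrite divr_gt0.
move=> y; rewrite ltr_pdivlMr // => xy.
rewrite /birkhoff -sumrB; apply: le_trans (ler_norm_sum _ _ _) _.
apply: (@le_trans _ _ (\sum_(i < n) e / n.+1%:R)); last first.
  rewrite sumr_const card_ord -[leLHS]mulr_natr mulrAC ler_pdivrMr // ler_wpM2l ?(ltW e0) //.
  by rewrite ler_nat.
have Xi i : X (shift_iter i w) by exact: subshift_iter.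
apply: ler_sum => i _; apply: modE => //.
apply: le_trans (torus_iter_lipschitz _ _ _ _) _; apply: le_trans (ltW xy).
rewrite mulrC ler_wpM2l ?mdist_ge0 // ler_wpM2l //.
by rewrite ler_weXn2l // ltnW.
Qed.

Lemma nowhere_dense_avoid (A U : set (torus R)) :
  (forall x, U x -> exists2 r : R, 0 < r & forall y, mdist x y < r -> U y) ->
  (forall x (r : R), 0 < r -> exists2 y, mdist x y < r & U y) ->
  A `<=` ~` U -> nowhere_dense A.
Proof.
move=> oU dU AU; rewrite /nowhere_dense -subset0 => x /nbhs_mdist[r r0 rA].
have [y xy Uy] := dU x r r0; have [s s0 sU] := oU y Uy.
have /(_ _ (mdist_nbhs y s0)) := rA y xy.
by move=> [z [Az yz]]; exact: AU Az (sU z yz).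
Qed.

Variables (phi : full_shift k * torus R -> R) (a b : R).
Hypothesis phi_mod : uniform_modulus X phi.
Hypothesis phi_bd : exists K, forall w x, X w -> `|phi (w, x)| <= K.
Hypothesis ba : b < a.
Hypothesis phi_spread : spread_averages B X phi a b.

(** Exceeding [a - e] at some time after [N] is an open condition, dense by tracing; likewise
    falling below [b + e]. If all of them hold, a limit [l] of the averages would satisfy
    [a - 2 * e < l < b + 2 * e], which $4e=a-b$ excludes. *)
Lemma irregular_residual w : X w -> residual [set x | ~ regular B phi w x].
Proof.
move=> Xw; pose e := (a - b) / 4; have e0 : 0 < e by rewrite divr_gt0 // subr_gt0.
have ebE : 4 * e = a - b by rewrite /e; field.
pose U N := [set x | exists2 n, (N < n)%N & (a - e) * n%:R < birkhoff phi n w x].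
pose V N := [set x | exists2 n, (N < n)%N & birkhoff phi n w x < (b + e) * n%:R].
have openU N x : U N x -> exists2 r : R, 0 < r & forall y, mdist x y < r -> U N y.
  move=> [n Nn h]; have g0 : 0 < (birkhoff phi n w x - (a - e) * n%:R) / 2.
    by rewrite divr_gt0 // subr_gt0.
  have [r r0 rE] := birkhoff_near n x phi_mod Xw g0; exists r => // y /rE.
  by rewrite ler_norml => /andP[_ h2]; exists n => //; lra.
have openV N x : V N x -> exists2 r : R, 0 < r & forall y, mdist x y < r -> V N y.
  move=> [n Nn h]; have g0 : 0 < ((b + e) * n%:R - birkhoff phi n w x) / 2.
    by rewrite divr_gt0 // subr_gt0.
  have [r r0 rE] := birkhoff_near n x phi_mod Xw g0; exists r => // y /rE.
  by rewrite ler_norml => /andP[h2 _]; exists n => //; lra.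
have denseU N x (r : R) : 0 < r -> exists2 y, mdist x y < r & U N y.
  move=> r0; have high eta : 0 < eta -> exists n0, forall n w', (n0 < n)%N -> X w' ->
      exists x, (a - eta) * n%:R <= birkhoff phi n w' x.
    move=> /phi_spread[n0 h]; exists n0 => n w' nn Xw'; by case: (h n w' nn Xw').
  have [y [n [xy Nn h]]] := high_average_dense B_gt0 B_det subX N x phi_mod phi_bd high Xw r0 e0.
  by exists y => //; exists n.
have denseV N x (r : R) : 0 < r -> exists2 y, mdist x y < r & V N y.
  move=> r0; have high eta : 0 < eta -> exists n0, forall n w', (n0 < n)%N -> X w' ->
      exists x, (- b - eta) * n%:R <= birkhoff (fun z => - phi z) n w' x.
    move=> /phi_spread[n0 h]; exists n0 => n w' nn Xw'.
    have [_ [z zE]] := h n w' nn Xw'; exists z; rewrite birkhoffN.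
    have -> : (- b - eta) * n%:R = - ((b + eta) * n%:R) by ring.
    by rewrite lerN2.
  have bdN : exists K, forall w x, X w -> `|- phi (w, x)| <= K.
    by have [K h] := phi_bd; exists K => w' x'; rewrite normrN; exact: h.
  have [y [n [xy Nn]]] := high_average_dense B_gt0 B_det subX N x (uniform_modulusN phi_mod)
    bdN high Xw r0 e0.
  rewrite birkhoffN; have -> : (- b - e) * n%:R = - ((b + e) * n%:R) by ring.
  by rewrite ltrN2 => h; exists y => //; exists n.
have irr x : (forall N, U N x) -> (forall N, V N x) -> ~ regular B phi w x.
  move=> Ux Vx /regularP[l /(_ e e0) [J0 h]].
  have [n nJ hn] := Ux J0; have [m mJ hm] := Vx J0.
  have nR : (0 : R) < n%:R by rewrite ltr0n (leq_ltn_trans _ nJ).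
  have mR : (0 : R) < m%:R by rewrite ltr0n (leq_ltn_trans _ mJ).
  have := h n nJ; rewrite ler_norml => /andP[_]; rewrite lerBlDr -mulrDl => h1.
  have := h m mJ; rewrite ler_norml => /andP[+ _]; rewrite lerBrDr -mulNr -mulrDl => h2.
  have := lt_le_trans hn h1; rewrite ltr_pM2r // => h3.
  have := le_lt_trans h2 hm; rewrite ltr_pM2r // => h4.
  by lra.
(* [first_category] asks for an equality, so the nowhere dense sets are cut down to the regular
   points; the parity of [m] interleaves the two families. *)
pose G m := [set x | regular B phi w x /\ if odd m then ~ U m./2 x else ~ V m./2 x].
exists G; split.
  move=> m; case oddm : (odd m).
    apply: (nowhere_dense_avoid (openU m./2) (denseU m./2)).
    by move=> x [_]; rewrite oddm.
  apply: (nowhere_dense_avoid (openV m./2) (denseV m./2)).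
  by move=> x [_]; rewrite oddm.
apply/seteqP; split => [x /= /contrapT reg|x [m _ [reg _]] /=]; last exact.
apply: contrapT => nG; apply: (irr x _ _ reg) => N; apply: contrapT => nUV; apply: nG.
  have e1 : odd N.*2.+1 = true by rewrite /= odd_double.
  have e2 : (N.*2.+1)./2 = N by rewrite /= uphalf_double.
  by exists N.*2.+1 => //; rewrite /G e1 e2; split.
have e1 : odd N.*2 = false by rewrite odd_double.
by exists N.*2 => //; rewrite /G e1 doubleK; split.
Qed.

End Residual.

Theorem corollary6 (R : realType) (k : nat) (B : 'I_k.+2 -> 'M[int]_2)
    (B_gt0 : forall i p q, 0 < B i p q)
    (B_det : forall i, `|B i 0 0 * B i 1 1 - B i 1 0 * B i 0 1| = 1)
    (Omega_s : set (full_shift k)) (AR : arnoux_rauzy Omega_s)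
    (P : probability (borel (full_shift k)) R)
    (P_inv : unique_invariant_probability_on Omega_s P)
    (phi : full_shift k * torus R -> R)
    (phi_cont : {within Omega_s `*` [set: torus R], continuous phi}) :
  let F : full_shift k -> torus R -> torus R := fun w => toral_map (B (w 0)) in
  let I_phi := irregular_set (skew_product (@left_shift k) F)
                 (Omega_s `*` [set: torus R]) phi in
  let I_phi_at (w : full_shift k) := [set x | I_phi (w, x)] in
  I_phi !=set0 ->
  {ae P, forall w, Omega_s w ->
     bowen_entropy (@left_shift k) F (I_phi_at w) w =
       fiber_entropy P Omega_s (@left_shift k) F /\
     residual (I_phi_at w)} /\
  Omega_s `*` [set: torus R] `<=` closure I_phi.
Proof.
move=> F I_phi I_phi_at [[w0 x0] irr0].
have [[subX _ _] _] := AR; have closedX := subX.1.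
have phi_mod := continuous_uniform_modulus closedX phi_cont.
have phi_bd := uniform_modulus_bounded closedX phi_cont.
have IE w x : I_phi (w, x) <-> Omega_s w /\ ~ regular B phi w x by exact: irregular_setE.
have [Xw0 nreg0] := (IE w0 x0).1 irr0.
have [a [b [ba spread]]] :=
  irregular_spread B_gt0 B_det P_inv subX phi_mod phi_bd Xw0 nreg0.
have [lam lam0 lam_rate] := growth_rate B_gt0 P_inv subX.
have atE w : Omega_s w -> I_phi_at w = [set x | ~ regular B phi w x].
  by move=> Xw; apply/seteqP; split => x; rewrite /I_phi_at /= IE => // -[].
split.
  apply: aeW => w Xw; rewrite atE //; split; last first.
    exact (irregular_residual B_gt0 B_det subX phi_mod phi_bd ba spread Xw).
  rewrite (fiber_entropyE B_gt0 B_det closedX P_inv.1.1 lam0 lam_rate).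
  apply/eqP; rewrite eq_le; apply/andP; split.
    exact (bowen_entropy_le B_gt0 B_det lam_rate _ Xw).
  exact (bowen_entropy_irregular_ge B_gt0 B_det subX phi_mod phi_bd ba spread lam0 lam_rate Xw).
(* It suffices to move [x] inside the fiber over the same [w]. *)
move=> [w x] [/= Xw _] A [[U V] /= [/nbhs_singleton Uw /nbhs_mdist[r r0 rV]] UVA].
have [y xy irr] := irregular_dense B_gt0 B_det subX phi_mod phi_bd ba spread x Xw r0.
exists (w, y); split; first by apply/IE.
by apply: UVA; split => //=; exact: rV.
Qed.
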